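(* Let $d\ge 2$, let $E\subset[0,1]^d$ be compact, and let $K\subset\mathbb{R}^d$ be a bounded convex set, symmetric about the origin and with non-empty interior. Let $\sigma_K$ denote the Lebesgue (surface) measure on $\partial K$. (i) Suppose that there are $\gamma>0$ and $C>0$ such that $|\widehat{\sigma}_K(\xi)|\le C|\xi|^{-\gamma}$ for all $\xi\in\mathbb{R}^d\setminus\{0\}$, and that the Hausdorff dimension of $E$ is greater than $d-\gamma$. Then $\Delta_K(E)$ has positive Lebesgue measure. (ii) Suppose that there are $\gamma>0$ and $C>0$ such that $\int_{S^{d-1}}|\widehat{\sigma}_K(R\omega)|\,d\omega\le CR^{-\gamma}$ for all $R>0$, and that the Hausdorff dimension of $E$ is greater than $d-\gamma$. Then $\Delta_K(\rho E)$ has positive Lebesgue measure for almost every $\rho\in SO(d)$ (with respect to Haar measure). (iii) Suppose that there are $C>0$ and a convex function $\gamma:[0,\infty)\to\mathbb{R}$ with $\gamma(0)=0$ such that $|\widehat{\sigma}_K(\xi)|\le C\gamma(|\xi|^{-1})$ for all $\xi\in\mathbb{R}^d\setminus\{0\}$. Suppose also that there exists a non-zero finite Borel measure $\mu$ supported on $E$ such that $$\int_{\mathbb{R}^d}|\widehat{\mu}(\xi)|^2\,\gamma(|\xi|^{-1})\,d\xi<\infty.$$ Then $\Delta_K(E)$ has positive Lebesgue measure.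
   Context: For a bounded convex set $K\subset\mathbb{R}^d$, symmetric about the origin and with non-empty interior, $\|\cdot\|_K$ is the norm induced by $K$ (the norm whose unit ball is $K$, up to boundary points). The $K$-distance set of $E\subset\mathbb{R}^d$ is $\Delta_K(E)=\{\|x-y\|_K: x,y\in E\}\subset[0,\infty)$; ''Lebesgue measure'' of $\Delta_K(E)$ means one-dimensional Lebesgue measure. For a finite Borel measure $\mu$, $\widehat{\mu}(\xi)=\int e^{-2\pi i x\cdot\xi}\,d\mu(x)$. $d\omega$ is surface measure on the unit sphere $S^{d-1}$. *)

(* Defs.v *)
From HB Require Import structures.
From mathcomp Require Import all_boot all_order all_algebra.
From mathcomp Require Import complex.
From mathcomp Require Import all_classical all_reals all_analysis.

Set Implicit Arguments.
Unset Strict Implicit.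
Unset Printing Implicit Defensive.

Import Order.TTheory GRing.Theory Num.Theory.
Import numFieldNormedType.Exports.

Local Open Scope classical_set_scope.
Local Open Scope ring_scope.

Notation borel T := (g_sigma_algebraType (@open T)).

Section euclidean.
Context {R : realType} {n : nat}.
Implicit Types x y : 'rV[R]_n.

Definition dotv x y : R := \sum_i x ord0 i * y ord0 i.

(* The library norm `|x| on 'rV_n is the sup norm. *)
Definition enorm x : R := Num.sqrt (dotv x x).

Definition ediam (U : set 'rV[R]_n) : \bar R :=
  ereal_sup [set (enorm (p.1 - p.2))%:E | p in U `*` U].

Definition sphere : set 'rV[R]_n := [set x | enorm x = 1].

Definition halfspace (i : 'I_n) (c : R) : set 'rV[R]_n :=
  [set x | x ord0 i < c].

Lemma coord_le_enorm x i : `|x ord0 i| <= enorm x.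
Proof.
rewrite /enorm -sqrtr_sqr ler_wsqrtr// /dotv (bigD1 i)//= -expr2 lerDl.
by apply: sumr_ge0 => j _; rewrite -expr2 sqr_ge0.
Qed.

End euclidean.

Section outer_from_gauge.
Local Open Scope ereal_scope.
Context {R : realType} {T : pointedType}.
Variable tau : set T -> \bar R.

Definition cover_outer (A : set T) : \bar R :=
  ereal_inf [set \sum_(k <oo) tau (F k) |
              F in [set F : (set T)^nat | A `<=` \bigcup_k F k]].

Hypothesis tau0 : tau set0 = 0.
Hypothesis tau_ge0 : forall A, 0 <= tau A.

Lemma cover_outerE :
  cover_outer = mu_ext (tau : set (g_sigma_algebraType [set: set T]) -> \bar R).
Proof.
apply/funext => A; congr ereal_inf; rewrite eqEsubset; split => _ [F + <-].
  by move=> AF; exists F => //; split => // i; exact: sub_sigma_algebra.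
by move=> [_ AF]; exists F.
Qed.

Lemma cover_outer0 : cover_outer set0 = 0.
Proof. by rewrite cover_outerE mu_ext0. Qed.

Lemma cover_outer_ge0 A : 0 <= cover_outer A.
Proof. by rewrite cover_outerE mu_ext_ge0. Qed.

Lemma le_cover_outer : {homo cover_outer : A B / A `<=` B >-> A <= B}.
Proof. by rewrite cover_outerE => A B AB; exact: le_mu_ext. Qed.

Lemma cover_outer_sigma_subadditive : sigma_subadditive cover_outer.
Proof.
rewrite cover_outerE => F.
exact: (@mu_ext_sigma_subadditive _ (g_sigma_algebraType [set: set T])).
Qed.

Lemma cover_outer_split (f g : set T -> set T) X Y Z :
  (forall U, tau (f U) + tau (g U) <= tau U) -> X `<=` Z -> Y `<=` Z ->
  (forall U, U `&` X `<=` f U) -> (forall U, U `&` Y `<=` g U) ->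
  cover_outer X + cover_outer Y <= cover_outer Z.
Proof.
move=> taufg XZ YZ Xf Yg; apply: le_ereal_inf_tmp => _ [F ZF <-].
apply: (@le_trans _ _ (\sum_(k <oo) (tau (f (F k)) + tau (g (F k))))).
  rewrite nneseriesD//; apply: leeD; apply: ereal_inf_lbound.
    exists (f \o F) => //= x Xx; have [k _ Fk] := ZF _ (XZ _ Xx).
    by exists k => //; exact: Xf.
  exists (g \o F) => //= x Yx; have [k _ Fk] := ZF _ (YZ _ Yx).
  by exists k => //; exact: Yg.
by apply: lee_nneseries => // k _; rewrite adde_ge0.
Qed.

End outer_from_gauge.

Section borel_caratheodory.
Local Open Scope ereal_scope.
Context {R : realType} {n : nat}.
Variable mu : {outer_measure set 'rV[R]_n -> \bar R}.
Hypothesis mu_halfspace : forall i c, mu.-caratheodory (halfspace i c).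

Lemma open_caratheodory (U : set 'rV[R]_n) : open U -> mu.-caratheodory U.
Proof.
move=> oU.
pose box (ab : 'rV[rat]_n * 'rV[rat]_n) : set (caratheodory_type mu) :=
  [set x : 'rV[R]_n | forall i,
     (ratr (ab.1 ord0 i) <= x ord0 i < ratr (ab.2 ord0 i))%R].
have mbox ab : measurable (box ab).
  rewrite (_ : box ab = \bigcap_(i in [set: 'I_n])
    (~` halfspace i (ratr (ab.1 ord0 i)) `&` halfspace i (ratr (ab.2 ord0 i)))).
    apply: fin_bigcap_measurable => // i _.
    apply: measurableI; last exact: mu_halfspace.
    by apply: measurableC; exact: mu_halfspace.
  rewrite eqEsubset; split => x /= bx i.
    move=> _; have /andP[ax xb] := bx i; split => //=.
    by rewrite /halfspace/=; apply/negP; rewrite -leNgt.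
  have [/= /negP + xb] := bx i I.
  by rewrite -leNgt => ->.
rewrite (_ : U = \bigcup_(ab in [set ab | box ab `<=` U]) box ab).
  pose F := fun ab => if `[< box ab `<=` U >] then box ab else set0.
  rewrite (_ : \bigcup_(_ in _) _ = \bigcup_ab F ab).
    apply: (@countable_bigcupT_measurable _ (caratheodory_type mu) _ F) => //.
    by move=> ab; rewrite /F; case: ifP.
  by rewrite bigcup_mkcond; apply: eq_bigcupr => ab _.
rewrite eqEsubset; split => [x Ux|x [ab /= abU]]; last exact: abU.
have /nbhs_ballP[e /= e0 eU] := open_nbhs_nbhs (conj oU Ux).
have ha i : {q : rat | (x ord0 i - e < ratr q < x ord0 i)%R}.
  apply: cid; have [q] := @rat_in_itvoo _ (x ord0 i - e)%R (x ord0 i)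
    ltac:(by rewrite ltrBlDr ltrDl).
  by rewrite in_itv/=; exists q.
have hb i : {q : rat | (x ord0 i < ratr q < x ord0 i + e)%R}.
  apply: cid; have [q] := @rat_in_itvoo _ (x ord0 i) (x ord0 i + e)%R
    ltac:(by rewrite ltrDl).
  by rewrite in_itv/=; exists q.
exists (\row_i sval (ha i), \row_i sval (hb i)) => /=.
  move=> y /= yab; apply: eU; split => // i j; rewrite ord1.
  have := yab j; rewrite !mxE/= => /andP[].
  case: (ha j) => a /= /andP[ea _]; case: (hb j) => b /= /andP[_ be] ay yb.
  rewrite /ball/= ltr_distlC; apply/andP; split.
    by rewrite (lt_le_trans ea).
  by rewrite (lt_trans yb).
move=> i; rewrite !mxE/=.
case: (ha i) => a /= /andP[_ /ltW ->]; by case: (hb i) => b /= /andP[->].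
Qed.

Lemma borel_caratheodory (A : set (borel 'rV[R]_n)) :
  measurable A -> mu.-caratheodory A.
Proof.
move: A; apply: smallest_sub; last exact: open_caratheodory.
split; first exact: caratheodory_measurable_set0.
  by move=> A mA; rewrite setTD; exact: caratheodory_measurable_setC.
exact: caratheodory_measurable_bigcup.
Qed.

Lemma borel_sigma_additive :
  semi_sigma_additive (mu : set (borel 'rV[R]_n) -> \bar R).
Proof.
move=> F mF tF mUF.
apply: (caratheodory_measure_sigma_additive (mu := mu)) => //.
  by move=> i; exact: borel_caratheodory.
exact: borel_caratheodory.
Qed.

End borel_caratheodory.

Section lebesgue_rV.
Local Open Scope ereal_scope.
Context {R : realType} {n : nat}.
Implicit Types (a b x : 'rV[R]_n) (A U : set 'rV[R]_n).

Definition cbox a b : set 'rV[R]_n :=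
  [set x | forall i, (a ord0 i <= x ord0 i <= b ord0 i)%R].

(* Volume of the smallest closed box that contains [U], so that [lebesgue_rV]
   is the infimum of the total volumes of countable covers by boxes. The empty
   set is singled out because in dimension 0 every box has volume 1. *)
Definition box_volume U : \bar R :=
  if `[< U = set0 >] then 0 else
  ereal_inf [set (\prod_i (ab.2 ord0 i - ab.1 ord0 i))%:E |
    ab in [set ab : 'rV[R]_n * 'rV[R]_n |
      (forall i, (ab.1 ord0 i <= ab.2 ord0 i)%R) /\ U `<=` cbox ab.1 ab.2]].

Lemma box_volume0 : box_volume set0 = 0.
Proof. by rewrite /box_volume asboolT. Qed.

Lemma box_volume_ge0 U : 0 <= box_volume U.
Proof.
rewrite /box_volume; case: ifPn => // _.
apply: le_ereal_inf_tmp => _ [[a b] /= [ab _] <-].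
by rewrite lee_fin; apply: prodr_ge0 => i _; rewrite subr_ge0.
Qed.

Definition lebesgue_rV : set (borel 'rV[R]_n) -> \bar R :=
  cover_outer box_volume.

HB.instance Definition _ := isOuterMeasure.Build R 'rV[R]_n
  (cover_outer box_volume)
  (cover_outer0 box_volume0 box_volume_ge0) (cover_outer_ge0 box_volume_ge0)
  (@le_cover_outer _ _ box_volume)
  (cover_outer_sigma_subadditive box_volume_ge0).

Lemma box_volume_le U a b : (forall i, (a ord0 i <= b ord0 i)%R) ->
  U `<=` cbox a b -> box_volume U <= (\prod_i (b ord0 i - a ord0 i))%:E.
Proof.
move=> ab Uab; rewrite /box_volume; case: ifPn => _.
  by rewrite lee_fin; apply: prodr_ge0 => i _; rewrite subr_ge0.
by apply: ereal_inf_lbound; exists (a, b).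
Qed.

Lemma box_volume_halfspace U i c : box_volume (U `&` halfspace i c) +
  box_volume (U `&` ~` halfspace i c) <= box_volume U.
Proof.
have [->|/set0P[u Uu]] := eqVneq U set0; first by rewrite !set0I box_volume0 adde0.
have U0 : U <> set0 by move=> U0; rewrite U0 in Uu.
rewrite {3}/box_volume asboolF//.
apply: le_ereal_inf_tmp => _ [[a b] /= [ab Uab] <-].
have [->|/set0P[x [Ux xc]]] := eqVneq (U `&` halfspace i c) set0.
  by rewrite box_volume0 add0e; apply: box_volume_le => // x [/Uab].
have [->|/set0P[y [Uy yc]]] := eqVneq (U `&` ~` halfspace i c) set0.
  by rewrite box_volume0 adde0; apply: box_volume_le => // z [/Uab].
have ac : (a ord0 i <= c)%R.
  by have /andP[+ _] := Uab _ Ux i => /le_trans; apply; exact: ltW.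
have cb : (c <= b ord0 i)%R.
  have /andP[_ +] := Uab _ Uy i; apply: le_trans.
  by rewrite leNgt; exact/negP.
pose a' := (\row_j if j == i then c else a ord0 j)%R.
pose b' := (\row_j if j == i then c else b ord0 j)%R.
have h1 : box_volume (U `&` halfspace i c) <=
    (\prod_j (b' ord0 j - a ord0 j))%:E.
  apply: box_volume_le => [j|z [Uz zc] j]; rewrite mxE; case: eqP => [->|_] //.
    by have /andP[-> _] := Uab _ Uz i; rewrite ltW.
  exact: Uab.
have h2 : box_volume (U `&` ~` halfspace i c) <=
    (\prod_j (b ord0 j - a' ord0 j))%:E.
  apply: box_volume_le => [j|z [Uz zc] j]; rewrite mxE; case: eqP => [->|_] //.
    by have /andP[_ ->] := Uab _ Uz i; rewrite andbT leNgt; exact/negP.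
  exact: Uab.
apply: le_trans (leeD h1 h2) _.
rewrite -EFinD lee_fin (bigD1 i)//= [X in (_ + X <= _)%R](bigD1 i)//=.
rewrite [leRHS](bigD1 i)//= !mxE eqxx.
rewrite [X in (_ * X + _)%R](_ : _ =
    (\prod_(j | j != i) (b ord0 j - a ord0 j))%R); last first.
  by apply: eq_bigr => j ji; rewrite mxE (negbTE ji).
rewrite [X in (_ + _ * X)%R](_ : _ =
    (\prod_(j | j != i) (b ord0 j - a ord0 j))%R); last first.
  by apply: eq_bigr => j ji; rewrite mxE (negbTE ji).
by rewrite -mulrDl addrC addrA subrK.
Qed.

Lemma lebesgue_rV_halfspace i c :
  (cover_outer box_volume).-caratheodory (halfspace i c).
Proof.
apply: le_caratheodory_measurable => X.
apply: (@cover_outer_split _ _ _ box_volume_ge0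
  (fun U => U `&` halfspace i c) (fun U => U `&` ~` halfspace i c)).
- by move=> U; exact: box_volume_halfspace.
- exact: subIsetl.
- exact: subIsetl.
- by move=> U; apply: setIS; exact: subIsetr.
- by move=> U; apply: setIS; exact: subIsetr.
Qed.

HB.instance Definition _ := isMeasure.Build _ (borel 'rV[R]_n) R lebesgue_rV
  (cover_outer0 box_volume0 box_volume_ge0) (cover_outer_ge0 box_volume_ge0)
  (borel_sigma_additive lebesgue_rV_halfspace).

End lebesgue_rV.
Arguments lebesgue_rV : clear implicits.

Section hausdorff.
Local Open Scope ereal_scope.
Context {R : realType} {n : nat}.
Variable s : R.
Implicit Types (A B U X : set 'rV[R]_n) (e : R).

(* The empty set is singled out so that it costs nothing when [s = 0]. *)
Definition diam_gauge e U : \bar R :=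
  if `[< U = set0 >] then 0 else
  if ediam U <= e%:E then ediam U `^ s else +oo.

Definition hausdorff_outer A : \bar R :=
  ereal_sup [set cover_outer (diam_gauge e) A | e in [set e : R | (0 < e)%R]].

Lemma diam_gauge0 e : diam_gauge e set0 = 0.
Proof. by rewrite /diam_gauge asboolT. Qed.

Lemma diam_gauge_ge0 e U : 0 <= diam_gauge e U.
Proof.
rewrite /diam_gauge; case: ifPn => // _; case: ifPn => // _; exact: poweR_ge0.
Qed.

Lemma le_hausdorff_outer : {homo hausdorff_outer : A B / A `<=` B >-> A <= B}.
Proof.
move=> A B AB; apply: ge_ereal_sup => _ [e e0 <-].
apply: (@le_trans _ _ (cover_outer (diam_gauge e) B)).
  exact: le_cover_outer.
by apply: ereal_sup_ubound; exists e.
Qed.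

Lemma cover_outer_le_hausdorff e A : (0 < e)%R ->
  cover_outer (diam_gauge e) A <= hausdorff_outer A.
Proof. by move=> e0; apply: ereal_sup_ubound; exists e. Qed.

Lemma hausdorff_outer_ge0 A : 0 <= hausdorff_outer A.
Proof.
apply: le_trans (cover_outer_le_hausdorff A (@ltr01 R)).
exact/cover_outer_ge0/diam_gauge_ge0.
Qed.

Lemma hausdorff_outer0 : hausdorff_outer set0 = 0.
Proof.
apply/eqP; rewrite eq_le hausdorff_outer_ge0 andbT.
apply: ge_ereal_sup => _ [e e0 <-].
by rewrite cover_outer0//; [exact: diam_gauge0|exact: diam_gauge_ge0].
Qed.

Lemma hausdorff_outer_sigma_subadditive : sigma_subadditive hausdorff_outer.
Proof.
move=> F; apply: ge_ereal_sup => _ [e e0 <-].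
apply: (le_trans (cover_outer_sigma_subadditive (diam_gauge_ge0 e) F)).
apply: lee_nneseries => k _; last exact: cover_outer_le_hausdorff.
by move=> _; exact/cover_outer_ge0/diam_gauge_ge0.
Qed.

HB.instance Definition _ := isOuterMeasure.Build R 'rV[R]_n hausdorff_outer
  hausdorff_outer0 hausdorff_outer_ge0 le_hausdorff_outer
  hausdorff_outer_sigma_subadditive.

Lemma hausdorff_outer_separated e A B : (0 < e)%R ->
  (forall x y, A x -> B y -> (e <= enorm (x - y))%R) ->
  hausdorff_outer A + hausdorff_outer B <= hausdorff_outer (A `|` B).
Proof.
move=> e0 AB.
have [->|ABoo] := eqVneq (hausdorff_outer (A `|` B)) +oo; first exact: leey.
have fin C : C `<=` A `|` B -> hausdorff_outer C \is a fin_num.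
  move=> CAB; rewrite ge0_fin_numE ?hausdorff_outer_ge0//.
  by rewrite (le_lt_trans (le_hausdorff_outer CAB))// ltey.
rewrite -leeBrDr ?fin//; apply: ge_ereal_sup => _ [e1 /= e1_gt0 <-].
have fin1 : cover_outer (diam_gauge e1) A \is a fin_num.
  rewrite ge0_fin_numE; last exact/cover_outer_ge0/diam_gauge_ge0.
  apply: (le_lt_trans (cover_outer_le_hausdorff A e1_gt0)).
  by rewrite -ge0_fin_numE ?fin ?hausdorff_outer_ge0.
rewrite leeBrDr ?fin// addeC -leeBrDr//.
apply: ge_ereal_sup => _ [e2 /= e2_gt0 <-].
pose d : R := Num.min (Num.min e1 e2) (e / 2)%R.
have d0 : (0 < d)%R by rewrite !lt_min e1_gt0 e2_gt0 divr_gt0.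
have gauge_le e' U : (d <= e')%R -> diam_gauge e' U <= diam_gauge d U.
  move=> de'; rewrite /diam_gauge; case: ifPn => // _.
  case: ifPn => [_|/negP]; case: ifPn => //; first by rewrite leey.
  by move=> Ud []; apply: le_trans Ud _; rewrite lee_fin.
have cover_le e' C : (d <= e')%R ->
    cover_outer (diam_gauge e') C <= cover_outer (diam_gauge d) C.
  move=> de'; apply: le_ereal_inf_tmp => _ [F CF <-].
  apply: (@le_trans _ _ (\sum_(k <oo) diam_gauge e' (F k))).
    by apply: ereal_inf_lbound; exists F.
  apply: lee_nneseries => k _; last exact: gauge_le.
  by move=> _; exact: diam_gauge_ge0.
have ded : (d < e)%R.
  rewrite gt_min; apply/orP; right.
  by rewrite ltr_pdivrMr// ltr_pMr// ltr1n.
rewrite leeBrDr// addeC.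
apply: (@le_trans _ _ (cover_outer (diam_gauge d) A +
                       cover_outer (diam_gauge d) B)).
  by apply: leeD; apply: cover_le; rewrite !ge_min lexx ?orbT.
apply: le_trans (cover_outer_le_hausdorff _ d0).
pose meet C U := if `[< U `&` C !=set0 >] then U else set0.
have meetP C U : U `&` C `<=` meet C U.
  by move=> x UCx; rewrite /meet asboolT; [case: UCx|exists x].
apply: (@cover_outer_split _ _ _ (diam_gauge_ge0 d) (meet A) (meet B)) => //.
move=> U; rewrite /meet; case: asboolP => [[x [Ux Ax]]|_]; last first.
  by case: asboolP => _; rewrite diam_gauge0 add0e// diam_gauge_ge0.
case: asboolP => [[y [Uy By]]|_]; last by rewrite diam_gauge0 adde0.
rewrite [leRHS]/diam_gauge asboolF; last by move=> U0; rewrite U0 in Ux.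
case: ifPn => [Ud|_]; last exact: leey.
have := lt_le_trans ded (AB _ _ Ax By); rewrite ltNge => /negP[].
rewrite -lee_fin; apply: le_trans Ud.
by apply: ereal_sup_ubound; exists (x, y).
Qed.

Lemma hausdorff_halfspace i c : hausdorff_outer.-caratheodory (halfspace i c).
Proof.
apply: le_caratheodory_measurable => X.
change (hausdorff_outer (X `&` halfspace i c) +
  hausdorff_outer (X `&` ~` halfspace i c) <= hausdorff_outer X).
have [->|XNoo] := eqVneq (hausdorff_outer X) +oo; first exact: leey.
have HX : hausdorff_outer X < +oo by rewrite ltey.
pose t k : R := (c - k.+1%:R^-1)%R.
have tS k : (t k < t k.+1)%R.
  by rewrite ltrD2l ltrN2 ltf_pV2 ?posrE ?ltr0n// ltr_nat.
have t_homo j k : (j <= k)%N -> (t j <= t k)%R.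
  by move=> jk; rewrite lerD2l lerN2 lef_pV2 ?posrE ?ltr0n// ler_nat.
have tc k : (t k < c)%R by rewrite ltrBlDr ltrDl invr_gt0 ltr0n.
pose Z k := X `&` halfspace i (t k).
pose S k := X `&` [set x : 'rV[R]_n | (t k <= x ord0 i < t k.+1)%R].
have sep u v A B : (u < v)%R -> (forall x, A x -> (x ord0 i < u)%R) ->
    (forall x, B x -> (v <= x ord0 i)%R) ->
    hausdorff_outer A + hausdorff_outer B <= hausdorff_outer (A `|` B).
  move=> uv Au Bv; apply: (@hausdorff_outer_separated (v - u)%R).
    by rewrite subr_gt0.
  move=> x y /Au xu /Bv vy; apply: le_trans (coord_le_enorm _ i).
  rewrite -normrN !mxE opprB; apply: le_trans (ler_norm _).
  by apply: lerB => //; exact: ltW.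
have ZX k : hausdorff_outer (Z k) +
    hausdorff_outer (X `&` ~` halfspace i c) <= hausdorff_outer X.
  apply: (@le_trans _ _ (hausdorff_outer
      (Z k `|` (X `&` ~` halfspace i c)))).
    apply: (sep (t k) c) => // [x []//|x [_ /negP]].
    by rewrite -leNgt.
  by apply: le_hausdorff_outer => x [[]|[]].
have SX b m : \sum_(0 <= j < m.+1) hausdorff_outer (S (j.*2 + b)%N) <=
    hausdorff_outer (Z (m.*2 + b).+1).
  elim: m => [|m ih].
    rewrite big_nat1; apply: le_hausdorff_outer => x [Xx /andP[_ xt]].
    by split.
  rewrite big_nat_recr//=; apply: (le_trans (leeD2r _ ih)).
  apply: le_trans (sep (t (m.*2 + b).+1) (t (m.*2 + b).+2) _ _ (tS _) _ _) _.
  - by move=> x [].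
  - by move=> x [_ /andP[]]; rewrite doubleS !addSn.
  - apply: le_hausdorff_outer => x [[Xx xt]|[Xx /andP[_ xt]]].
      split => //; rewrite /halfspace/=; apply: (lt_le_trans xt); apply: t_homo.
      by rewrite doubleS !addSn ltnS; exact: leqW (leqnSn _).
    by split.
have Sfin : \sum_(0 <= j <oo) hausdorff_outer (S j) < +oo.
  apply: (@le_lt_trans _ _ (hausdorff_outer X + hausdorff_outer X)).
    apply: lime_le; first by apply: is_cvg_nneseries => *; exact: hausdorff_outer_ge0.
    apply: nearW => m.
    apply: (@le_trans _ _ (\sum_(0 <= j < m.+1.*2) hausdorff_outer (S j))).
      apply: lee_sum_nneg_natr => //.
        by move=> *; exact: hausdorff_outer_ge0.
      by rewrite -addnn (leq_trans (leqnSn _))// leq_addr.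
    have -> : \sum_(0 <= j < m.+1.*2) hausdorff_outer (S j) =
        \sum_(0 <= j < m.+1) hausdorff_outer (S (j.*2 + 0)%N) +
        \sum_(0 <= j < m.+1) hausdorff_outer (S (j.*2 + 1)%N).
      elim: (m.+1) => [|k ih]; first by rewrite double0 !big_nil adde0.
      rewrite doubleS; do 4 rewrite big_nat_recr//=; rewrite ih addn0 addn1.
      by rewrite -!addeA; congr (_ + _); rewrite addeCA.
    apply: leeD; apply: le_trans (SX _ _) _; apply: le_hausdorff_outer;
      exact: subIsetl.
  by rewrite lte_add_pinfty.
have XS k : hausdorff_outer (X `&` halfspace i c) <=
    hausdorff_outer (Z k) + \sum_(k <= j <oo) hausdorff_outer (S j).
  have sub : X `&` halfspace i c `<=` Z k `|` \bigcup_(j in ~` `I_k) S j.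
    move=> x [Xx xc].
    have [xt|tx] := ltP (x ord0 i) (t k); first by left.
    right.
    have cx : (0 < c - x ord0 i)%R by rewrite subr_gt0.
    have exj : exists j, (x ord0 i < t j)%R.
      exists (Num.truncn (c - x ord0 i)^-1).
      rewrite ltrBrDl -ltrBrDr invf_plt ?posrE ?ltr0n//.
      exact: truncnS_gt.
    case: (ex_minnP exj) => -[|j] xj jmin.
      by have := lt_le_trans xj (t_homo _ _ (leq0n k)); rewrite ltNge tx.
    have tjx : (t j <= x ord0 i)%R.
      by rewrite leNgt; apply/negP => /jmin; rewrite ltnn.
    exists j; last by split => //=; rewrite tjx.
    move=> /= jk; have := lt_le_trans xj (t_homo _ _ jk).
    by rewrite ltNge tx.
  apply: (le_trans (le_hausdorff_outer sub)).
  apply: (le_trans (outer_measureU2 _ _ _)); rewrite leeD2l//.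
  exact: outer_measure_sigma_subadditive_tail.
have tail0 := nneseries_tail_cvg Sfin (fun k _ => hausdorff_outer_ge0 (S k)).
apply/lee_addgt0Pr => e e0.
have [k _ /(_ k (leqnn _)) tail_lt] : \forall k \near \oo,
    \sum_(k <= j <oo) hausdorff_outer (S j) < e%:E.
  have /fine_cvgP[tfin /cvgrPdist_lt/(_ _ e0) tcvg] := tail0.
  near=> k.
  have kfin : \sum_(k <= j <oo) hausdorff_outer (S j) \is a fin_num.
    by near: k.
  rewrite -(fineK kfin) lte_fin.
  have : (`|0 - fine (\sum_(k <= j <oo) hausdorff_outer (S j))| < e)%R.
    by near: k.
  by rewrite sub0r normrN; apply: le_lt_trans; exact: ler_norm.
apply: (le_trans (leeD2r _ (XS k))).
by rewrite addeAC; apply: leeD; [exact: ZX|exact: ltW].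
Unshelve. all: by end_near. Qed.

Definition hausdorff_measure : set (borel 'rV[R]_n) -> \bar R :=
  hausdorff_outer.

HB.instance Definition _ := isMeasure.Build _ (borel 'rV[R]_n) R
  hausdorff_measure hausdorff_outer0 hausdorff_outer_ge0
  (borel_sigma_additive hausdorff_halfspace).

End hausdorff.
Arguments hausdorff_measure {R} n s.

Section geometric_measure.
Context {R : realType} {n : nat}.
Implicit Types (A K E : set 'rV[R]_n) (x xi : 'rV[R]_n).

Definition hausdorff_dim A : \bar R :=
  ereal_inf [set s%:E | s in
    [set s : R | 0 <= s /\ hausdorff_measure n s A = 0%E]].

Definition ball_volume (m : nat) : R :=
  fine (lebesgue_rV R m [set x | enorm x <= 1]).

Lemma surface_const_ge0 m : 0 <= ball_volume m / 2 ^+ m.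
Proof. by rewrite divr_ge0// fine_ge0// measure_ge0. Qed.

(* The factor turns the (n-1)-dimensional Hausdorff measure, which is defined
   with diameters, into the one that agrees with Lebesgue measure on
   hyperplanes. *)
Definition surface_measure : {measure set (borel 'rV[R]_n) -> \bar R} :=
  mscale (NngNum (surface_const_ge0 n.-1)) (hausdorff_measure n n.-1%:R).

Definition boundary K : set (borel 'rV[R]_n) := closure K `\` K°.

Lemma measurable_boundary K : measurable (boundary K).
Proof.
apply: measurableD; last by apply: sub_sigma_algebra; exact: open_interior.
rewrite -[closure K]setCK; apply: measurableC; apply: sub_sigma_algebra.
by apply: closed_openC; exact: closed_closure.
Qed.

Definition boundary_measure K : {measure set (borel 'rV[R]_n) -> \bar R} :=
  mrestr surface_measure (measurable_boundary K).

Definition fourier (mu : {measure set (borel 'rV[R]_n) -> \bar R}) xi : R[i] :=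
  Complex (\int[mu]_x cos (2 * pi * dotv x xi))
          (- \int[mu]_x sin (2 * pi * dotv x xi)).

Definition gauge_norm K x : R := inf [set t : R | 0 < t /\ K (t^-1 *: x)].

Definition distance_set K E : set R :=
  [set gauge_norm K (p.1 - p.2) | p in E `*` E].

End geometric_measure.
Arguments surface_measure : clear implicits.

Section rotations.
Context {R : realType} {d : nat}.

Definition special_orthogonal : set 'M[R]_d :=
  [set rho | rho *m rho^T = 1%:M /\ \det rho = 1].

(* Vectors are rows, so [x *m rho^T] is the image of [x] under [rho]. *)
Definition rotate (rho : 'M[R]_d) (E : set 'rV[R]_d) : set 'rV[R]_d :=
  [set x *m rho^T | x in E].

(* A Haar measure on SO(d), as a Borel measure on matrices carried by SO(d). *)
Definition haar_SO (h : {measure set (borel 'M[R]_d) -> \bar R}) : Prop :=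
  [/\ h (~` special_orthogonal) = 0%E,
      (0 < h special_orthogonal < +oo)%E &
      forall rho (A : set (borel 'M[R]_d)),
        special_orthogonal rho -> measurable A ->
        h [set rho *m g | g in A] = h A].

End rotations.
Arguments special_orthogonal : clear implicits.

(* Main.v *)
(* Push the surface measure sigma of K forward by z |-> t z rho.  Fubini's theorem
   and Fourier duality with the autocorrelation of a small cube bound the mu x mu
   measure of {(x, y) : | ||(x - y) rho^T||_K - t | <= delta} by C delta A(t), where
   A(t) is the integral of |mu^(xi)|^2 |sigma^(t xi rho^T)|.  If A is integrable on
   compact subintervals of (0, oo), the image of mu x mu under the distance is thus
   absolutely continuous there; finiteness of a single A(t) also shows that the
   diagonal is mu x mu-null, so the distance set cannot be Lebesgue null.

   It remains to find mu with A locally integrable.  A Frostman measure of exponent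
   s satisfies int_{|xi| <= r} |mu^|^2 = O(r^(d - s)), and summing over dyadic shells
   gives (i).  In (ii), integrating over SO(d) replaces |sigma^| by its spherical
   average, so A is finite for almost every rotation by Tonelli's theorem.  In (iii),
   dilations of xi are absorbed by gamma(u / 2) <= gamma(u) / 2, which follows from
   convexity, and by the doubling property of r |-> int_{|xi| <= r} |mu^|^2.

   When gamma > d there is no exponent s >= 0 to use, but such a decay is impossible:
   the argument applied to a point mass would give a one-point distance set positive
   measure. *)

Require Import Defs.
From HB Require Import structures.
From mathcomp Require Import all_boot all_order all_algebra.
From mathcomp Require Import complex.
From mathcomp Require Import all_classical all_reals all_analysis.
From mathcomp Require Import measurable_realfun.
From mathcomp Require Import lra ring zify.

Set Implicit Arguments.
Unset Strict Implicit.
Unset Printing Implicit Defensive.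

Import Order.TTheory GRing.Theory Num.Theory.
Import numFieldNormedType.Exports.

Local Open Scope classical_set_scope.
Local Open Scope ring_scope.

(** * Borel sets of matrices and bounded integrals *)

Section borel_matrices.
Context {R : realType}.

(** The basic identity is the Fubini duality [cosft_duality]; the Fourier estimates are inequalities
    derived from it by testing against the autocorrelation of a cube. That test measure combines
    several properties: its density is bounded and supported in the doubled cube, it is bounded
    below on a concentric cube, its transform is a square, hence nonnegative, and this square is a
    product of squared sinc functions, hence summable over a lattice. These properties yield
    concentration at the origin, doubling and the decay of Frostman measures. The factor delta in
    the shell estimate is a count of scales: a test cube of size delta contributes delta^(-d), and a
    ball of radius comparable to delta centred on the sphere has surface mass at least c
    delta^(d-1). What is used of the surface measure is thus its finiteness and this lower mass
    bound; both come from Lipschitz comparison of the sphere with coordinate cubes, which convexity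
    makes possible. A(t) may be infinite for some t, so absolute continuity has to be drawn from its
    integrability, by averaging the shell estimate over t. *)

Lemma open_borel (T : ptopologicalType) (U : set T) :
  open U -> measurable (U : set (borel T)).
Proof. by move=> oU; exact: sub_sigma_algebra. Qed.

Lemma closed_borel (T : ptopologicalType) (U : set T) :
  closed U -> measurable (U : set (borel T)).
Proof.
move=> cU; rewrite -[U]setCK; apply: measurableC.
by apply: open_borel; exact: closed_openC.
Qed.

Lemma continuous_borel (T : ptopologicalType) (f : T -> R) :
  continuous f -> measurable_fun setT (f : borel T -> R).
Proof.
move=> cf; apply: (@measurability _ _ (borel T) R _ _ _ (RGenOpens.measurableE R)).
move=> _ [_ [x [y ->]] <-]; rewrite setTI; apply: open_borel.
by move/continuousP : cf; apply; exact: itv_open.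
Qed.

Lemma measurable_coord m n i j :
  measurable_fun setT (fun M : borel 'M[R]_(m, n) => (M : 'M[R]_(m, n)) i j).
Proof.
apply: (@continuous_borel _ (fun M : 'M[R]_(m, n) => M i j)).
exact: coord_continuous.
Qed.

(** An open set is the union of the rational boxes that it contains, and these are countably many;
    so measurability of the entries suffices. *)
Lemma measurable_fun_matrix m n d (T : measurableType d)
    (f : T -> borel 'M[R]_(m, n)) :
  (forall i j, measurable_fun setT (fun t => (f t : 'M[R]_(m, n)) i j)) ->
  measurable_fun setT f.
Proof.
move=> mf; apply: (@measurability _ _ _ (borel 'M[R]_(m, n)) _ _ (@open 'M[R]_(m, n))) => //.
move=> _ [U oU <-]; rewrite setTI.
pose box (ab : 'M[rat]_(m, n) * 'M[rat]_(m, n)) : set 'M[R]_(m, n) :=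
  [set x | forall i j, ratr (ab.1 i j) < x i j < ratr (ab.2 i j)].
have mbox ab : measurable (f @^-1` box ab).
  rewrite (_ : f @^-1` box ab = \bigcap_(i in [set: 'I_m]) \bigcap_(j in [set: 'I_n])
    ((fun t => (f t : 'M[R]_(m, n)) i j) @^-1` `]ratr (ab.1 i j), ratr (ab.2 i j)[)).
    apply: fin_bigcap_measurable => // i _; apply: fin_bigcap_measurable => // j _.
    rewrite -[X in measurable X]setTI; apply: mf => //.
  rewrite eqEsubset; split => [t bt i _ j _|t bt i j] /=.
    by rewrite in_itv /=; exact: bt.
  by have := bt i I j I; rewrite /= in_itv.
rewrite (_ : f @^-1` U = \bigcup_ab (if `[< box ab `<=` U >] then f @^-1` box ab else set0)).
  apply: countable_bigcupT_measurable => // ab; case: ifP => // _; exact: mbox.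
rewrite eqEsubset; split => [t Ut|t [ab _]]; last by case: asboolP => // + bt; exact.
have /nbhs_ballP[e /= e0 eU] := open_nbhs_nbhs (conj oU Ut).
pose x : 'M[R]_(m, n) := f t.
have ha i j : {q : rat | (x i j - e < ratr q < x i j)%R}.
  apply: cid; have [q] := @rat_in_itvoo _ (x i j - e)%R (x i j)
    ltac:(by rewrite ltrBlDr ltrDl).
  by rewrite in_itv/=; exists q.
have hb i j : {q : rat | (x i j < ratr q < x i j + e)%R}.
  apply: cid; have [q] := @rat_in_itvoo _ (x i j) (x i j + e)%R
    ltac:(by rewrite ltrDl).
  by rewrite in_itv/=; exists q.
exists (\matrix_(i, j) sval (ha i j), \matrix_(i, j) sval (hb i j)) => //.
rewrite asboolT.
  move=> i j /=; rewrite !mxE/=.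
  by case: (ha i j) => a /= /andP[_ ->]; case: (hb i j) => b /= /andP[->].
move=> y /= yab; apply: eU; split => // i j.
have := yab i j; rewrite !mxE/= => /andP[].
case: (ha i j) => a /= /andP[ea _]; case: (hb i j) => b /= /andP[_ be] ay yb.
by rewrite /ball/= ltr_distlC (lt_trans ea ay) (lt_trans yb be).
Qed.

Lemma measurable_mulmx d (T : measurableType d) m n p
    (f : T -> borel 'M[R]_(m, n)) (g : T -> borel 'M[R]_(n, p)) :
  measurable_fun setT f -> measurable_fun setT g ->
  measurable_fun setT (fun t => ((f t : 'M[R]_(m, n)) *m (g t : 'M[R]_(n, p))) : borel 'M[R]_(m, p)).
Proof.
move=> mf mg; apply: measurable_fun_matrix => i j.
under eq_fun do rewrite mxE; apply: measurable_sum => k.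
by apply: measurable_funM; [exact: (measurableT_comp (measurable_coord i k) mf)
  |exact: (measurableT_comp (measurable_coord k j) mg)].
Qed.

Lemma measurable_trmx d (T : measurableType d) m n (f : T -> borel 'M[R]_(m, n)) :
  measurable_fun setT f -> measurable_fun setT (fun t => (f t : 'M[R]_(m, n))^T : borel 'M[R]_(n, m)).
Proof.
move=> mf; apply: measurable_fun_matrix => i j; under eq_fun do rewrite mxE.
exact: (measurableT_comp (measurable_coord j i) mf).
Qed.

Lemma measurable_addmx d (T : measurableType d) m n (f g : T -> borel 'M[R]_(m, n)) :
  measurable_fun setT f -> measurable_fun setT g ->
  measurable_fun setT (fun t => (f t : 'M[R]_(m, n)) + (g t : 'M[R]_(m, n)) : borel 'M[R]_(m, n)).
Proof.
move=> mf mg; apply: measurable_fun_matrix => i j; under eq_fun do rewrite mxE.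
by apply: measurable_funD; apply: (measurableT_comp (measurable_coord i j)).
Qed.

Lemma measurable_oppmx d (T : measurableType d) m n (f : T -> borel 'M[R]_(m, n)) :
  measurable_fun setT f -> measurable_fun setT (fun t => - (f t : 'M[R]_(m, n)) : borel 'M[R]_(m, n)).
Proof.
move=> mf; apply: measurable_fun_matrix => i j; under eq_fun do rewrite mxE.
by apply: measurable_funN; apply: (measurableT_comp (measurable_coord i j)).
Qed.

Lemma measurable_submx d (T : measurableType d) m n (f g : T -> borel 'M[R]_(m, n)) :
  measurable_fun setT f -> measurable_fun setT g ->
  measurable_fun setT (fun t => (f t : 'M[R]_(m, n)) - (g t : 'M[R]_(m, n)) : borel 'M[R]_(m, n)).
Proof. by move=> mf mg; apply: measurable_addmx => //; exact: measurable_oppmx. Qed.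

Lemma measurable_scalemx d (T : measurableType d) m n (a : T -> R) (f : T -> borel 'M[R]_(m, n)) :
  measurable_fun setT a -> measurable_fun setT f ->
  measurable_fun setT (fun t => a t *: (f t : 'M[R]_(m, n)) : borel 'M[R]_(m, n)).
Proof.
move=> ma mf; apply: measurable_fun_matrix => i j; under eq_fun do rewrite mxE.
by apply: measurable_funM => //; apply: (measurableT_comp (measurable_coord i j)).
Qed.

Lemma measurable_dotv d (T : measurableType d) n (f g : T -> borel 'rV[R]_n) :
  measurable_fun setT f -> measurable_fun setT g ->
  measurable_fun setT (fun t => dotv (f t : 'rV[R]_n) (g t : 'rV[R]_n)).
Proof.
move=> mf mg; apply: measurable_sum => i.
by apply: measurable_funM; apply: (measurableT_comp (measurable_coord ord0 i)).
Qed.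

End borel_matrices.

Section finite_measures.
Local Open Scope ereal_scope.
Context d d' (T : measurableType d) (T' : measurableType d') {R : realType}.

(** The identity on measures. The proof of finiteness is an argument so that the finite-measure
    structure can be attached to the term and inferred from it. *)
Definition fin_measure (m : {measure set T -> \bar R}) (mfin : m setT < +oo) : set T -> \bar R := m.

Section fin.
Variables (m : {measure set T -> \bar R}) (mfin : m setT < +oo).
HB.instance Definition _ := Measure.on (fin_measure mfin).
Let fin_num_fin : fin_num_fun (fin_measure mfin).
Proof.
move=> A mA; rewrite /fin_measure ge0_fin_numE//; apply: le_lt_trans mfin.
by apply: le_measure; rewrite ?inE.
Qed.
HB.instance Definition _ := Measure_isFinite.Build _ _ _ (fin_measure mfin) fin_num_fin.
End fin.

(** The push-forward, with the proof of measurability kept as an argument so that the measure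
    structures below are inferred. *)
Definition law (m : {measure set T -> \bar R}) (f : T -> T') (mf : measurable_fun setT f)
  : set T' -> \bar R := pushforward m f.

Section law_measure.
Variables (m : {measure set T -> \bar R}) (f : T -> T') (mf : measurable_fun setT f).
Let law0 : law m mf set0 = 0.
Proof. by rewrite /law /pushforward preimage_set0 measure0. Qed.
Let law_ge0 A : 0 <= law m mf A.
Proof. exact: measure_ge0. Qed.
Let law_sigma_additive : semi_sigma_additive (law m mf).
Proof.
move=> F mF tF mUF; rewrite /law /pushforward preimage_bigcup.
apply: measure_semi_sigma_additive.
- by move=> n; rewrite -[X in measurable X]setTI; exact: mf.
- apply/trivIsetP => /= i j _ _ ij; rewrite -preimage_setI.
  by move/trivIsetP : tF => /(_ _ _ _ _ ij) ->//; rewrite preimage_set0.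
- by rewrite -preimage_bigcup -[X in measurable X]setTI; exact: mf.
Qed.
HB.instance Definition _ := isMeasure.Build _ _ _ (law m mf)
  law0 law_ge0 law_sigma_additive.

Lemma ge0_integral_law (g : T' -> \bar R) :
  measurable_fun setT g -> (forall x, 0 <= g x) ->
  \int[law m mf]_x g x = \int[m]_x g (f x).
Proof.
move=> mg g0; rewrite -(preimage_setT f).
by rewrite -(ge0_integral_pushforward mf m).
Qed.

End law_measure.

Section law_finite.
Variables (m : {finite_measure set T -> \bar R}) (f : T -> T') (mf : measurable_fun setT f).
Let law_fin : fin_num_fun (law m mf).
Proof.
by move=> A mA; apply: fin_num_measure; rewrite -[X in measurable X]setTI; exact: mf.
Qed.
HB.instance Definition _ := Measure_isFinite.Build _ _ _ (law m mf) law_fin.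
End law_finite.
End finite_measures.

Section bounded_integrals.
Context d (T : measurableType d) {R : realType}.
Implicit Types (m : {finite_measure set T -> \bar R}).

Lemma finite_measure_lty m A : d.-measurable A -> (m A < +oo)%E.
Proof. by move=> mA; rewrite ltey_eq fin_num_measure. Qed.

Lemma bounded_integrable m (f : T -> R) (M : R) D : measurable D ->
  measurable_fun setT f -> (forall x, `|f x| <= M) ->
  m.-integrable D (EFin \o f).
Proof.
move=> mD mf fM; apply: (@integrableS _ _ _ _ setT) => //.
apply: measurable_bounded_integrable => //; first exact: finite_measure_lty.
exists M; split; first exact: num_real.
by move=> N MN x _; exact: le_trans (fM x) (ltW MN).
Qed.

Lemma Rintegral_le_bound m (f : T -> R) (M : R) :
  measurable_fun setT f -> (forall x, `|f x| <= M) ->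
  `|\int[m]_x f x| <= M * fine (m setT).
Proof.
move=> mf fM; apply: le_trans (le_normr_Rintegral _ _) _ => //.
  exact: bounded_integrable mf fM.
rewrite -Rintegral_cst//; apply: le_Rintegral => //.
- apply: (@bounded_integrable _ (fun x => `|f x|) M) => //.
    exact: measurableT_comp.
  by move=> x; rewrite normr_id.
- apply: (@bounded_integrable _ _ `|M|) => //; exact: measurable_cst.
Qed.

Lemma integral_EFin_Rintegral m (f : T -> R) (M : R) :
  measurable_fun setT f -> (forall x, `|f x| <= M) ->
  (\int[m]_x (f x)%:E)%E = (\int[m]_x f x)%:E.
Proof.
move=> mf fM; rewrite /Rintegral fineK//.
by apply: integrable_fin_num => //; exact: (bounded_integrable _ _ mf fM).
Qed.

End bounded_integrals.

Section fubini_bounded.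
Context d d' (T : measurableType d) (T' : measurableType d') {R : realType}.
Variables (m : {finite_measure set T -> \bar R}) (p : {finite_measure set T' -> \bar R}).

Lemma Rintegral_law (f : T -> T') (mf : measurable_fun setT f) (g : T' -> R) M :
  measurable_fun setT g -> (forall x, `|g x| <= M) ->
  \int[law m mf]_x g x = \int[m]_x g (f x).
Proof.
move=> mg gM; rewrite /Rintegral; congr fine.
rewrite -(preimage_setT f).
rewrite -(integral_pushforward mf (mu := m) (f := EFin \o g))//.
- exact/measurable_EFinP.
- rewrite preimage_setT; apply: (@bounded_integrable _ _ _ _ (g \o f) M) => //.
  + exact: measurableT_comp.
  + by move=> x; exact: gM.
Qed.

Variables (f : T * T' -> R) (M : R).
Hypotheses (mf : measurable_fun setT f) (fM : forall x, `|f x| <= M).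

Let mx x : measurable_fun setT (fun y => f (x, y)).
Proof. by apply: measurableT_comp mf _; exact: pair1_measurable. Qed.

Let my y : measurable_fun setT (fun x => f (x, y)).
Proof. by apply: measurableT_comp mf _; exact: pair2_measurable. Qed.

Let fi : (m \x p)%E.-integrable setT (EFin \o f).
Proof.
apply: measurable_bounded_integrable => //; last first.
  by exists M; split; [exact: num_real|move=> N MN x _; exact: le_trans (fM x) (ltW MN)].
rewrite -setXTT [ltLHS]product_measure1E//.
by rewrite lte_mul_pinfty// ?fin_num_measure// ltey_eq fin_num_measure.
Qed.

Lemma measurable_fun_Rintegral2 :
  measurable_fun setT (fun y => \int[m]_x f (x, y)).
Proof.
have := measurable_fubini_G fi; rewrite /fubini_G => mF.
by apply: measurableT_comp mF => //; exact: fine_measurable.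
Qed.

Lemma Rintegral_swap :
  \int[m]_x (\int[p]_y f (x, y)) = \int[p]_y (\int[m]_x f (x, y)).
Proof.
have := Fubini fi => /=.
under eq_integral do rewrite /= (integral_EFin_Rintegral p (mx _) (fun y => fM (_, y))).
under [in RHS]eq_integral do rewrite /= (integral_EFin_Rintegral m (my _) (fun x => fM (x, _))).
by rewrite /Rintegral => ->.
Qed.

Lemma Rintegral_prod :
  \int[(m \x p)%E]_z f z = \int[m]_x (\int[p]_y f (x, y)).
Proof.
rewrite [LHS]/Rintegral -(integral12_prod_meas1 fi) /fubini_F; congr fine.
by apply: eq_integral => x _ /=; rewrite (integral_EFin_Rintegral p (mx _) (fun y => fM (_, y))).
Qed.

End fubini_bounded.

(** * Lebesgue measure on row vectors *)

Section cover_outer_lemmas.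
Local Open Scope ereal_scope.
Context {R : realType} {T : pointedType}.
Variable tau : set T -> \bar R.
Hypothesis tau0 : tau set0 = 0.
Hypothesis tau_ge0 : forall A, 0 <= tau A.

Lemma cover_outer_le A : cover_outer tau A <= tau A.
Proof.
apply: ereal_inf_lbound; exists (fun k => if k is 0%N then A else set0) => /=.
  by move=> x Ax; exists 0%N.
rewrite (nneseries_split 0 1)// big_nat1 /= eseries0 ?adde0// => i; by case: i.
Qed.

Lemma le_cover_outer_image (f : T -> T) A :
  (forall U, tau (f @` U) <= tau U) -> cover_outer tau (f @` A) <= cover_outer tau A.
Proof.
move=> ftau; apply: le_ereal_inf_tmp => _ [F AF <-].
apply: (@le_trans _ _ (\sum_(k <oo) tau (f @` F k))).
  apply: ereal_inf_lbound; exists (fun k => f @` F k) => //=.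
  by move=> _ [x /AF[k _ Fx] <-]; exists k => //; exists x.
by apply: lee_nneseries => // k _; exact: tau_ge0.
Qed.

End cover_outer_lemmas.

Section lebesgue_rV_boxes.
Context {R : realType} {n : nat}.
Implicit Types (a b : 'rV[R]_n).

Definition cube (r : R) : set 'rV[R]_n := cbox (const_mx (- r)) (const_mx r).

Lemma cubeE r x : cube r x <-> forall i, `|x ord0 i| <= r.
Proof.
by split => h i; have := h i; rewrite !mxE ler_norml.
Qed.

Lemma closed_cbox a b : closed (cbox a b).
Proof.
rewrite (_ : cbox a b = \bigcap_(i in [set: 'I_n])
   ((fun x : 'rV[R]_n => x ord0 i) @^-1` `[a ord0 i, b ord0 i])).
  apply: closed_bigI => i _; apply: closed_comp => [x _|]; first exact: coord_continuous.
  exact: itv_closed.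
rewrite eqEsubset; split => [x h i _|x h i]; rewrite /= ?in_itv; first exact: h.
by have := h i I; rewrite /= in_itv.
Qed.

Lemma measurable_cbox a b : measurable (cbox a b : set (borel 'rV[R]_n)).
Proof. by apply: closed_borel; exact: closed_cbox. Qed.

Lemma measurable_cube r : measurable (cube r : set (borel 'rV[R]_n)).
Proof. exact: measurable_cbox. Qed.

Lemma lebesgue_rV_cbox_le a b : (forall i, a ord0 i <= b ord0 i) ->
  (lebesgue_rV R n (cbox a b) <= (\prod_i (b ord0 i - a ord0 i))%:E)%E.
Proof.
move=> ab; apply: le_trans (cover_outer_le box_volume0 box_volume_ge0 _) _.
exact: box_volume_le.
Qed.

Lemma lebesgue_rV_cbox_lty a b : (lebesgue_rV R n (cbox a b) < +oo)%E.
Proof.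
case: (pselect (forall i, a ord0 i <= b ord0 i)) => [ab|/existsNP[i /negP]].
  by apply: le_lt_trans (lebesgue_rV_cbox_le ab) _; rewrite ltry.
rewrite -ltNge => ba; rewrite (_ : cbox a b = set0) ?measure0//.
rewrite eqEsubset; split => // x /(_ i) /andP[ax xb].
by have := le_lt_trans (le_trans ax xb) ba; rewrite ltxx.
Qed.

Lemma cubeT : \bigcup_k cube k%:R = setT.
Proof.
rewrite eqEsubset; split => // x _.
exists (Num.truncn (\sum_i `|x ord0 i|)).+1 => //; apply/cubeE => i.
apply: ltW; apply: le_lt_trans (truncnS_gt _).
by rewrite (bigD1 i)//= lerDl sumr_ge0.
Qed.

Lemma lebesgue_rV_sigma_finite : sigma_finite setT (lebesgue_rV R n).
Proof.
exists (fun k => cube k%:R); first by rewrite cubeT.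
by move=> k; split; [exact: measurable_cube|exact: lebesgue_rV_cbox_lty].
Qed.

HB.instance Definition _ := Measure_isSigmaFinite.Build _ (borel 'rV[R]_n) R
  (lebesgue_rV R n) lebesgue_rV_sigma_finite.

Lemma lebesgue_rV_translate_le a A :
  (lebesgue_rV R n [set ((x : 'rV[R]_n) + a)%R | x in A] <= lebesgue_rV R n A)%E.
Proof.
apply: (@le_cover_outer_image _ _ _ box_volume_ge0 (fun x : 'rV[R]_n => x + a)) => U.
have [->|U0] := pselect (U = set0); first by rewrite image_set0 box_volume0.
rewrite [leRHS]/box_volume asboolF//; apply: le_ereal_inf_tmp => _ [[p q] /= [pq Upq] <-].
rewrite (_ : \prod_i (q ord0 i - p ord0 i) = \prod_i ((q + a) ord0 i - (p + a) ord0 i)).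
  apply: box_volume_le => [i|_ [x /Upq Ux <-] i]; first by rewrite !mxE lerD2r.
  by rewrite !mxE !lerD2r; exact: Ux.
by apply: eq_bigr => i _; rewrite !mxE; ring.
Qed.

Lemma lebesgue_rV_translate a (A : set 'rV[R]_n) :
  lebesgue_rV R n [set x | A (x + a)] = lebesgue_rV R n A.
Proof.
have e b (B : set 'rV[R]_n) : [set x | B (x + b)] = [set x - b | x in B].
  rewrite eqEsubset; split => [x Bx|_ [x Bx <-]] /=; last by rewrite subrK.
  by exists (x + b) => //; rewrite addrK.
apply/eqP; rewrite eq_le; apply/andP; split.
  by rewrite e; exact: lebesgue_rV_translate_le.
have := @lebesgue_rV_translate_le a [set x | A (x + a)].
apply: le_trans; apply: le_cover_outer => x Ax; exists (x - a) => //=; by rewrite subrK.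
Qed.

Lemma measurable_translate (a : 'rV[R]_n) :
  measurable_fun setT (fun x : borel 'rV[R]_n => (x : 'rV[R]_n) + a : borel 'rV[R]_n).
Proof. by apply: measurable_addmx => //; exact: measurable_cst. Qed.

Lemma integral_lebesgue_rV_translate a (f : borel 'rV[R]_n -> \bar R) :
  measurable_fun setT f -> (forall x, 0 <= f x)%E ->
  (\int[lebesgue_rV R n]_x f ((x : 'rV[R]_n) + a)%R = \int[lebesgue_rV R n]_x f x)%E.
Proof.
move=> mf f0; rewrite -(ge0_integral_law _ (measurable_translate a))//.
apply: eq_measure_integral => A mA _.
by rewrite -[RHS](lebesgue_rV_translate a).
Qed.

End lebesgue_rV_boxes.
Arguments cube {R n} r.

Section generation.
Context {R : realType} {n : nat}.

Definition cboxes : set (set 'rV[R]_n) := [set cbox ab.1 ab.2 | ab in [set: 'rV[R]_n * 'rV[R]_n]].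

Lemma setI_closed_cboxes : setI_closed cboxes.
Proof.
move=> _ _ [[a b] _ <-] [[p q] _ <-] /=.
exists (\row_i Num.max (a ord0 i) (p ord0 i), \row_i Num.min (b ord0 i) (q ord0 i)) => //=.
rewrite eqEsubset; split => [x h|x [h k] i].
  by split => i; have := h i; rewrite !mxE ge_max le_min => /andP[/andP[h1 h2] /andP[h3 h4]];
    rewrite ?h1 ?h2 ?h3 ?h4.
by have := h i; have := k i; rewrite !mxE ge_max le_min => /andP[-> ->] /andP[-> ->].
Qed.

(** For the inclusion from left to right, the identity out of the sigma-algebra of boxes is
    measurable as soon as its coordinates are, and the preimage of a half-line is a countable union
    of boxes whose other sides grow. *)
Lemma borel_cboxes : (open : set (set 'rV[R]_n)).-sigma.-measurable = <<s cboxes >>.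
Proof.
rewrite eqEsubset; split; last first.
  apply: smallest_sub; first exact: sigma_algebra_measurable.
  by move=> _ [ab _ <-]; exact: measurable_cbox.
have mid : measurable_fun setT (id : g_sigma_algebraType cboxes -> borel 'rV[R]_n).
  apply: measurable_fun_matrix => i j.
  apply: (@measurability _ _ (g_sigma_algebraType cboxes) R _ _ _ (RGenCInfty.measurableE R)).
  move=> _ [_ [c ->] <-]; rewrite setTI.
  rewrite (_ : _ @^-1` _ = \bigcup_k cbox (\row_l (if l == j then c else - k%:R)) (const_mx k%:R)).
    by apply: bigcupT_measurable => k; apply: sub_sigma_algebra;
      exists (\row_l (if l == j then c else - k%:R), const_mx k%:R).
  rewrite eqEsubset; split => [x /=|x [k _ /(_ j)]]; last first.
    move=> /andP[]; rewrite mxE eqxx => cx _.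
  by rewrite /preimage /= in_itv /= andbT ord1.
  rewrite in_itv/= andbT => cx.
  have : (\bigcup_k cube k%:R) x by rewrite cubeT.
  move=> [k _ /cubeE xk]; exists k => // l; rewrite !mxE.
  have := xk l; rewrite ler_norml => /andP[h1 ->]; rewrite andbT.
  by case: eqP => // ->; move: cx; rewrite ord1.
by move=> A mA; have := mid measurableT A mA; rewrite setTI.
Qed.

Lemma borel_measure_unique (m1 m2 : {measure set (borel 'rV[R]_n) -> \bar R}) :
  (forall a b : 'rV[R]_n, (forall i, a ord0 i <= b ord0 i) -> m1 (cbox a b) = m2 (cbox a b)) ->
  (forall r, m1 (cube r) < +oo)%E ->
  forall A, measurable A -> m1 A = m2 A.
Proof.
move=> m12 mfin A mA.
refine (@measure_unique _ R (borel 'rV[R]_n) cboxes (fun k => cube k%:R) _ _ _ _ m1 m2 _ _ A mA) => //.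
- exact: borel_cboxes.
- exact: setI_closed_cboxes.
- by move=> k; exists (const_mx (- k%:R), const_mx k%:R).
- by rewrite cubeT.
- move=> _ [[a b] _ <-] /=.
  case: (pselect (forall i, a ord0 i <= b ord0 i)) => [|/existsNP[i /negP]]; first exact: m12.
  rewrite -ltNge => ba; rewrite (_ : cbox a b = set0) ?measure0//.
  rewrite eqEsubset; split => // x /(_ i) /andP[ax xb].
  by have := le_lt_trans (le_trans ax xb) ba; rewrite ltxx.
Qed.

End generation.

Section lebesgue_rV_product.
Local Open Scope ereal_scope.
Context {R : realType}.

Definition consv n (tv : R * borel 'rV[R]_n) : borel 'rV[R]_n.+1 :=
  (\row_i if unlift ord0 i is Some j then (tv.2 : 'rV[R]_n) ord0 j else tv.1)%R.

Lemma consv0 n tv : (@consv n tv : 'rV[R]_n.+1) ord0 ord0 = tv.1.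
Proof. by rewrite mxE unlift_none. Qed.

Lemma consvS n tv j : (@consv n tv : 'rV[R]_n.+1) ord0 (lift ord0 j) = (tv.2 : 'rV[R]_n) ord0 j.
Proof. by rewrite mxE liftK. Qed.

Lemma measurable_consv n : measurable_fun setT (@consv n).
Proof.
apply: measurable_fun_matrix => i j; rewrite ord1.
under eq_fun do rewrite mxE.
case: unliftP => [k _|_]; last exact: measurable_fst.
exact: (measurableT_comp (measurable_coord ord0 k) measurable_snd).
Qed.

Lemma consv_preimage n (a b : 'rV[R]_n.+1) : @consv n @^-1` cbox a b =
  `[a ord0 ord0, b ord0 ord0] `*` cbox (\row_i a ord0 (lift ord0 i))%R (\row_i b ord0 (lift ord0 i))%R.
Proof.
rewrite eqEsubset; split => [tv h|tv [h1 h2] i].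
  split => /=; first by have := h ord0; rewrite consv0 in_itv.
  by move=> i; have := h (lift ord0 i); rewrite consvS !mxE.
case: (unliftP ord0 i) => [j ->|->]; last by rewrite consv0; move: h1; rewrite /= in_itv.
by rewrite consvS; have := h2 j; rewrite !mxE.
Qed.

Local Notation P n := (law (lebesgue_measure \x lebesgue_rV R n) (@measurable_consv n)).

Let boxes n := forall a b : 'rV[R]_n, (forall i, a ord0 i <= b ord0 i)%R ->
  lebesgue_rV R n (cbox a b) = (\prod_i (b ord0 i - a ord0 i))%:E.

Let P_cbox n (a b : 'rV[R]_n.+1) : boxes n -> (forall i, a ord0 i <= b ord0 i)%R ->
  P n (cbox a b) = (\prod_i (b ord0 i - a ord0 i))%:E.
Proof.
move=> bn ab; rewrite /law /pushforward consv_preimage.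
apply: etrans (product_measure1E _ _ _ _) _ => //; first exact: measurable_cbox.
rewrite [X in _ * X](bn (\row_i a ord0 (lift ord0 i)) (\row_i b ord0 (lift ord0 i))); last first.
  by move=> i; rewrite !mxE.
rewrite [X in X * _](lebesgue_measure_itv `[a ord0 ord0, b ord0 ord0])/= lte_fin.
rewrite (_ : (if _ then _ else _) = (b ord0 ord0 - a ord0 ord0)%:E); last first.
  case: ltP => // h; have -> : a ord0 ord0 = b ord0 ord0 by apply/eqP; rewrite eq_le ab h.
  by rewrite subrr.
rewrite -EFinM big_ord_recl; congr (_ * _)%:E; by apply: eq_bigr => i _; rewrite !mxE.
Qed.

(** This gives the lower bound for the volume of a box. By subadditivity the two measures need only
    be compared on each piece of a cover, and a closed box around a piece has product measure equal
    to its volume. Countable additivity of the product measure takes the place of the usual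
    compactness argument. *)
Let P_le n A : boxes n -> measurable A -> P n A <= lebesgue_rV R n.+1 A.
Proof.
move=> bn mA; rewrite -(measurable_mu_extE (P n))//.
apply: le_ereal_inf_tmp => _ [F AF <-].
apply: (@le_trans _ _ (mu_ext (P n) (\bigcup_k F k))); first exact: le_mu_ext.
apply: le_trans (@mu_ext_sigma_subadditive _ (borel 'rV[R]_n.+1) R (P n) _ F) _ => //.
apply: lee_nneseries => [k _ _|k _]; first exact: mu_ext_ge0.
rewrite /box_volume; case: asboolP => [->|_]; first by rewrite mu_ext0.
apply: le_ereal_inf_tmp => _ [[a b] /= [ab Fab] <-].
apply: le_trans.
  by apply: (@le_mu_ext _ (borel 'rV[R]_n.+1) _ (P n)); exact: Fab.
by rewrite [X in X <= _](measurable_mu_extE (P n) (measurable_cbox a b)) [X in X <= _](P_cbox bn ab).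
Qed.

Let lebesgue_rV_cbox0 : boxes 0.
Proof.
move=> a b ab; rewrite big_ord0; apply/eqP; rewrite eq_le; apply/andP; split.
  by have := lebesgue_rV_cbox_le ab; rewrite big_ord0.
apply: le_ereal_inf_tmp => _ [F AF <-].
have [k _ Fka] : (\bigcup_k F k) a by apply: AF => i; rewrite lexx ab.
rewrite (nneseriesD1 (n := k))//; last by move=> *; exact: box_volume_ge0.
apply: (@le_trans _ _ (box_volume (F k))); last first.
  by rewrite leeDl// nneseries_ge0// => *; exact: box_volume_ge0.
rewrite /box_volume asboolF; last by move=> F0; rewrite F0 in Fka.
by apply: le_ereal_inf_tmp => _ [[p q] /= _ <-]; rewrite big_ord0.
Qed.

Lemma lebesgue_rV_cbox n (a b : 'rV[R]_n) : (forall i, a ord0 i <= b ord0 i)%R ->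
  lebesgue_rV R n (cbox a b) = (\prod_i (b ord0 i - a ord0 i))%:E.
Proof.
elim: n a b => [|n ih] a b ab; first exact: lebesgue_rV_cbox0.
apply/eqP; rewrite eq_le lebesgue_rV_cbox_le//= -(P_cbox ih ab).
apply: P_le => //; exact: measurable_cbox.
Qed.

Lemma lebesgue_rV_consv n A : measurable A ->
  lebesgue_rV R n.+1 A = law (lebesgue_measure \x lebesgue_rV R n) (@measurable_consv n) A.
Proof.
apply: (@borel_measure_unique R n.+1 (lebesgue_rV R n.+1) (P n)).
  move=> a b ab; apply: etrans (lebesgue_rV_cbox ab) _; symmetry; apply: P_cbox => //.
  exact: lebesgue_rV_cbox.
by move=> r; exact: lebesgue_rV_cbox_lty.
Qed.

Lemma lebesgue_rV_cube n r : (0 <= r)%R -> lebesgue_rV R n (cube r) = ((r *+ 2) ^+ n)%:E.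
Proof.
move=> r0; rewrite lebesgue_rV_cbox; last by move=> i; rewrite !mxE; lra.
under eq_bigr do rewrite !mxE opprK -mulr2n.
by rewrite big_const iter_mulr_1 card_ord.
Qed.

End lebesgue_rV_product.

(** * Fourier transforms of finite measures *)

Section product_finite.
Context d d' (T : measurableType d) (T' : measurableType d') {R : realType}.
Variables (m1 : {finite_measure set T -> \bar R}) (m2 : {finite_measure set T' -> \bar R}).

Lemma product_measure_lty : ((m1 \x m2) setT < +oo)%E.
Proof.
by rewrite -setXTT product_measure1E// lte_mul_pinfty// ?fin_num_measure// ltey_eq fin_num_measure.
Qed.

Definition fin_product : {finite_measure set (T * T')%type -> \bar R} :=
  fin_measure product_measure_lty.

End product_finite.

Section fourier_transforms.
Context {R : realType} {n : nat}.
Local Notation V := (borel 'rV[R]_n).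
Implicit Types (m tau : {finite_measure set V -> \bar R}) (x xi : 'rV[R]_n).

(** [cosft] is the real part of [fourier] and [sinft] minus its imaginary part; with them all
    integrals stay real. *)
Definition cosft (m : {measure set V -> \bar R}) xi : R := \int[m]_x cos (2 * pi * dotv x xi).
Definition sinft (m : {measure set V -> \bar R}) xi : R := \int[m]_x sin (2 * pi * dotv x xi).

Lemma normc_fourier (m : {measure set V -> \bar R}) xi :
  Normc.normc (fourier m xi) = Num.sqrt (cosft m xi ^+ 2 + sinft m xi ^+ 2).
Proof. by rewrite /fourier /= sqrrN. Qed.

Lemma normc_fourier2 (m : {measure set V -> \bar R}) xi :
  Normc.normc (fourier m xi) ^+ 2 = cosft m xi ^+ 2 + sinft m xi ^+ 2.
Proof. by rewrite normc_fourier sqr_sqrtr// addr_ge0// sqr_ge0. Qed.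

Lemma normc_fourier_ge0 (m : {measure set V -> \bar R}) xi : 0 <= Normc.normc (fourier m xi).
Proof. by rewrite normc_fourier sqrtr_ge0. Qed.

Lemma dotvC x xi : dotv x xi = dotv xi x.
Proof. by apply: eq_bigr => i _; rewrite mulrC. Qed.

Lemma dotvDl x y xi : dotv (x + y) xi = dotv x xi + dotv y xi.
Proof. by rewrite /dotv -big_split; apply: eq_bigr => i _; rewrite mxE mulrDl. Qed.

Lemma dotvNl x xi : dotv (- x) xi = - dotv x xi.
Proof. by rewrite /dotv -sumrN; apply: eq_bigr => i _; rewrite mxE mulNr. Qed.

Lemma dotvBl x y xi : dotv (x - y) xi = dotv x xi - dotv y xi.
Proof. by rewrite dotvDl dotvNl. Qed.

Lemma dotvDr x y xi : dotv xi (x + y) = dotv xi x + dotv xi y.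
Proof. by rewrite ![dotv xi _]dotvC dotvDl. Qed.

Lemma dotvZl a x xi : dotv (a *: x) xi = a * dotv x xi.
Proof. by rewrite /dotv mulr_sumr; apply: eq_bigr => i _; rewrite mxE mulrA. Qed.

Lemma measurable_phase d (T : measurableType d) (f g : T -> V) :
  measurable_fun setT f -> measurable_fun setT g ->
  measurable_fun setT (fun t => 2 * pi * dotv (f t : 'rV[R]_n) (g t : 'rV[R]_n)).
Proof.
by move=> mf mg; apply: measurable_funM => //; exact: measurable_dotv.
Qed.

Lemma measurable_cosT d (T : measurableType d) (f : T -> R) :
  measurable_fun setT f -> measurable_fun setT (fun t => cos (f t)).
Proof. apply: measurableT_comp; apply: continuous_measurable_fun; exact: continuous_cos. Qed.

Lemma measurable_sinT d (T : measurableType d) (f : T -> R) :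
  measurable_fun setT f -> measurable_fun setT (fun t => sin (f t)).
Proof. apply: measurableT_comp; apply: continuous_measurable_fun; exact: continuous_sin. Qed.

Lemma measurable_cos_phase d (T : measurableType d) (f g : T -> V) :
  measurable_fun setT f -> measurable_fun setT g ->
  measurable_fun setT (fun t => cos (2 * pi * dotv (f t : 'rV[R]_n) (g t : 'rV[R]_n))).
Proof. by move=> mf mg; apply: measurable_cosT; exact: measurable_phase. Qed.

Lemma measurable_sin_phase d (T : measurableType d) (f g : T -> V) :
  measurable_fun setT f -> measurable_fun setT g ->
  measurable_fun setT (fun t => sin (2 * pi * dotv (f t : 'rV[R]_n) (g t : 'rV[R]_n))).
Proof. by move=> mf mg; apply: measurable_sinT; exact: measurable_phase. Qed.

Lemma measurable_cosft m : measurable_fun setT (cosft m : V -> R).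
Proof.
apply: (@measurable_fun_Rintegral2 _ _ V V R m m (fun z => cos (2 * pi * dotv (z.1 : 'rV[R]_n) (z.2 : 'rV[R]_n))) 1).
  exact: measurable_cos_phase measurable_fst measurable_snd.
by move=> z; exact: cos_max.
Qed.

Lemma measurable_sinft m : measurable_fun setT (sinft m : V -> R).
Proof.
apply: (@measurable_fun_Rintegral2 _ _ V V R m m (fun z => sin (2 * pi * dotv (z.1 : 'rV[R]_n) (z.2 : 'rV[R]_n))) 1).
  exact: measurable_sin_phase measurable_fst measurable_snd.
by move=> z; exact: sin_max.
Qed.

Lemma measurable_normc_fourier m : measurable_fun setT (fun xi : V => Normc.normc (fourier m xi)).
Proof.
under eq_fun do rewrite normc_fourier.
apply: (@measurableT_comp _ _ _ _ _ _ (@Num.sqrt R)).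
  by apply: continuous_measurable_fun; exact: sqrt_continuous.
by apply: measurable_funD; apply: measurable_funX;
  [exact: measurable_cosft|exact: measurable_sinft].
Qed.

Lemma cosft_le m xi : `|cosft m xi| <= fine (m setT).
Proof.
rewrite -[leRHS]mul1r; apply: Rintegral_le_bound => [|x]; last exact: cos_max.
by apply: measurable_cos_phase => //; exact: measurable_cst.
Qed.

Lemma normc_fourier_le m xi : Normc.normc (fourier m xi) <= 2 * fine (m setT).
Proof.
have sl : `|sinft m xi| <= fine (m setT).
  rewrite -[leRHS]mul1r; apply: Rintegral_le_bound => [|x]; last exact: sin_max.
  by apply: measurable_sin_phase => //; exact: measurable_cst.
have cl := cosft_le m xi.
have m0 : 0 <= fine (m setT) by rewrite fine_ge0.
rewrite normc_fourier -(ger0_norm (mulr_ge0 _ m0))// -sqrtr_sqr ler_wsqrtr//.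
rewrite -(real_normK (num_real (cosft _ _))) -(real_normK (num_real (sinft _ _))).
have := normr_ge0 (cosft m xi); have := normr_ge0 (sinft m xi); nra.
Qed.

(** Fubini: both sides are the double integral of the symmetric kernel
    [cos (2 * pi * dotv x xi)]. *)
Lemma cosft_duality m tau : \int[m]_xi cosft tau xi = \int[tau]_x cosft m x.
Proof.
rewrite /cosft.
rewrite (@Rintegral_swap _ _ V V R m tau (fun z => cos (2 * pi * dotv (z.2 : 'rV[R]_n) (z.1 : 'rV[R]_n))) 1).
- by apply: eq_Rintegral => x _; apply: eq_Rintegral => xi _; rewrite dotvC.
- exact: measurable_cos_phase measurable_snd measurable_fst.
- by move=> z; exact: cos_max.
Qed.

Lemma measurable_subV : measurable_fun setT (fun z : V * V => (z.1 : 'rV[R]_n) - (z.2 : 'rV[R]_n) : V).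
Proof. exact: measurable_submx measurable_fst measurable_snd. Qed.

(** The convolution of [m] with the reflection of [tau]. *)
Definition diff_law m tau : {finite_measure set V -> \bar R} := law (fin_product m tau) measurable_subV.

Lemma integrable_cos m xi : m.-integrable setT (EFin \o (fun x : V => cos (2 * pi * dotv (x : 'rV[R]_n) xi))).
Proof.
apply: (@bounded_integrable _ _ _ _ _ 1) => //; last by move=> x; exact: cos_max.
by apply: measurable_cos_phase => //; exact: measurable_cst.
Qed.

Lemma integrable_sin m xi : m.-integrable setT (EFin \o (fun x : V => sin (2 * pi * dotv (x : 'rV[R]_n) xi))).
Proof.
apply: (@bounded_integrable _ _ _ _ _ 1) => //; last by move=> x; exact: sin_max.
by apply: measurable_sin_phase => //; exact: measurable_cst.
Qed.

Lemma integrableMc m (f : V -> R) (c : R) : m.-integrable setT (EFin \o f) ->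
  m.-integrable setT (EFin \o (fun x => f x * c)).
Proof.
move=> fi; rewrite (_ : _ \o _ = (fun x => (EFin \o f) x * c%:E)%E) //.
exact: integrableZr.
Qed.

Lemma cosft_diff_law m tau xi :
  cosft (diff_law m tau) xi = cosft m xi * cosft tau xi + sinft m xi * sinft tau xi.
Proof.
rewrite /cosft /diff_law (@Rintegral_law _ _ _ _ _ _ _ _ (fun p : V => cos (2 * pi * dotv (p : 'rV[R]_n) xi)) 1); last 2 first.
  by apply: measurable_cos_phase => //; exact: measurable_cst.
  by move=> x; exact: cos_max.
have mz : measurable_fun setT (fun z : V * V => cos (2 * pi * dotv ((z.1 : 'rV[R]_n) - (z.2 : 'rV[R]_n)) xi)).
  by apply: measurable_cos_phase; [exact: measurable_subV|exact: measurable_cst].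
apply: etrans (@Rintegral_prod _ _ V V R m tau _ 1 mz (fun z => cos_max _)) _ => /=.
transitivity (\int[m]_x (cos (2 * pi * dotv (x : 'rV[R]_n) xi) * cosft tau xi +
                         sin (2 * pi * dotv (x : 'rV[R]_n) xi) * sinft tau xi)).
  apply: eq_Rintegral => x _.
  under eq_Rintegral do rewrite dotvBl mulrBr cosB.
  have ic := integrable_cos tau xi; have is' := integrable_sin tau xi.
  rewrite RintegralD//.
  - by rewrite !RintegralZl.
  - by under eq_fun do rewrite mulrC; exact: integrableMc.
  - by under eq_fun do rewrite mulrC; exact: integrableMc.
have ic := integrable_cos m xi; have is' := integrable_sin m xi.
rewrite RintegralD//; [|exact: integrableMc|exact: integrableMc].
by rewrite !RintegralZr.
Qed.

Lemma sinft_diff_law m tau xi :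
  sinft (diff_law m tau) xi = sinft m xi * cosft tau xi - cosft m xi * sinft tau xi.
Proof.
rewrite /sinft /diff_law (@Rintegral_law _ _ _ _ _ _ _ _ (fun p : V => sin (2 * pi * dotv (p : 'rV[R]_n) xi)) 1); last 2 first.
  by apply: measurable_sin_phase => //; exact: measurable_cst.
  by move=> x; exact: sin_max.
have mz : measurable_fun setT (fun z : V * V => sin (2 * pi * dotv ((z.1 : 'rV[R]_n) - (z.2 : 'rV[R]_n)) xi)).
  by apply: measurable_sin_phase; [exact: measurable_subV|exact: measurable_cst].
apply: etrans (@Rintegral_prod _ _ V V R m tau _ 1 mz (fun z => sin_max _)) _ => /=.
transitivity (\int[m]_x (sin (2 * pi * dotv (x : 'rV[R]_n) xi) * cosft tau xi -
                         cos (2 * pi * dotv (x : 'rV[R]_n) xi) * sinft tau xi)).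
  apply: eq_Rintegral => x _.
  under eq_Rintegral do rewrite dotvBl mulrBr sinB.
  have ic := integrable_cos tau xi; have is' := integrable_sin tau xi.
  rewrite RintegralB//.
  - by rewrite !RintegralZl.
  - by under eq_fun do rewrite mulrC; exact: integrableMc.
  - by under eq_fun do rewrite mulrC; exact: integrableMc.
have ic := integrable_cos m xi; have is' := integrable_sin m xi.
rewrite RintegralB//; [|exact: integrableMc|exact: integrableMc].
by rewrite !RintegralZr.
Qed.

Lemma sinft_diff_law_self m xi : sinft (diff_law m m) xi = 0.
Proof. by rewrite sinft_diff_law mulrC subrr. Qed.

Lemma cosft_diff_law_self m xi :
  cosft (diff_law m m) xi = cosft m xi ^+ 2 + sinft m xi ^+ 2.
Proof. by rewrite cosft_diff_law !expr2. Qed.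

(** By Fubini, translating by [a] multiplies the transform of [m] by [cos (2 * pi * dotv x a)],
    which is at most 1; as [cosft m] is nonnegative, the integral against [tau] can only
    decrease. *)
Lemma cosft_translate_le m tau (a : 'rV[R]_n) : (forall x, sinft m x = 0) ->
  (forall x, 0 <= cosft m x) ->
  \int[m]_xi cosft tau ((xi : 'rV[R]_n) + a) <= \int[m]_xi cosft tau xi.
Proof.
move=> sm0 cm0; rewrite cosft_duality /cosft.
rewrite (@Rintegral_swap _ _ V V R m tau (fun z => cos (2 * pi * dotv (z.2 : 'rV[R]_n) ((z.1 : 'rV[R]_n) + a))) 1); last 2 first.
- apply: measurable_cos_phase; first exact: measurable_snd.
  by apply: measurable_addmx; [exact: measurable_fst|exact: measurable_cst].
- by move=> z; exact: cos_max.
have E x : \int[m]_xi cos (2 * pi * dotv x ((xi : 'rV[R]_n) + a)) =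
    cosft m x * cos (2 * pi * dotv x a).
  under eq_Rintegral do rewrite dotvDr mulrDr cosD (dotvC x).
  have ic := integrable_cos m x; have is' := integrable_sin m x.
  rewrite RintegralB//; [|exact: integrableMc|exact: integrableMc].
  by rewrite !RintegralZr// -/(sinft m x) sm0 mul0r subr0.
rewrite /=; under eq_Rintegral do rewrite E.
have bc : tau.-integrable setT (EFin \o (cosft m : V -> R)).
  apply: (@bounded_integrable _ _ _ _ _ (fine (m setT))) => //; first exact: measurable_cosft.
  by move=> x; exact: cosft_le.
apply: le_Rintegral => //.
  apply: (@bounded_integrable _ _ _ _ _ (fine (m setT))) => //.
    apply: measurable_funM; first exact: measurable_cosft.
    by apply: measurable_cos_phase => //; exact: measurable_cst.
  move=> x; rewrite normrM -[leRHS]mulr1 ler_pM//; first exact: cosft_le.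
  exact: cos_max.
by move=> x _; rewrite -[leRHS]mulr1 ler_wpM2l// cos_le1.
Qed.

End fourier_transforms.

(** * Autocorrelation of a cube *)

Section restricted_measures.
Context d (T : measurableType d) {R : realType}.
Variables (m : {measure set T -> \bar R}) (D : set T) (mD : measurable D).

Let mrestr_setC : mrestr m mD (~` D) = 0%E.
Proof. by rewrite /mrestr setICl measure0. Qed.

Let eq_mrestr (f : T -> \bar R) :
  (\int[mrestr m mD]_(x in D) f x = \int[m]_(x in D) f x)%E.
Proof.
by apply: eq_measure_integral => A mA AD; rewrite /= /mrestr setIidl.
Qed.

Lemma ge0_integral_mrestr (f : T -> \bar R) :
  measurable_fun setT f -> (forall x, 0 <= f x)%E ->
  (\int[mrestr m mD]_x f x = \int[m]_(x in D) f x)%E.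
Proof.
move=> mf f0; rewrite (@ge0_negligible_integral _ _ _ _ setT (~` D))//; last exact: measurableC.
by rewrite setTD setCK eq_mrestr.
Qed.

Lemma Rintegral_mrestr (f : T -> R) : (mrestr m mD).-integrable setT (EFin \o f) ->
  \int[mrestr m mD]_x f x = \int[m]_(x in D) f x.
Proof.
move=> fi; rewrite /Rintegral (@negligible_integral _ _ _ _ setT (~` D))//; last exact: measurableC.
by rewrite setTD setCK eq_mrestr.
Qed.

End restricted_measures.

Section cube_measure.
Context {R : realType} (n : nat).
Local Notation V := (borel 'rV[R]_n).
Local Notation lambda := (lebesgue_rV R n).

Let cube_lty r : (mrestr lambda (measurable_cube r) setT < +oo)%E.
Proof. by rewrite /mrestr /= setTI; exact: lebesgue_rV_cbox_lty. Qed.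

Definition cube_measure r : {finite_measure set V -> \bar R} := fin_measure (cube_lty r).

Lemma ge0_integral_cube r (f : V -> \bar R) :
  measurable_fun setT f -> (forall x, 0 <= f x)%E ->
  (\int[cube_measure r]_x f x = \int[lambda]_(x in cube r) f x)%E.
Proof. exact: ge0_integral_mrestr. Qed.

Lemma cube_measureT r : 0 <= r -> cube_measure r setT = ((r *+ 2) ^+ n)%:E.
Proof. by move=> r0; apply: etrans (lebesgue_rV_cube n r0); rewrite -[in RHS](setTI (cube r)). Qed.

(** The autocorrelation of a cube; its density is a product of triangular functions. *)
Definition cube_diff r := diff_law (cube_measure r) (cube_measure r).

Let integral_cube_diff r (f : V -> \bar R) :
  measurable_fun setT f -> (forall x, 0 <= f x)%E ->
  (\int[cube_diff r]_x f x =
   \int[lambda]_(v in cube r) \int[lambda]_(u in cube r) f ((u : 'rV[R]_n) - (v : 'rV[R]_n))%R)%E.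
Proof.
move=> mf f0; rewrite /cube_diff /diff_law ge0_integral_law//.
have mF : measurable_fun setT (fun z : V * V => f ((z.1 : 'rV[R]_n) - (z.2 : 'rV[R]_n))).
  by apply: measurableT_comp mf _; exact: measurable_subV.
rewrite /fin_product /fin_measure.
have -> := fubini_tonelli2 (m1 := cube_measure r) (m2 := cube_measure r) _ mF (fun z => f0 _).
have mG := measurable_fun_fubini_tonelli_G (m1 := cube_measure r) _ mF (fun z => f0 _).
have G0 (x : V) : (0 <= fubini_G (cube_measure r) (fun z : V * V => f ((z.1 : 'rV[R]_n) - (z.2 : 'rV[R]_n))%R) x)%E.
  exact: integral_ge0.
apply: etrans (ge0_integral_cube r mG G0) _.
apply: eq_integral => v _; rewrite /fubini_G.
apply: (@ge0_integral_cube r (fun u : V => f ((u : 'rV[R]_n) - (v : 'rV[R]_n)))) => //.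
by apply: measurableT_comp mf _; apply: measurable_submx => //; exact: measurable_cst.
Qed.

Let translate_restrict (f : V -> \bar R) D (v : 'rV[R]_n) : measurable D ->
  measurable_fun setT f -> (forall x, 0 <= f x)%E ->
  (\int[lambda]_x (f \_ D) ((x : 'rV[R]_n) - v)%R = \int[lambda]_(x in D) f x)%E.
Proof.
move=> mD mf f0; rewrite (@integral_lebesgue_rV_translate _ _ (- v) (f \_ D)).
- by rewrite [RHS]integral_mkcond.
- by apply/(measurable_restrictT _ _).1 => //; exact: measurable_funTS.
- by move=> x; rewrite patchE; case: ifP.
Qed.

Let measurable_sub_r (f : V -> \bar R) (v : 'rV[R]_n) : measurable_fun setT f ->
  measurable_fun setT (fun x : V => f ((x : 'rV[R]_n) - v)).
Proof.
by move=> mf; apply: measurableT_comp mf _; apply: measurable_submx => //; exact: measurable_cst.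
Qed.

Let measurable_restr (f : V -> \bar R) D : measurable D -> measurable_fun setT f ->
  measurable_fun setT (f \_ D).
Proof. by move=> mD mf; apply/(measurable_restrictT _ _).1 => //; exact: measurable_funTS. Qed.

Let restr_ge0 (f : V -> \bar R) D : (forall x, 0 <= f x)%E -> forall x, (0 <= (f \_ D) x)%E.
Proof. by move=> f0 x; rewrite patchE; case: ifP. Qed.

(** For [v] in the cube, the differences [u - v] stay inside [cube (r *+ 2)]; integrating over [v]
    bounds the density by the volume of the cube. *)
Lemma integral_cube_diff_le r (f : V -> \bar R) : 0 <= r ->
  measurable_fun setT f -> (forall x, 0 <= f x)%E ->
  (\int[cube_diff r]_x f x <= ((r *+ 2) ^+ n)%:E * \int[lambda]_(x in cube (r *+ 2)) f x)%E.
Proof.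
move=> r0 mf f0; rewrite integral_cube_diff//.
rewrite -(lebesgue_rV_cube n r0) muleC -integral_cst; last exact: measurable_cube.
apply: ge0_le_integral => //.
- exact: measurable_cube.
- by move=> v _; apply: integral_ge0.
- apply: measurable_funTS.
  have mF : measurable_fun setT (fun z : V * V => f ((z.1 : 'rV[R]_n) - (z.2 : 'rV[R]_n))).
    by apply: measurableT_comp mf _; exact: measurable_subV.
  have := (measurable_fun_fubini_tonelli_G (m1 := cube_measure r) _ mF (fun z => f0 _)).
  apply: eq_measurable_fun => v _; rewrite /fubini_G ge0_integral_cube//.
  exact: measurable_sub_r.
- move=> v /cubeE vr; rewrite -(translate_restrict v _ mf)//; last exact: measurable_cube.
  rewrite integral_mkcond; apply: ge0_le_integral => //.
  + by move=> x _; exact: restr_ge0.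
  + by apply: measurable_restr; [exact: measurable_cube|exact: measurable_sub_r].
  + by apply: measurable_sub_r; apply: measurable_restr => //; exact: measurable_cube.
  + move=> u _; rewrite patchE; case: ifPn => [|_]; last exact: restr_ge0.
    rewrite inE => /cubeE ur; rewrite patchE ifT// inE; apply/cubeE => i.
    rewrite !mxE mulr2n; apply: le_trans (ler_normB _ _) _; exact: lerD.
Qed.

(** Only the [v] in the smaller [cube r] are kept: for these the differences [u - v], with [u] in
    [cube (r *+ 2)], cover [cube r]. *)
Lemma integral_cube_diff_ge r (f : V -> \bar R) : 0 <= r ->
  measurable_fun setT f -> (forall x, 0 <= f x)%E ->
  (((r *+ 2) ^+ n)%:E * \int[lambda]_(x in cube r) f x <= \int[cube_diff (r *+ 2)]_x f x)%E.
Proof.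
move=> r0 mf f0; rewrite integral_cube_diff//.
rewrite -(lebesgue_rV_cube n r0) muleC -integral_cst; last exact: measurable_cube.
have mI : measurable_fun setT (fun v : V => \int[lambda]_(u in cube (r *+ 2)) f ((u : 'rV[R]_n) - (v : 'rV[R]_n))%R)%E.
  have mF : measurable_fun setT (fun z : V * V => f ((z.1 : 'rV[R]_n) - (z.2 : 'rV[R]_n))).
    by apply: measurableT_comp mf _; exact: measurable_subV.
  have := (measurable_fun_fubini_tonelli_G (m1 := cube_measure (r *+ 2)) _ mF (fun z => f0 _)).
  apply: eq_measurable_fun => v _; rewrite /fubini_G ge0_integral_cube//.
  exact: measurable_sub_r.
have sub : cube r `<=` (cube (r *+ 2) : set 'rV[R]_n).
  by move=> x /cubeE xr; apply/cubeE => i; apply: le_trans (xr i) _; rewrite mulr2n lerDl.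
apply: (@le_trans _ _ (\int[lambda]_(v in cube r) \int[lambda]_(u in cube (r *+ 2)) f ((u : 'rV[R]_n) - (v : 'rV[R]_n))%R)%E).
  apply: ge0_le_integral => //.
  - exact: measurable_cube.
  - by move=> v _; apply: integral_ge0.
  - exact: measurable_funTS.
  - move=> v /cubeE vr; rewrite -(translate_restrict v _ mf)//; last exact: measurable_cube.
    rewrite [leRHS]integral_mkcond; apply: ge0_le_integral => //.
    + by move=> x _; exact: restr_ge0.
    + by apply: measurable_sub_r; apply: measurable_restr => //; exact: measurable_cube.
    + by apply: measurable_restr; [exact: measurable_cube|exact: measurable_sub_r].
    + move=> u _; rewrite patchE; case: ifPn => [|_]; last exact: restr_ge0.
      rewrite inE => /cubeE ur; rewrite patchE ifT// inE; apply/cubeE => i.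
      rewrite -(subrK (v ord0 i) (u ord0 i)) mulr2n; apply: le_trans (ler_normD _ _) _.
      by apply: lerD; [have := ur i; rewrite !mxE|exact: vr].
apply: ge0_subset_integral => //; [exact: measurable_cube|exact: measurable_cube|exact: measurable_funTS|].
by move=> v _; apply: integral_ge0.
Qed.

Lemma cosft_cube_diff_ge0 r x : 0 <= cosft (cube_diff r) x.
Proof. by rewrite cosft_diff_law_self addr_ge0// sqr_ge0. Qed.

End cube_measure.

(** * Mass near the origin bounded by the Fourier transform *)

Section concentration.
Context {R : realType} (n : nat).
Local Notation V := (borel 'rV[R]_n).
Local Notation lambda := (lebesgue_rV R n).
Implicit Type tau : {finite_measure set V -> \bar R}.

Lemma cos_ge_half : exists2 c : R, 0 < c & forall x : R, `|x| <= c -> 1 / 2 <= cos x.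
Proof.
have := @continuous_cos R 0 => /cvgrPdist_lt /(_ (1 / 2)) [//|e /= e0 h].
exists (e / 2); first by rewrite divr_gt0.
move=> x xe; have := h x; rewrite /= sub0r normrN cos0 => /(_ _).
have xe' : `|x| < e by apply: le_lt_trans xe _; rewrite ltr_pdivrMr// ltr_pMr// ltr1n.
by move=> /(_ xe') /(le_lt_trans (ler_norm _)); lra.
Qed.

Lemma dotv_le (x y : 'rV[R]_n) a b : cube a x -> cube b y -> `|dotv x y| <= n%:R * (a * b).
Proof.
move=> /cubeE xa /cubeE yb; apply: le_trans (ler_norm_sum _ _ _) _.
rewrite mulr_natl -[X in _ <= _ *+ X](card_ord n) -sumr_const; apply: ler_sum => i _.
by rewrite normrM ler_pM.
Qed.

(** On [cube (c / r)] the transform of the cube is at least half of its maximum, hence that of the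
    autocorrelation at least a quarter of its own. The latter is integrated against [tau]; duality
    moves the transform to [tau], and the density of the autocorrelation is at most the volume of
    the cube. *)
Lemma cube_concentration : exists2 c : R, 0 < c & forall r tau, 0 < r ->
  (((r *+ 2) ^+ n)%:E * tau (cube (c / r)) <= 4%:E * \int[lambda]_xi `|cosft tau xi|%:E)%E.
Proof.
have [c c0 hc] := cos_ge_half.
(* The bound [n * r * (k / r)] for the inner product makes the phase at most [c * n / (n + 1)]; the
   [+ 1] keeps the denominator nonzero in dimension 0. *)
pose k : R := c / (2 * pi * (n%:R + 1)).
have n1 : 0 < n%:R + 1 :> R by rewrite ltr_wpDl.
have pi0 : 0 < pi :> R := pi_gt0 R.
have k0 : 0 < k by rewrite divr_gt0// !mulr_gt0.
exists k => // r tau r0.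
pose Q : R := (r *+ 2) ^+ n.
have Q0 : 0 < Q by rewrite exprn_gt0// mulr2n addr_gt0.
have Cbox x : cube (k / r) x -> Q / 2 <= cosft (cube_measure n r) x.
  move=> xk.
  have E : cosft (cube_measure n r) x = \int[mrestr lambda (measurable_cube r)]_u cos (2 * pi * dotv (u : 'rV[R]_n) x) by [].
  rewrite E Rintegral_mrestr; last exact: (integrable_cos (cube_measure n r)).
  have -> : Q / 2 = \int[lambda]_(u in cube r) (1 / 2).
    rewrite Rintegral_cst; last exact: measurable_cube.
    by rewrite [X in fine X](lebesgue_rV_cube n (ltW r0))/= mul1r mulrC.
  have fin (f : V -> R) : measurable_fun setT f -> (forall x, `|f x| <= 1) ->
      lambda.-integrable (cube r) (EFin \o f).
    move=> mf f1; apply: measurable_bounded_integrable => //.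
    - exact: measurable_cube.
    - exact: lebesgue_rV_cbox_lty.
    - exact: measurable_funTS.
    - by exists 1; split => // M M1 y _; exact: le_trans (f1 y) (ltW M1).
  apply: le_Rintegral => //.
  - exact: measurable_cube.
  - by apply: fin => // y; rewrite ger0_norm//; lra.
  - apply: fin; last by move=> y; exact: cos_max.
    by apply: measurable_cos_phase => //; exact: measurable_cst.
  - move=> u ur; apply: hc; rewrite normrM ger0_norm; last by rewrite mulr_ge0// ltW.
    have := dotv_le ur xk; rewrite [r * _]mulrC divfK ?gt_eqF//.
    move=> h; apply: le_trans (ler_wpM2l _ h) _; first by rewrite mulr_ge0// ltW.
    have hk (m N p : R) : N != 0 -> p != 0 -> 2 * p * (m * (c / (2 * p * N))) = c * (m / N).
      by move=> N0 p0; field; rewrite N0 p0.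
    rewrite /k hk ?gt_eqF//.
    by rewrite ger_pMr// ler_pdivrMr// mul1r lerDl.
have step1 : ((Q ^+ 2 / 4)%:E * tau (cube (k / r)) <= (\int[tau]_x cosft (cube_diff n r) x)%:E)%E.
  rewrite -(@integral_EFin_Rintegral _ _ _ _ _ (fine (cube_diff n r setT))); last 2 first.
  - exact: measurable_cosft.
  - exact: cosft_le.
  rewrite -integral_cst; last exact: measurable_cube.
  rewrite integral_mkcond; apply: ge0_le_integral => //.
  - by move=> x _; rewrite patchE; case: ifP => //; rewrite lee_fin divr_ge0// sqr_ge0.
  - by apply/(measurable_restrictT _ _).1 => //; exact: measurable_cube.
  - by apply/measurable_EFinP; exact: measurable_cosft.
  - move=> x _; rewrite patchE; case: ifPn => [|_]; last by rewrite lee_fin cosft_cube_diff_ge0.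
    rewrite inE => /Cbox xQ; rewrite lee_fin cosft_diff_law_self.
    by have := sqr_ge0 (sinft (cube_measure n r) x); nra.
have step2 : ((\int[tau]_x cosft (cube_diff n r) x)%:E <= Q%:E * \int[lambda]_xi `|cosft tau xi|%:E)%E.
  rewrite -cosft_duality -(@integral_EFin_Rintegral _ _ _ _ _ (fine (tau setT))); last 2 first.
  - exact: measurable_cosft.
  - exact: cosft_le.
  have mE : measurable_fun setT (fun xi : V => `|cosft tau xi|%:E).
    by apply/measurable_EFinP; apply: measurableT_comp => //; exact: measurable_cosft.
  apply: (@le_trans _ _ (\int[cube_diff n r]_xi `|cosft tau xi|%:E)%E).
    apply: le_trans (lee_abs _) _; apply: le_trans (le_abse_integral _ _ _) _ => //.
    by apply/measurable_EFinP; exact: measurable_cosft.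
  apply: le_trans (integral_cube_diff_le _ _ _) _ => //; first exact: ltW.
  rewrite lee_pmul2l//; apply: ge0_subset_integral => //; exact: measurable_cube.
have := le_trans step1 step2.
rewrite -(@lee_pmul2l _ (Q^-1 * 4)%:E)//; last by rewrite lte_fin mulr_gt0// invr_gt0.
rewrite !muleA -!EFinM.
rewrite (_ : Q^-1 * 4 * (Q ^+ 2 / 4) = Q); last by field; rewrite gt_eqF.
by rewrite (_ : Q^-1 * 4 * Q = 4)//; field; rewrite gt_eqF.
Qed.

End concentration.

(** * Doubling for integrals of positive definite transforms over cubes *)

Section doubling.
Context {R : realType} (n : nat).
Local Notation V := (borel 'rV[R]_n).
Local Notation lambda := (lebesgue_rV R n).
Variable tau : {finite_measure set V -> \bar R}.
Hypothesis tau_ge0 : forall xi, 0 <= cosft tau xi.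

Definition ball_energy r := (\int[lambda]_(xi in cube r) (cosft tau xi)%:E)%E.

Lemma measurable_cosft_translate (a : 'rV[R]_n) :
  measurable_fun setT (fun xi : V => cosft tau ((xi : 'rV[R]_n) + a)).
Proof. by apply: measurableT_comp (measurable_cosft tau) _; exact: measurable_translate. Qed.

Lemma integral_cube_diff_cosft r a :
  (\int[cube_diff n r]_xi (cosft tau ((xi : 'rV[R]_n) + a))%:E =
   (\int[cube_diff n r]_xi cosft tau ((xi : 'rV[R]_n) + a))%:E)%E.
Proof.
apply: (@integral_EFin_Rintegral _ _ _ _ _ (fine (tau setT))).
  exact: measurable_cosft_translate.
by move=> x; exact: cosft_le.
Qed.

(** The autocorrelation of [cube (r *+ 2)] has density at least [(r *+ 2) ^+ n] on [cube r] and at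
    most [(r *+ 4) ^+ n] on its support [cube (r *+ 4)]. Between these two bounds
    [cosft_translate_le] removes the translation, and the ratio of the constants is [2 ^+ n]. *)
Lemma integral_translate_cube_le r a : 0 < r ->
  (\int[lambda]_(xi in cube r) (cosft tau ((xi : 'rV[R]_n) + a))%:E <=
   (2 ^+ n)%:E * ball_energy (r *+ 4))%E.
Proof.
move=> r0.
have Q0 : 0 < (r *+ 2) ^+ n by rewrite exprn_gt0// mulr2n addr_gt0.
have h1 := @integral_cube_diff_ge _ n r (fun xi => (cosft tau ((xi : 'rV[R]_n) + a))%:E) (ltW r0).
have h2 := @integral_cube_diff_le _ n (r *+ 2) (fun xi => (cosft tau xi)%:E).
have r20 : 0 <= r *+ 2 by rewrite mulr2n addr_ge0// ltW.
have m1 : measurable_fun setT (fun xi : V => (cosft tau ((xi : 'rV[R]_n) + a))%:E).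
  by apply/measurable_EFinP; exact: measurable_cosft_translate.
have m2 : measurable_fun setT (fun xi : V => (cosft tau xi)%:E).
  by apply/measurable_EFinP; exact: measurable_cosft.
have {}h1 := h1 m1 (fun x => tau_ge0 _).
have {}h2 := h2 r20 m2 (fun x => tau_ge0 _).
have h3 : (\int[cube_diff n (r *+ 2)]_xi (cosft tau ((xi : 'rV[R]_n) + a))%:E <=
           \int[cube_diff n (r *+ 2)]_xi (cosft tau xi)%:E)%E.
  rewrite integral_cube_diff_cosft.
  have := integral_cube_diff_cosft (r *+ 2) 0.
  under eq_integral do rewrite addr0.
  under eq_Rintegral do rewrite addr0.
  move=> ->; rewrite lee_fin; apply: cosft_translate_le.
    by move=> x; exact: sinft_diff_law_self.
  by move=> x; exact: cosft_cube_diff_ge0.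
have := le_trans h1 (le_trans h3 h2).
rewrite -(@lee_pmul2l _ ((r *+ 2) ^+ n)^-1%:E)//; last by rewrite lte_fin invr_gt0.
rewrite !muleA -!EFinM mulVf ?gt_eqF// mul1e => /le_trans; apply.
rewrite le_eqVlt; apply/orP; left; apply/eqP; congr (_%:E * _)%E; last first.
  by rewrite /ball_energy -mulrnA.
rewrite -!exprVn -exprMn; congr (_ ^+ n).
rewrite -(mulr_natr (r *+ 2) 2) mulrA mulVf ?mul1r//.
by rewrite gt_eqF// mulr2n addr_gt0.
Qed.

(* The cube of radius [2 r] is covered by [17 ^ n] translates of the cube of
   radius [r / 4]; positive definiteness bounds the integral over each of them
   by [2 ^ n] times the integral over the centred cube of radius [r]. *)
Lemma ball_energy_doubling r : 0 < r -> (ball_energy (r *+ 2) <= (34 ^+ n)%:E * ball_energy r)%E.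
Proof.
move=> r0; pose p := r / 4.
have p0 : 0 < p by rewrite divr_gt0.
(* A coordinate in [[- 8 * p, 8 * p]], divided by [p] and shifted by 8, has its integer part among
   0, ..., 16. *)
pose a (f : {ffun 'I_n -> 'I_17}) : 'rV[R]_n := \row_i (((f i)%:R - 8) * p).
pose g (f : {ffun 'I_n -> 'I_17}) (y : V) := ((fun y : V => (cosft tau ((y : 'rV[R]_n) + a f))%:E) \_ (cube p) y)%E.
have mg f : measurable_fun setT (g f).
  apply/(measurable_restrictT _ _).1 => //; first exact: measurable_cube.
  by apply: measurable_funTS; apply/measurable_EFinP; exact: measurable_cosft_translate.
have g0 f y : (0 <= g f y)%E by rewrite /g patchE; case: ifP => // _; rewrite lee_fin.
have mgt f : measurable_fun setT (fun x : V => g f ((x : 'rV[R]_n) - a f)).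
  by apply: measurableT_comp (mg f) _; exact: measurable_translate.
have ig f : (\int[lambda]_x g f ((x : 'rV[R]_n) - a f)%R <= (2 ^+ n)%:E * ball_energy r)%E.
  rewrite (@integral_lebesgue_rV_translate _ _ (- a f) (g f))// /g -integral_mkcond.
  by have := integral_translate_cube_le (a f) p0; rewrite (_ : p *+ 4 = r)// /p; lra.
apply: (@le_trans _ _ (\int[lambda]_x (\sum_f g f ((x : 'rV[R]_n) - a f)%R))%E).
  rewrite /ball_energy integral_mkcond; apply: ge0_le_integral => //.
  - by move=> x _; rewrite patchE; case: ifP => // _; rewrite lee_fin.
  - apply/(measurable_restrictT _ _).1 => //; first exact: measurable_cube.
    by apply: measurable_funTS; apply/measurable_EFinP; exact: measurable_cosft.
  - by apply: emeasurable_sum => f.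
  - move=> x _; rewrite patchE; case: ifPn => [|_]; last exact: sume_ge0.
    rewrite inE => /cubeE xr.
    have q0 i : 0 <= x ord0 i / p + 8.
      rewrite -lerBlDr sub0r ler_pdivlMr//; have := xr i.
      by rewrite ler_norml => /andP[+ _]; rewrite /p; lra.
    have q16 i : x ord0 i / p + 8 < 17%:R.
      rewrite -ltrBrDr ltr_pdivrMr//; have := xr i.
      by rewrite ler_norml => /andP[_]; rewrite /p; lra.
    have tr i := truncn_itv (q0 i).
    have ti i : (Num.truncn (x ord0 i / p + 8) < 17)%N.
      by rewrite -(ltr_nat R); apply: le_lt_trans (q16 i); have /andP[] := tr i.
    pose f0 : {ffun 'I_n -> 'I_17} := [ffun i => Ordinal (ti i)].
    rewrite (bigD1 f0)//= -[leLHS]adde0; apply: leeD; last exact: sume_ge0.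
    rewrite /g patchE ifT ?subrK// inE; apply/cubeE => i; rewrite !mxE ffunE /=.
    have /andP[t1 t2] := tr i; move: t2; rewrite -[(Num.truncn _).+1]addn1 natrD => t2.
    rewrite (_ : _ - _ = (x ord0 i / p + 8 - (Num.truncn (x ord0 i / p + 8))%:R) * p); last first.
      by field; rewrite gt_eqF.
    by rewrite normrM (gtr0_norm p0) ger_pMl// ger0_norm; lra.
rewrite ge0_integral_sum//.
apply: (@le_trans _ _ (\sum_(f : {ffun 'I_n -> 'I_17}) (2 ^+ n)%:E * ball_energy r)%E).
  by apply: lee_sum => f _; exact: ig.
have -> : (\sum_(f : {ffun 'I_n -> 'I_17}) (2 ^+ n)%:E * ball_energy r = (17 ^+ n)%:R%:E * ((2 ^+ n)%:E * ball_energy r))%E.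
  rewrite -[in LHS](mul1e (_ * _)%E).
  rewrite -ge0_sume_distrl// sumEFin sumr_const card_ffun !card_ord.
  by rewrite natrX.
by rewrite muleA -EFinM natrX -exprMn (_ : 17 * 2 = 34 :> R) // -natrM.
Qed.

End doubling.

(** * The transform of a cube as a product of one-dimensional kernels *)

Section sinc.
Context {R : realType}.
Local Notation mu := (@lebesgue_measure R).

Let itvm (r : R) : {measure set (measurableTypeR R) -> \bar R} := mrestr mu (measurable_itv `[(- r)%R, r]).

Let itvmT (r : R) : itvm r setT = mu `[(- r)%R, r].
Proof. by rewrite -[in RHS](setTI `[(- r)%R, r]%classic). Qed.

Let itv_lty (r : R) : (itvm r setT < +oo)%E.
Proof.
rewrite itvmT lebesgue_measure_itv /= lte_fin.
by case: ifP => // _; rewrite ltry.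
Qed.

Definition itv_measure (r : R) : {finite_measure set (measurableTypeR R) -> \bar R} := fin_measure (itv_lty r).

(** The transform of the indicator of [[-r, r]], that is sin(2 pi r t) / (pi t) for nonzero [t]. *)
Definition sinc (r t : R) : R := \int[itv_measure r]_u cos (2 * pi * (u * t)).

Let mcos t : measurable_fun setT (fun u : R => cos (2 * pi * (u * t))).
Proof. by apply: measurable_cosT; do 2 apply: measurable_funM => //. Qed.

Let msin t : measurable_fun setT (fun u : R => sin (2 * pi * (u * t))).
Proof. by apply: measurable_sinT; do 2 apply: measurable_funM => //. Qed.

Lemma sinc_le r t : 0 <= r -> `|sinc r t| <= r *+ 2.
Proof.
move=> r0; apply: le_trans (@Rintegral_le_bound _ (measurableTypeR R) R (itv_measure r) _ 1 (mcos t) (fun u => cos_max _)) _.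
rewrite mul1r [X in fine X](itvmT r) lebesgue_measure_itv /= lte_fin.
by case: ifP => _ /=; rewrite ?opprK -?mulr2n// mulrn_wge0.
Qed.

Let FTC_itv (r : R) (f F : R -> R) : 0 < r ->
  (forall x : R, is_derive x (1 : R) F (f x)) -> continuous f ->
  (forall x, `|f x| <= 1) ->
  \int[itv_measure r]_u f u = F r - F (- r).
Proof.
move=> r0 dF cf f1; have mf : measurable_fun setT f by exact: continuous_measurable_fun.
have -> : \int[itv_measure r]_u f u = \int[mu]_(u in `[- r, r]) f u.
  by apply: Rintegral_mrestr; exact: (@bounded_integrable _ (measurableTypeR R) R (itv_measure r) f 1 setT measurableT mf f1).
rewrite /Rintegral (@continuous_FTC2 _ _ F)//.
- by rewrite -subr_gt0 opprK addr_gt0.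
- by apply: continuous_subspaceT.
- have cF : continuous F.
    move=> x; apply: differentiable_continuous; apply/derivable1_diffP.
    by have [] := dF x.
  split.
  + by move=> x _; have [] := dF x.
  + by apply: cvg_at_right_filter; exact: cF.
  + by apply: cvg_at_left_filter; exact: cF.
- by move=> x _; rewrite derive1E; apply: derive_val.
Qed.

Let derive_scaled (w x : R) : is_derive x (1 : R) (fun u : R => u * w) w.
Proof.
rewrite (_ : (fun u : R => u * w) = w \*: (id : R -> R)); last by apply/funext => u /=; rewrite mulrC.
rewrite -[X in is_derive _ _ _ X]mulr1; exact: is_deriveZ.
Qed.

Let derive_sin_scaled (w x : R) : w != 0 ->
  is_derive x (1 : R) (fun u : R => w^-1 * sin (u * w)) (cos (x * w)).
Proof.
move=> w0; have h := derive_scaled w x.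
rewrite (_ : (fun u : R => _) = w^-1 \*: (sin \o (fun u : R => u * w)))//.
rewrite (_ : cos (x * w) = w^-1 *: (w * cos (x * w))); last by rewrite /GRing.scale /= mulKf.
by apply: is_deriveZ; rewrite mulrC; exact: is_derive1_comp.
Qed.

Let derive_cos_scaled (w x : R) : w != 0 ->
  is_derive x (1 : R) (fun u : R => - w^-1 * cos (u * w)) (sin (x * w)).
Proof.
move=> w0; have h := derive_scaled w x.
rewrite (_ : (fun u : R => _) = - w^-1 \*: (cos \o (fun u : R => u * w)))//.
rewrite (_ : sin (x * w) = - w^-1 *: (w * - sin (x * w))); last first.
  by rewrite /GRing.scale /= mulrN mulrNN mulKf.
by apply: is_deriveZ; rewrite mulrC; exact: is_derive1_comp.
Qed.

Lemma sinc_decay r t : 0 < r -> `|sinc r t| * `|t| <= 1.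
Proof.
move=> r0; have [->|t0] := eqVneq t 0; first by rewrite normr0 mulr0.
pose w := 2 * pi * t.
have pi0 : 0 < pi :> R := pi_gt0 R.
have w0 : w != 0 by rewrite !mulf_neq0// gt_eqF.
have -> : sinc r t = \int[itv_measure r]_u cos (u * w).
  by apply: eq_Rintegral => u _; congr cos; rewrite /w; ring.
rewrite (FTC_itv r0 (fun x => derive_sin_scaled x w0)); last 2 first.
- move=> x; apply: (@continuous_comp R R R (fun u => u * w) cos); last exact: continuous_cos.
  exact: mulrr_continuous.
- by move=> x; exact: cos_max.
rewrite mulNr sinN mulrN opprK -mulr2n normrMn normrM normfV.
rewrite (_ : `|w| = 2 * pi * `|t|); last by rewrite /w !normrM (gtr0_norm pi0) normr_nat.
have s1 := sin_max (r * w).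
have t1 : 0 < `|t| by rewrite normr_gt0.
have p2 : 2 <= pi :> R := pi_ge2 R.
have hk (a b s : R) : a != 0 -> b != 0 -> (2 * a * b)^-1 * s *+ 2 * b = s / a.
  by move=> a0 b0; rewrite -mulr_natr; field; rewrite a0 b0.
rewrite hk ?gt_eqF//.
by rewrite ler_pdivrMr// mul1r; lra.
Qed.

Lemma int_sin_itv r t : 0 < r -> \int[itv_measure r]_u sin (2 * pi * (u * t)) = 0.
Proof.
move=> r0; have [->|t0] := eqVneq t 0.
  under eq_Rintegral do rewrite !mulr0 sin0.
  by rewrite Rintegral_cst// mul0r.
pose w := 2 * pi * t.
have pi0 : 0 < pi :> R := pi_gt0 R.
have w0 : w != 0 by rewrite !mulf_neq0// gt_eqF.
have -> : \int[itv_measure r]_u sin (2 * pi * (u * t)) = \int[itv_measure r]_u sin (u * w).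
  by apply: eq_Rintegral => u _; congr sin; rewrite /w; ring.
rewrite (FTC_itv r0 (fun x => derive_cos_scaled x w0)); last 2 first.
- move=> x; apply: (@continuous_comp R R R (fun u => u * w) sin); last exact: continuous_sin.
  exact: mulrr_continuous.
- by move=> x; exact: sin_max.
by rewrite (mulNr r w) cosN subrr.
Qed.

Lemma cube_measure_consv n r (A : set (borel 'rV[R]_n.+1)) : measurable A ->
  cube_measure n.+1 r A =
  law (fin_product (itv_measure r) (cube_measure n r)) (@measurable_consv R n) A.
Proof.
move: A; apply: (borel_measure_unique (m1 := cube_measure n.+1 r)
  (m2 := law (fin_product (itv_measure r) (cube_measure n r)) (@measurable_consv R n))).
- move=> a b ab; transitivity (lebesgue_rV R n.+1 (cbox a b `&` cube r)); first by [].
  transitivity ((itv_measure r \x cube_measure n r)%E (@consv R n @^-1` cbox a b)); last by [].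
  rewrite consv_preimage [RHS](product_measure1E (itv_measure r) (cube_measure n r))//; last exact: measurable_cbox.
  have mI : measurable (cbox a b `&` cube r : set (borel 'rV[R]_n.+1)).
    by apply: measurableI; [exact: measurable_cbox|exact: measurable_cube].
  rewrite [LHS](lebesgue_rV_consv mI) /law /pushforward preimage_setI /cube !consv_preimage.
  rewrite -setXI.
  rewrite [LHS](product_measure1E (@lebesgue_measure R) (lebesgue_rV R n)); last 2 first.
  + by apply: measurableI.
  + by apply: measurableI; exact: measurable_cbox.
  rewrite /itv_measure /fin_measure /mrestr !mxE.
  by congr (_ * lebesgue_rV R n (_ `&` cbox _ _))%E; apply/rowP => i; rewrite !mxE.
- move=> q; exact: (finite_measure_lty (cube_measure n.+1 r) (measurable_cube q)).
Qed.

Lemma dotv_consv n (z : R * borel 'rV[R]_n) (x : 'rV[R]_n.+1) :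
  dotv (consv z : 'rV[R]_n.+1) x = z.1 * x ord0 ord0 + dotv (z.2 : 'rV[R]_n) (\row_i x ord0 (lift ord0 i)).
Proof.
rewrite /dotv big_ord_recl consv0; congr (_ + _); apply: eq_bigr => i _.
by rewrite consvS mxE.
Qed.

(** Induction along [consv]: the addition formulas separate the first coordinate from the tail, and
    the terms with a sine vanish because interval and cube are symmetric. *)
Lemma cosft_sinft_cube n r (x : 'rV[R]_n) : 0 < r ->
  cosft (cube_measure n r) x = \prod_i sinc r (x ord0 i) /\ sinft (cube_measure n r) x = 0.
Proof.
move=> r0; elim: n x => [|n ih] x.
  rewrite big_ord0 /cosft /sinft.
  under eq_Rintegral do rewrite /dotv big_ord0 mulr0 cos0.
  under [X in _ /\ X = _]eq_Rintegral do rewrite /dotv big_ord0 mulr0 sin0.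
  rewrite !Rintegral_cst// mul0r; split => //.
  by rewrite [X in fine X](cube_measureT 0 (ltW r0)) mul1r.
pose y : 'rV[R]_n := \row_i x ord0 (lift ord0 i).
have [ihc ihs] := ih y.
have mphase : measurable_fun setT (fun z : R * borel 'rV[R]_n => 2 * pi * (z.1 * x ord0 ord0 + dotv (z.2 : 'rV[R]_n) y)).
  apply: measurable_funM => //; apply: measurable_funD.
    by apply: measurable_funM => //; exact: measurable_fst.
  by apply: measurable_dotv; [exact: measurable_snd|exact: measurable_cst].
have L (g : R -> R) : measurable_fun setT g -> (forall u, `|g u| <= 1) ->
    \int[cube_measure n.+1 r]_v g (2 * pi * dotv (v : 'rV[R]_n.+1) x) =
    \int[itv_measure r]_t \int[cube_measure n r]_v g (2 * pi * (t * x ord0 ord0 + dotv (v : 'rV[R]_n) y)).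
  move=> mg g1.
  have -> : \int[cube_measure n.+1 r]_v g (2 * pi * dotv (v : 'rV[R]_n.+1) x) =
    \int[law (fin_product (itv_measure r) (cube_measure n r)) (@measurable_consv R n)]_v
       g (2 * pi * dotv (v : 'rV[R]_n.+1) x).
    rewrite /Rintegral; congr fine; apply: eq_measure_integral => A mA _.
    exact: cube_measure_consv.
  rewrite (@Rintegral_law _ _ _ _ _ _ _ _ (fun v : borel 'rV[R]_n.+1 => g (2 * pi * dotv (v : 'rV[R]_n.+1) x)) 1); last 2 first.
  - by apply: measurableT_comp mg _; apply: measurable_phase => //; exact: measurable_cst.
  - by move=> v; exact: g1.
  have mgp : measurable_fun setT (fun z : R * borel 'rV[R]_n => g (2 * pi * (z.1 * x ord0 ord0 + dotv (z.2 : 'rV[R]_n) y))).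
    exact: measurableT_comp mg mphase.
  apply: etrans (@Rintegral_prod _ _ _ _ _ (itv_measure r) (cube_measure n r) _ 1 mgp (fun z => g1 _)).
  by apply: eq_Rintegral => z _; rewrite dotv_consv.
have ic := integrable_cos (cube_measure n r) y; have is' := integrable_sin (cube_measure n r) y.
have ZlE (c : R) (f : borel 'rV[R]_n -> R) : (cube_measure n r).-integrable setT (EFin \o f) ->
    (cube_measure n r).-integrable setT (EFin \o (fun v => c * f v)).
  by move=> fi; rewrite (_ : _ \o _ = (fun x => c%:E * (EFin \o f) x)%E) //; exact: integrableZl.
have itvi (g : R -> R) : measurable_fun setT g -> (forall u, `|g u| <= 1) ->
   (itv_measure r).-integrable setT (EFin \o g).
  by move=> mg g1; exact: (@bounded_integrable _ (measurableTypeR R) R (itv_measure r) g 1 setT measurableT mg g1).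
split.
  rewrite /cosft (L cos)//; last 2 first.
  - by apply: continuous_measurable_fun; exact: continuous_cos.
  - by move=> u; exact: cos_max.
  transitivity (\int[itv_measure r]_t (cos (2 * pi * (t * x ord0 ord0)) * cosft (cube_measure n r) y)).
    apply: eq_Rintegral => t _; under eq_Rintegral do rewrite mulrDr cosD.
    rewrite RintegralB//; [|exact: ZlE|exact: ZlE].
    by rewrite !RintegralZl// -/(sinft _ _) ihs mulr0 subr0.
  rewrite RintegralZr//; last by apply: itvi => // u; exact: cos_max.
  rewrite ihc big_ord_recl -/(sinc _ _); congr (_ * _); by apply: eq_bigr => i _; rewrite mxE.
rewrite /sinft (L sin)//; last 2 first.
- by apply: continuous_measurable_fun; exact: continuous_sin.
- by move=> u; exact: sin_max.
transitivity (\int[itv_measure r]_t (sin (2 * pi * (t * x ord0 ord0)) * cosft (cube_measure n r) y)).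
  apply: eq_Rintegral => t _; under eq_Rintegral do rewrite mulrDr sinD.
  rewrite RintegralD//; [|exact: ZlE|exact: ZlE].
  by rewrite !RintegralZl// -/(sinft _ _) ihs mulr0 addr0.
rewrite RintegralZr//; last by apply: itvi => // u; exact: sin_max.
by rewrite int_sin_itv// mul0r.
Qed.

End sinc.

(** * Fourier decay of Frostman measures *)

Section frostman_fourier.
Context {R : realType} (n : nat).
Local Notation V := (borel 'rV[R]_n).
Local Notation lambda := (lebesgue_rV R n).

Definition frostman (mu : {measure set V -> \bar R}) (C s : R) :=
  forall (x : 'rV[R]_n) (r : R), 0 < r <= 1 ->
    (mu [set y | cube r ((y : 'rV[R]_n) - x)%R] <= (C * r `^ s)%:E)%E.

Lemma measurable_translated_cube (x : 'rV[R]_n) r :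
  measurable [set y : V | cube r ((y : 'rV[R]_n) - x)].
Proof.
have := @measurable_translate R n (- x) measurableT _ (measurable_cube r).
by rewrite setTI.
Qed.

Lemma sum_inv_sqr_le N : \sum_(j < N) (1 + (j%:R : R) ^+ 2)^-1 <= 3.
Proof.
suff : \sum_(j < N) (1 + (j%:R : R) ^+ 2)^-1 <= 3 - 3 / (N%:R + 1).
  move/le_trans; apply; rewrite gerBl divr_ge0// addr_ge0//.
elim: N => [|N ih]; first by rewrite big_ord0 add0r divr1 subrr.
rewrite big_ord_recr /=; apply: le_trans (lerD ih (lexx _)) _.
have N0 : 0 <= N%:R :> R by [].
(* Integrality enters here: the telescoping bound 1 / (1 + x^2) <= 3 / ((x + 1) (x + 2)) amounts to
   (2 x - 1) (x - 1) >= 0, which fails between 1/2 and 1. *)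
have N1 : 0 <= (2 * N%:R - 1) * (N%:R - 1) :> R.
  case: N {ih N0} => [|N]; first lra.
  by rewrite -natr1; have : 0 <= N%:R :> R by []; nra.
rewrite -(natr1 N); move: N0 N1; set x : R := N%:R => N0 N1.
have x1 : 0 < x + 1 by rewrite ltr_wpDl.
have x2 : 0 < x + 1 + 1 by rewrite ltr_wpDl// ltW.
have x3 : 0 < 1 + x ^+ 2 by rewrite ltr_pwDl// sqr_ge0.
suff : (1 + x ^+ 2)^-1 <= 3 / ((x + 1) * (x + 1 + 1)).
  have -> : 3 / ((x + 1) * (x + 1 + 1)) = 3 / (x + 1) - 3 / (x + 1 + 1).
    by field; rewrite !gt_eqF.
  by lra.
rewrite ler_pdivlMr ?mulr_gt0// mulrC ler_pdivrMr//; nra.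
Qed.

(** For [j <= 2] the trivial bound [2 * rho] and 1 + j^2 <= 5 give the constant 4 * 5 = 20. For
    larger [j] the decay of [sinc] gives rho / (j - 1), and 1 + j^2 <= 20 (j - 1)^2. *)
Lemma sinc2_le rho w (j : nat) (b : bool) : 1 <= rho ->
  `|rho * w - (-1) ^+ b * j%:R| <= 1 ->
  sinc rho w ^+ 2 <= 20 * rho ^+ 2 / (1 + (j%:R : R) ^+ 2).
Proof.
move=> rho1 h; have rho0 : 0 < rho by apply: lt_le_trans rho1.
have s1 := sinc_le w (ltW rho0); have s2 := sinc_decay w rho0.
have jw : j%:R - 1 <= rho * `|w|.
  have : `|(-1) ^+ b * j%:R| - `|rho * w| <= 1.
    by apply: le_trans h; rewrite distrC; exact: lerB_dist.
  by rewrite !normrM normrX normrN1 expr1n mul1r normr_nat (gtr0_norm rho0); lra.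
have J0 : 0 <= j%:R :> R by [].
have D0 : 0 < 1 + (j%:R : R) ^+ 2 by rewrite ltr_pwDl// sqr_ge0.
rewrite ler_pdivlMr// -(real_normK (num_real (sinc _ _))).
have s0 := normr_ge0 (sinc rho w); move: s0 s1 s2.
rewrite mulr2n; set S := `|sinc rho w|; set W := `|w| => s0 s1 s2.
have W0 : 0 <= W by exact: normr_ge0.
have [j2|j2] := leqP j 2.
  have jr : j%:R <= 2 :> R by rewrite (ler_nat R _ 2).
  have S2 : S ^+ 2 <= 4 * rho ^+ 2 by nra.
  have : (j%:R : R) ^+ 2 <= 4 by nra.
  move: S2 D0; set A := S ^+ 2; set B := rho ^+ 2; set D := (j%:R : R) ^+ 2.
  have : 0 <= A by rewrite sqr_ge0.
  have : 0 <= D by rewrite sqr_ge0.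
  nra.
have jr : 3 <= j%:R :> R by rewrite (ler_nat R 3).
have : S * (j%:R - 1) <= rho.
  apply: (@le_trans _ _ (S * (rho * W))); first by rewrite ler_wpM2l.
  by rewrite mulrCA -[leRHS]mulr1 ler_wpM2l// ltW.
move=> SJ.
have : S ^+ 2 * (j%:R - 1) ^+ 2 <= rho ^+ 2.
  rewrite -exprMn; apply: lerXn2r => //; rewrite nnegrE ?mulr_ge0//; lra.
have : 1 + (j%:R : R) ^+ 2 <= 20 * (j%:R - 1) ^+ 2 by nra.
have A0 : 0 <= S ^+ 2 by rewrite sqr_ge0.
nra.
Qed.

(** Duality turns the energy over [cube r] into the integral over [mu] x [mu] of a product of
    squared sincs that concentrates at scale 1 / rho. For fixed [x] the points [y] are sorted into
    cubes of radius [rho^-1] centred on a lattice around [x]: each cube has mass at most C rho^(-s),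
    and squaring has made the lattice weights summable. *)
Lemma frostman_fourier (mu : {finite_measure set V -> \bar R}) (C s : R) : 0 <= s ->
  frostman mu C s -> mu (~` [set x : 'rV[R]_n | forall i, 0 <= x ord0 i <= 1]) = 0%E ->
  exists2 K : R, 0 <= K & forall r, 1 <= r ->
    (ball_energy (diff_law mu mu) r <= (K * r `^ (n%:R - s))%:E)%E.
Proof.
move=> s0 muC muE.
pose U : set V := [set x : 'rV[R]_n | forall i, 0 <= x ord0 i <= 1].
have mU : measurable U.
  rewrite (_ : U = cbox 0 (const_mx 1)); first exact: measurable_cbox.
  by rewrite eqEsubset; split => x h i; have := h i; rewrite !mxE.
have C0 : 0 <= C.
  have := muC 0 1; rewrite ltr01 lexx powR1 mulr1 => /(_ isT).
  by move/(le_trans (measure_ge0 _ _)); rewrite lee_fin.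
pose M := fine (mu setT).
have M0 : 0 <= M by rewrite fine_ge0.
(* Per coordinate, 20 from [sinc2_le], 3 from the series and 2 from the signs give 120; the
   remaining 2 comes from [rho], which is twice [r]. *)
exists (240 ^+ n * C * M); first by rewrite !mulr_ge0// exprn_ge0.
move=> r r1; have r0 : 0 < r by apply: lt_le_trans r1.
pose rho := r *+ 2.
have rho1 : 1 <= rho by rewrite /rho mulr2n; lra.
have rho0 : 0 < rho by apply: lt_le_trans rho1.
(* Coordinates of points of the unit cube differ by at most 1, so the lattice index, the integer
   part of [rho] times that difference, stays below [N]. *)
pose N := (Num.truncn rho).+1.
pose J := ('I_N * bool)%type.
pose c (j : J) : R := 20 * rho ^+ 2 / (1 + (j.1%:R : R) ^+ 2).
have D0 (j : J) : 0 < 1 + (j.1%:R : R) ^+ 2 by rewrite ltr_pwDl// sqr_ge0.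
have c0 j : 0 <= c j by rewrite /c divr_ge0 ?mulr_ge0 ?sqr_ge0// ltW.
have sumc : \sum_(j : J) c j <= 120 * rho ^+ 2.
  rewrite -(pair_big xpredT xpredT (fun (j : 'I_N) (b : bool) => c (j, b)))/=.
  under eq_bigr do rewrite big_bool /=.
  rewrite big_split /c /= -mulr_sumr.
  have := sum_inv_sqr_le N; have := sqr_ge0 rho; nra.
pose ctr (x : 'rV[R]_n) (f : {ffun 'I_n -> J}) : 'rV[R]_n :=
  \row_i (x ord0 i - (-1) ^+ (f i).2 * (f i).1%:R / rho).
pose A x f : set V := [set y | cube rho^-1 ((y : 'rV[R]_n) - ctr x f)].
pose D (w : 'rV[R]_n) : R := cosft (cube_diff n rho) w.
have DE w : D w = (\prod_i sinc rho (w ord0 i)) ^+ 2.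
  rewrite /D cosft_diff_law_self.
  by have [-> ->] := cosft_sinft_cube w rho0; rewrite expr0n addr0.
have D_le (x y : 'rV[R]_n) : U x -> U y -> D (x - y) <= \sum_(f : {ffun 'I_n -> J}) (\prod_i c (f i)) * \1_(A x f) (y : V).
  move=> Ux Uy.
  have q1 i : rho * `|(x - y) ord0 i| < N%:R.
    apply: le_lt_trans (truncnS_gt rho); rewrite ger_pMr// !mxE.
    have := Ux i; have := Uy i => /andP[? ?] /andP[? ?].
    by rewrite ler_norml; apply/andP; split; lra.
  have q0 i : 0 <= rho * `|(x - y) ord0 i| by rewrite mulr_ge0// ltW.
  pose q i := Num.truncn (rho * `|(x - y) ord0 i|).
  have qitv i : (q i)%:R <= rho * `|(x - y) ord0 i| < (q i).+1%:R by exact: truncn_itv (q0 i).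
  have tq i : (q i < N)%N.
    by rewrite -(ltr_nat R); apply: le_lt_trans (q1 i); have /andP[] := qitv i.
  pose f0 : {ffun 'I_n -> J} := [ffun i => (Ordinal (tq i), (x - y) ord0 i < 0)].
  have f0i i : `|rho * (x - y) ord0 i - (-1) ^+ (f0 i).2 * (f0 i).1%:R| <= 1.
    rewrite ffunE /=; have /andP[] := qitv i.
    rewrite -[(q i).+1]addn1 natrD; move: (q i) => k.
    case: (ltP ((x - y) ord0 i) 0) => w0 /=; rewrite ?expr1 ?expr0.
      by rewrite (ltr0_norm w0) => h1 h2; rewrite ler_norml; apply/andP; split; lra.
    by rewrite (ger0_norm w0) => h1 h2; rewrite ler_norml; apply/andP; split; lra.
  rewrite (bigD1 f0)//= -[leLHS]addr0; apply: lerD; last first.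
    by apply: sumr_ge0 => f _; rewrite mulr_ge0// prodr_ge0// => i _.
  rewrite indicE mem_set ?mulr1; last first.
    rewrite /A /=; apply/cubeE => i; rewrite !mxE.
    have := f0i i; rewrite !mxE; move: ((-1) ^+ _ * _) => e he.
    rewrite -(ler_pM2l rho0) divff ?gt_eqF//; apply: le_trans he.
    rewrite -{1}(gtr0_norm rho0) -normrM -normrN le_eqVlt; apply/orP; left; apply/eqP.
    by congr (`|_|); field; rewrite gt_eqF.
  rewrite DE -prodrXl; apply: ler_prod => i _; rewrite sqr_ge0/=.
  exact: (sinc2_le rho1 (f0i i)).
pose B : R := (120 * rho ^+ 2) ^+ n * (C * rho^-1 `^ s).
have rs0 : 0 <= rho^-1 `^ s by exact: powR_ge0.
have mA x f : measurable (A x f) by exact: measurable_translated_cube.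
have mDsub (x : 'rV[R]_n) : measurable_fun setT (fun y : V => D (x - (y : 'rV[R]_n))).
  apply: measurableT_comp (measurable_cosft _) _.
  by apply: measurable_submx => //; exact: measurable_cst.
have Dge0 w : 0 <= D w by rewrite DE sqr_ge0.
have inner x : U x -> (\int[mu]_y (D (x - (y : 'rV[R]_n)))%:E <= B%:E)%E.
  move=> Ux.
  rewrite (@ge0_negligible_integral _ _ _ _ setT (~` U));
    do ?[exact: measurableC | exact/measurable_EFinP | by move=> y _; rewrite lee_fin | by []].
  rewrite setTD setCK.
  apply: (@le_trans _ _ (\int[mu]_(y in U) (\sum_(f : {ffun 'I_n -> J}) (\prod_i c (f i))%:E * (\1_(A x f) y)%:E))%E).
    apply: ge0_le_integral => //.
    - by move=> y _; rewrite lee_fin.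
    - by apply: measurable_funTS; exact/measurable_EFinP.
    - apply: emeasurable_sum => f; apply: measurable_funTS.
      apply/measurable_EFinP; apply: measurable_funM => //; exact: measurable_indic.
    - move=> y Uy; apply: le_trans (_ : (\sum_(f : {ffun 'I_n -> J}) (\prod_i c (f i)) * \1_(A x f) y)%:E <= _)%E.
        by rewrite lee_fin; exact: D_le.
      by rewrite -sumEFin.
  rewrite ge0_integral_sum//; last 2 first.
  - move=> f; apply: measurable_funTS.
    apply/measurable_EFinP; apply: measurable_funM => //; exact: measurable_indic.
  - by move=> f y _; rewrite -EFinM lee_fin mulr_ge0// prodr_ge0.
  apply: (@le_trans _ _ (\sum_(f : {ffun 'I_n -> J}) (\prod_i c (f i))%:E * (C * rho^-1 `^ s)%:E)%E).
    apply: lee_sum => f _; rewrite ge0_integralZl_EFin//.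
    - apply: lee_wpmul2l; first by rewrite lee_fin prodr_ge0.
      rewrite integral_indic//; apply: le_trans (muC (ctr x f) rho^-1 _).
        by apply: le_measure; rewrite ?inE//; [exact: measurableI|exact: mA].
      by rewrite invr_gt0 rho0 invf_le1.
    - by apply: measurable_funTS; apply/measurable_EFinP; exact: measurable_indic.
    - by rewrite prodr_ge0.
  rewrite -ge0_sume_distrl; last by move=> f _; rewrite lee_fin prodr_ge0.
  rewrite sumEFin -EFinM lee_fin /B ler_wpM2r ?mulr_ge0//.
  rewrite -(bigA_distr_bigA (fun (i : 'I_n) (j : J) => c j)) /= prodr_const card_ord.
  by apply: lerXn2r; rewrite ?nnegrE ?sumr_ge0// mulr_ge0 ?sqr_ge0.
have outer : (\int[diff_law mu mu]_w (D w)%:E <= (B * M)%:E)%E.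
  rewrite /diff_law ge0_integral_law; last 2 first.
  - by apply/measurable_EFinP; exact: measurable_cosft.
  - by move=> w; rewrite lee_fin.
  have mDz : measurable_fun setT (fun z : V * V => (D ((z.1 : 'rV[R]_n) - (z.2 : 'rV[R]_n)))%:E).
    apply/measurable_EFinP; apply: measurableT_comp (measurable_cosft _) _; exact: measurable_subV.
  have D0z (z : V * V) : (0 <= (D ((z.1 : 'rV[R]_n) - (z.2 : 'rV[R]_n)))%:E)%E by rewrite lee_fin.
  rewrite /fin_product /fin_measure.
  have -> := fubini_tonelli1 (m1 := mu) (m2 := mu) _ mDz D0z.
  have mF := measurable_fun_fubini_tonelli_F (m2 := mu) _ mDz D0z.
  rewrite (@ge0_negligible_integral _ _ _ _ setT (~` U));
    do ?[exact: measurableC | exact: mF | by move=> x _; apply: integral_ge0 | by []].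
  rewrite setTD setCK.
  apply: (@le_trans _ _ (\int[mu]_(x in U) B%:E)%E).
    apply: ge0_le_integral => //.
    - by move=> x _; apply: integral_ge0.
    - exact: measurable_funTS.
  have B0 : (0 <= B%:E)%E by rewrite lee_fin !mulr_ge0// exprn_ge0// mulr_ge0// sqr_ge0.
  rewrite integral_cst// [(B * M)%:E]EFinM lee_wpmul2l// /M fineK ?fin_num_measure//.
  by apply: le_measure; rewrite ?inE.
have main : ((rho ^+ n)%:E * ball_energy (diff_law mu mu) r <= (B * M)%:E)%E.
  apply: le_trans (integral_cube_diff_ge (ltW r0) _ _) _.
  - by apply/measurable_EFinP; exact: measurable_cosft.
  - by move=> x; rewrite lee_fin cosft_diff_law_self addr_ge0// sqr_ge0.
  rewrite (@integral_EFin_Rintegral _ _ _ _ _ (fine (diff_law mu mu setT))); last 2 first.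
  - exact: measurable_cosft.
  - exact: cosft_le.
  rewrite cosft_duality -(@integral_EFin_Rintegral _ _ _ _ _ (fine (cube_diff n rho setT))); last 2 first.
  - exact: measurable_cosft.
  - exact: cosft_le.
  exact: outer.
have rn0 : 0 < rho ^+ n by rewrite exprn_gt0.
rewrite -(@lee_pmul2l _ (rho ^+ n)%:E)//; apply: (le_trans main).
rewrite -EFinM lee_fin /B.
rewrite powRD; last by rewrite (gt_eqF r0) implybT.
rewrite powR_mulrn ?(ltW r0)//.
have rrho : rho^-1 `^ s <= r `^ (- s).
  rewrite -[X in _ <= _ `^ X]mulN1r powRrM powR_inv1 ?(ltW r0)//.
  apply: ge0_ler_powR => //; rewrite ?nnegrE ?invr_ge0 ?(ltW r0) ?(ltW rho0)//.
  by rewrite lef_pV2 ?posrE// /rho mulr2n lerDl ltW.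
have -> : (120 * rho ^+ 2) ^+ n = rho ^+ n * (240 ^+ n * r ^+ n).
  rewrite -!exprMn; congr (_ ^+ n); rewrite /rho mulr2n; ring.
rewrite -!mulrA ler_wpM2l ?(ltW rn0)// ler_wpM2l ?exprn_ge0//.
rewrite [leRHS](_ : _ = r ^+ n * (C * (r `^ (- s) * M))); last by ring.
rewrite ler_wpM2l ?exprn_ge0 ?(ltW r0)// ler_wpM2l// ler_wpM2r//.
Qed.

End frostman_fourier.

(** * Hausdorff measure of the unit sphere of a norm *)

Section sup_norm.
Context {R : realType} {n : nat}.
Implicit Types x y : 'rV[R]_n.

Lemma cube_norm r x : 0 <= r -> cube r x <-> `|x| <= r.
Proof.
move=> r0; split => [/cubeE h|h].
  by rewrite [leLHS]mx_normrE; apply: bigmax_le => // -[i j] _; rewrite ord1.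
by apply/cubeE => i; apply: le_trans h; rewrite [leRHS]mx_normrE; exact: (le_bigmax _ _ (ord0, i)).
Qed.

Lemma coord_le_norm x i : `|x ord0 i| <= `|x|.
Proof. by have /cubeE := (cube_norm x (normr_ge0 x)).2 (lexx _); exact. Qed.

Lemma enorm_ge0 x : 0 <= enorm x.
Proof. by rewrite sqrtr_ge0. Qed.

Lemma dotv_self_ge0 x : 0 <= dotv x x.
Proof. by apply: sumr_ge0 => i _; rewrite -expr2 sqr_ge0. Qed.

Lemma enorm_sqr x : enorm x ^+ 2 = dotv x x.
Proof. by rewrite sqr_sqrtr// dotv_self_ge0. Qed.

Lemma norm_le_enorm x : `|x| <= enorm x.
Proof.
apply/(cube_norm _ (enorm_ge0 x)); apply/cubeE => i; exact: coord_le_enorm.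
Qed.

Lemma enorm_le_norm x : enorm x <= n%:R * `|x|.
Proof.
rewrite -(@ler_pXn2r _ 2)// ?nnegrE ?enorm_ge0 ?mulr_ge0// enorm_sqr exprMn.
apply: (@le_trans _ _ (n%:R * `|x| ^+ 2)).
  rewrite mulr_natl -[X in _ <= _ *+ X](card_ord n) -sumr_const; apply: ler_sum => i _.
  rewrite -expr2 -(real_normK (num_real _)); apply: lerXn2r; rewrite ?nnegrE//.
  exact: coord_le_norm.
rewrite ler_wpM2r ?sqr_ge0// expr2 -natrM ler_nat.
by case: n => // m; rewrite leq_pmulr.
Qed.

Lemma enormZ t x : enorm (t *: x) = `|t| * enorm x.
Proof.
rewrite /enorm dotvZl dotvC dotvZl mulrA -expr2 sqrtrM ?sqr_ge0//.
by rewrite sqrtr_sqr.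
Qed.

Lemma enormN x : enorm (- x) = enorm x.
Proof. by rewrite -scaleN1r enormZ normrN1 mul1r. Qed.

Lemma enorm0 : enorm (0 : 'rV[R]_n) = 0.
Proof. by rewrite -(scale0r (0 : 'rV[R]_n)) enormZ normr0 mul0r. Qed.

Lemma dotv_le_enorm x y : dotv x y <= enorm x * enorm y.
Proof.
have [x0|x0] := eqVneq (enorm x) 0.
  have := norm_le_enorm x; rewrite x0 normr_le0 => /eqP ->.
  by rewrite mul0r -(scale0r (0 : 'rV[R]_n)) dotvZl mul0r.
have [y0|y0] := eqVneq (enorm y) 0.
  have := norm_le_enorm y; rewrite y0 normr_le0 => /eqP ->.
  by rewrite mulr0 dotvC -(scale0r (0 : 'rV[R]_n)) dotvZl mul0r.
have xp : 0 < enorm x by rewrite lt_neqAle eq_sym x0 enorm_ge0.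
have yp : 0 < enorm y by rewrite lt_neqAle eq_sym y0 enorm_ge0.
have := dotv_self_ge0 (enorm y *: x - enorm x *: y).
rewrite dotvBl !dotvZl ![dotv _ (_ - _)]dotvC !dotvBl !dotvZl -!enorm_sqr (dotvC y x).
set a := enorm x in xp *; set b := enorm y in yp *; set c := dotv x y.
rewrite (_ : _ - _ = 2 * (a * b) * (a * b - c)); last by ring.
by rewrite pmulr_rge0 ?mulr_gt0// subr_ge0.
Qed.

Lemma enormD x y : enorm (x + y) <= enorm x + enorm y.
Proof.
rewrite -(@ler_pXn2r _ 2)// ?nnegrE ?addr_ge0 ?enorm_ge0//.
rewrite enorm_sqr dotvDl !dotvDr -!enorm_sqr (dotvC y x).
have := dotv_le_enorm x y; rewrite sqrrD; lra.
Qed.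

End sup_norm.

(** Shared by the gauge of [K], its rotations and the Euclidean norm. The comparison with the sup
    norm is part of the data because the covering arguments use cubes. *)
Record norm_like (R : realType) (n : nat) (N : 'rV[R]_n -> R) (m M : R) : Prop := NormLike {
  norm_like_gt0 : 0 < m;
  norm_like_gt0' : 0 < M;
  norm_like_ge : forall x, m * `|x| <= N x;
  norm_like_le : forall x, N x <= M * `|x|;
  norm_like_D : forall x y, N (x + y) <= N x + N y;
  norm_like_Z : forall t x, 0 <= t -> N (t *: x) = t * N x;
  norm_like_N : forall x, N (- x) = N x }.

Lemma enorm_norm_like (R : realType) (n : nat) : (0 < n)%N ->
  norm_like (@enorm R n) 1 n%:R.
Proof.
move=> n0; split => //.
- by rewrite ltr0n.
- by move=> x; rewrite mul1r norm_le_enorm.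
- exact: enorm_le_norm.
- exact: enormD.
- by move=> t x t0; rewrite enormZ ger0_norm.
- exact: enormN.
Qed.

Section finite_covers.
Local Open Scope ereal_scope.
Context {R : realType} {T : pointedType}.
Variable tau : set T -> \bar R.
Hypothesis tau0 : tau set0 = 0.
Hypothesis tau_ge0 : forall A, 0 <= tau A.

Lemma cover_outer_fin (I : finType) (G : I -> set T) A :
  A `<=` \bigcup_(i in [set: I]) G i -> cover_outer tau A <= \sum_i tau (G i).
Proof.
move=> AG; pose F k := nth set0 [seq G i | i <- enum I] k.
apply: (@le_trans _ _ (\sum_(k <oo) tau (F k))).
  apply: ereal_inf_lbound; exists F => //= x /AG[i _ Gx].
  exists (index i (enum I)) => //; rewrite /F (nth_map i) ?index_mem ?mem_enum//.
  by rewrite nth_index ?mem_enum.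
rewrite (nneseries_split 0 #|I|)//= add0n [X in _ + X]eseries0 ?adde0; last first.
  by move=> i h _; rewrite /F nth_default// size_map -cardE.
rewrite le_eqVlt; apply/orP; left; apply/eqP.
rewrite -[RHS](big_enum) /= -(big_map G xpredT tau) (big_nth set0) size_map -cardE.
by [].
Qed.

End finite_covers.

Section norm_spheres.
Context {R : realType} {k : nat}.
Variables (N : 'rV[R]_k.+1 -> R) (m M : R).
Hypothesis NN : norm_like N m M.
Implicit Types x y z : 'rV[R]_k.+1.

Let m0 := norm_like_gt0 NN.
Let M0 := norm_like_gt0' NN.
Let N_ge := norm_like_ge NN.
Let N_le := norm_like_le NN.
Let N_D := norm_like_D NN.
Let N_Z := norm_like_Z NN.
Let N_N := norm_like_N NN.

Lemma norm_like_ge0 x : 0 <= N x.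
Proof. by apply: le_trans (N_ge x); rewrite mulr_ge0// ltW. Qed.

Lemma norm_like_dist x y : `|N x - N y| <= N (x - y).
Proof.
have h a b : N a - N b <= N (a - b) by rewrite lerBlDr -{1}(subrK b a) N_D.
by rewrite ler_norml h andbT lerNl opprB (le_trans (h y x))// -N_N opprB.
Qed.

Lemma norm_like_gt0P x : x != 0 -> 0 < N x.
Proof.
by move=> x0; apply: lt_le_trans (N_ge x); rewrite mulr_gt0// normr_gt0.
Qed.

Lemma normalize x : x != 0 -> N ((N x)^-1 *: x) = 1.
Proof.
move=> /norm_like_gt0P x0; rewrite N_Z ?invr_ge0 ?(ltW x0)// mulVf// gt_eqF//.
Qed.

Lemma normalize_dist x y : x != 0 -> y != 0 -> `|x| = 1 -> `|y| = 1 ->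
  `|(N x)^-1 *: x - (N y)^-1 *: y| <= (m^-1 + M / m ^+ 2) * `|x - y|.
Proof.
move=> x0 y0 x1 y1.
have Nx : m <= N x by have := N_ge x; rewrite x1 mulr1.
have Ny : m <= N y by have := N_ge y; rewrite y1 mulr1.
have Nx0 : 0 < N x by apply: lt_le_trans Nx.
have Ny0 : 0 < N y by apply: lt_le_trans Ny.
have -> : (N x)^-1 *: x - (N y)^-1 *: y = (N x)^-1 *: (x - y) + ((N x)^-1 - (N y)^-1) *: y.
  by rewrite scalerBr scalerBl addrA subrK.
apply: (le_trans (ler_normD _ _)); rewrite !normrZ y1 mulr1 mulrDl.
apply: lerD.
  by rewrite ler_wpM2r// ger0_norm ?invr_ge0 ?(ltW Nx0)// lef_pV2.
have -> : (N x)^-1 - (N y)^-1 = (N y - N x) / (N x * N y).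
  by field; rewrite !gt_eqF.
rewrite normrM normfV (gtr0_norm (mulr_gt0 Nx0 Ny0)) mulrAC.
apply: ler_pM => //; first by rewrite invr_ge0 mulr_ge0// ltW.
  apply: le_trans (norm_like_dist _ _) _; rewrite distrC; exact: N_le.
by rewrite lef_pV2 ?posrE ?mulr_gt0 ?exprn_gt0// expr2 ler_pM// ltW.
Qed.

Lemma ediam_le (U : set 'rV[R]_k.+1) c : (forall x y, U x -> U y -> `|x - y| <= c) ->
  (ediam U <= (k.+1%:R * c)%:E)%E.
Proof.
move=> h; apply: ge_ereal_sup => _ [[x y] [Ux Uy] <-] /=.
rewrite lee_fin; apply: le_trans (enorm_le_norm _) _.
by rewrite ler_wpM2l// h.
Qed.

Lemma le_ediam (U : set 'rV[R]_k.+1) x y : U x -> U y -> (`|x - y|%:E <= ediam U)%E.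
Proof.
move=> Ux Uy; apply: (@le_trans _ _ (enorm (x - y))%:E).
  by rewrite lee_fin norm_le_enorm.
by apply: ereal_sup_ubound; exists (x, y).
Qed.

Lemma diam_gauge_le s e (U : set 'rV[R]_k.+1) c : 0 <= s -> c <= e -> 0 <= c ->
  (ediam U <= c%:E)%E -> (diam_gauge s e U <= (c `^ s)%:E)%E.
Proof.
move=> s0 ce c0 Uc; rewrite /diam_gauge; case: asboolP => U0; first by rewrite lee_fin powR_ge0.
rewrite ifT; last by apply: le_trans Uc _; rewrite lee_fin.
have [x Ux] : U !=set0 by apply/set0P/eqP.
have ge0 : (0 <= ediam U)%E by apply: le_trans (le_ediam Ux Ux); rewrite lee_fin.
rewrite -poweR_EFin; apply: gt0_ler_poweR => //; rewrite in_itv/= ?andbT ?leey ?ge0 ?lee_fin ?c0//.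
Qed.

Let L := k.+1%:R * ((m^-1 + M / m ^+ 2) * 2).

Let L0 : 0 < L.
Proof.
rewrite !mulr_gt0// addr_gt0 ?invr_gt0// divr_gt0// exprn_gt0//.
Qed.

(** The sphere is the radial image of the 2 (k + 1) faces of the sup-norm cube. Cutting each face
    into P^k cells of side 2 / P yields pieces of diameter at most L / P, so the sum of the k-th
    powers of the diameters is independent of [P]. In [L], the 2 is the side of a cell, the bracket
    the Lipschitz constant of the radial projection, and [k.+1%:R] the ratio of Euclidean to sup
    norm. *)
Lemma hausdorff_norm_sphere_le :
  (hausdorff_outer k%:R [set x | N x = 1%R] <= (k.+1%:R * 2 * L ^+ k)%:E)%E.
Proof.
apply: ge_ereal_sup => _ [e /= e0 <-].
pose P := (Num.truncn (L / e)).+1.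
have P0 : 0 < P%:R :> R by rewrite ltr0n.
have LP : L / P%:R <= e.
  rewrite ler_pdivrMr// mulrC -ler_pdivrMr//; apply: ltW; exact: truncnS_gt.
pose I := ('I_k.+1 * bool * {ffun 'I_k -> 'I_P})%type.
pose a (q : nat) : R := -1 + 2 * q%:R / P%:R.
pose cell (i : I) : set 'rV[R]_k.+1 := [set y : 'rV[R]_k.+1 | [/\ `|y| = 1%R,
  y ord0 i.1.1 = (-1) ^+ i.1.2 &
  forall j, a (i.2 j) <= y ord0 (lift i.1.1 j) <= a (i.2 j) + 2 / P%:R]].
pose G (i : I) : set 'rV[R]_k.+1 := [set (N y)^-1 *: y | y in cell i].
have cover : [set x | N x = 1%R] `<=` \bigcup_(i in [set: I]) G i.
  move=> x /= Nx1.
  have x0 : x != 0.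
    by apply/eqP => x0; have := N_le x; rewrite x0 normr0 mulr0 -x0 Nx1; lra.
  have nx0 : 0 < `|x| by rewrite normr_gt0.
  pose y := `|x|^-1 *: x.
  have y1 : `|y| = 1 by rewrite normrZ normfV normr_id mulVf ?gt_eqF.
  have xE : x = (N y)^-1 *: y.
    by rewrite /y N_Z ?invr_ge0// Nx1 mulr1 invrK scalerA divff ?scale1r ?gt_eqF.
  have yn0 : mx_norm y != 0 by rewrite [mx_norm y]y1 oner_neq0.
  have [[i0 i]] := mx_norm_neq0 yn0; rewrite [mx_norm y]y1 (ord1 i0) /= => yi.
  have q0 j : 0 <= (y ord0 j + 1) / 2 * P%:R.
    have := coord_le_norm y j; rewrite y1 ler_norml => /andP[h _].
    by rewrite mulr_ge0//; lra.
  have qP j : (y ord0 j + 1) / 2 * P%:R <= P%:R.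
    have := coord_le_norm y j; rewrite y1 ler_norml => /andP[_ h].
    by rewrite ger_pMl//; lra.
  (* The minimum puts the right end point, where the coordinate is 1, into the last cell. *)
  pose t j := minn (Num.truncn ((y ord0 (lift i j) + 1) / 2 * P%:R)) P.-1.
  have tP j : (t j < P)%N by rewrite /t /P ltnS geq_minr.
  have titv j : (t j)%:R <= (y ord0 (lift i j) + 1) / 2 * P%:R <= (t j)%:R + 1.
    have /andP[h1 h2] := truncn_itv (q0 (lift i j)); have := qP (lift i j).
    move: h1 h2; rewrite /t; move: (_ / 2 * _) => u; move: (Num.truncn u) => v.
    rewrite -[v.+1]addn1 natrD => h1 h2 h3.
    have [vP|Pv] := leqP v P.-1; first by rewrite h1 ltW.
    have PE : P%:R = P.-1%:R + 1 :> R by rewrite natr1.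
    rewrite -PE h3 andbT; apply: le_trans h1; by rewrite ler_nat ltnW.
  exists (i, y ord0 i < 0, [ffun j => Ordinal (tP j)]) => //.
  exists y => //; split => //=.
    case: ltP => y0 /=; move: yi; first by rewrite ltr0_norm// expr1 => ->; rewrite opprK.
    by rewrite ger0_norm.
  move=> j; rewrite ffunE /= /a; have /andP[h1 h2] := titv j.
  move: h1 h2; set u := y ord0 _; set v : R := (t j)%:R.
  rewrite -ler_pdivrMr// => h1; rewrite -ler_pdivlMr// mulrDl => h2.
  by apply/andP; split; lra.
apply: (le_trans (cover_outer_fin (diam_gauge0 _ _) (diam_gauge_ge0 _ _) cover)).
apply: (@le_trans _ _ (\sum_(i : I) ((L / P%:R) `^ k%:R)%:E)%E).
  apply: lee_sum => i _; apply: diam_gauge_le => //; first by rewrite divr_ge0// ltW.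
  rewrite /L -mulrA; apply: ediam_le => _ _ [y [y1 yi yj] <-] [z [z1 zi zj] <-].
  have nz u : `|u| = 1 -> u != 0 :> 'rV[R]_k.+1.
    by move=> u1; rewrite -normr_gt0 u1.
  apply: le_trans (normalize_dist (nz _ y1) (nz _ z1) y1 z1) _.
  rewrite -[leRHS]mulrA ler_wpM2l//.
    by rewrite addr_ge0 ?invr_ge0 ?divr_ge0 ?exprn_ge0// ltW.
  have P20 : 0 <= 2 / P%:R :> R by rewrite divr_ge0// ltW.
  apply/(cube_norm _ P20)/cubeE => j; rewrite !mxE.
  case: (unliftP i.1.1 j) => [j' ->|->]; last by rewrite yi zi subrr normr0.
  have /andP[? ?] := yj j'; have /andP[? ?] := zj j'.
  by rewrite ler_norml; apply/andP; split; lra.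
rewrite sumEFin lee_fin sumr_const !card_prod card_bool card_ffun !card_ord.
rewrite powR_mulrn; last by rewrite divr_ge0// ltW.
rewrite -[X in X <= _]mulr_natl 2!natrM natrX exprMn exprVn.
have Pk0 : P%:R ^+ k != 0 :> R by rewrite expf_neq0// gt_eqF.
by rewrite -!mulrA ler_wpM2l// ler_wpM2l// mulrCA divff// mulr1.
Qed.

Lemma hausdorff_norm_sphere_lty : (hausdorff_outer k%:R [set x | N x = 1%R] < +oo)%E.
Proof. by apply: le_lt_trans hausdorff_norm_sphere_le _; rewrite ltry. Qed.

Lemma box_volume_le_diam n (V : set 'rV[R]_n) c : 0 <= c ->
  (forall x y : 'rV[R]_n, V x -> V y -> forall i, `|x ord0 i - y ord0 i| <= c) ->
  (box_volume V <= ((2 * c) ^+ n)%:E)%E.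
Proof.
move=> c0 h; have [->|/eqP/set0P[x Vx]] := pselect (V = set0).
  by rewrite box_volume0 lee_fin exprn_ge0// mulr_ge0.
have b := @box_volume_le _ _ V (x - const_mx c) (x + const_mx c).
apply: le_trans (b _ _) _.
- by move=> i; rewrite !mxE; lra.
- move=> y Vy i; rewrite !mxE; have := h _ _ Vx Vy i.
  by rewrite ler_norml => /andP[? ?]; apply/andP; split; lra.
- rewrite (eq_bigr (fun=> 2 * c)); last by move=> i _; rewrite !mxE; lra.
  by rewrite prodr_const card_ord.
Qed.

(* The central projection [x |-> (x_j / x_i)_j], with [i] a largest coordinate
   of [z], is Lipschitz near [z] and maps the sphere onto a neighbourhood of the
   image of [z]. *)
Lemma hausdorff_norm_sphere_ge : exists c : R, 0 < c /\ exists r0 : R, 0 < r0 /\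
  forall z r, N z = 1 -> 0 < r <= r0 ->
  ((c * r ^+ k)%:E <=
    hausdorff_outer k%:R [set x | N x = 1%R /\ (`|x - z| <= r)%R])%E.
Proof.
(* Moving [z] by a vector of [cube dl] and renormalising displaces it by at most [2 * M * dl] in
   [N], hence by at most [C * dl = r] in the sup norm. *)
pose C := 2 * M / m.
have C0 : 0 < C by rewrite divr_gt0// mulr_gt0.
pose Lp := 2 * M + 4 * M ^+ 2 / m.
have Lp0 : 0 < Lp by rewrite addr_gt0 ?divr_gt0 ?mulr_gt0 ?exprn_gt0.
(* The image under [p] of the piece of the sphere over [cube dl] contains a cube of radius [dl * m],
   and [p] has Lipschitz constant [Lp] there; with [dl = r / C] the quotient of the two is [r] times
   this base. *)
pose c := (m / (Lp * C)) ^+ k.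
exists c; split; first by rewrite exprn_gt0// divr_gt0// mulr_gt0.
exists (C / M); split; first by rewrite divr_gt0.
move=> z r Nz /andP[r0 rC]; pose dl := r / C.
have dl0 : 0 < dl by rewrite divr_gt0.
have dlM : M * dl <= 1.
  by rewrite /dl mulrA ler_pdivrMr// mul1r mulrC -ler_pdivlMr.
have z0 : z != 0 by apply/eqP => z0; have := N_le z; rewrite z0 normr0 mulr0 -z0 Nz; lra.
have nz0 : mx_norm z != 0 by move: z0; rewrite -normr_eq0.
have [[i0 i]] := mx_norm_neq0 nz0; rewrite (ord1 i0) /= => zi {i0}.
have {}zi : `|z ord0 i| = `|z| by [].
have zM : M^-1 <= `|z| by rewrite -div1r ler_pdivrMr// mulrC -Nz.
have zm : `|z| <= m^-1 by rewrite -div1r ler_pdivlMr// mulrC -Nz.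
have zn0 : 0 < `|z| by rewrite normr_gt0.
have zi0 : z ord0 i != 0 by rewrite -normr_gt0 zi.
pose p (x : 'rV[R]_k.+1) : 'rV[R]_k := \row_j (x ord0 (lift i j) / x ord0 i).
pose y (v : 'rV[R]_k) : 'rV[R]_k.+1 := \row_j (if unlift i j is Some j' then v ord0 j' else 0).
pose q v := (N (z + y v))^-1 *: (z + y v).
pose S : set 'rV[R]_k.+1 := [set q v | v in cube dl].
have yi v : y v ord0 i = 0 by rewrite mxE unlift_none.
have yj v j : y v ord0 (lift i j) = v ord0 j by rewrite mxE liftK.
have Ny v : cube dl v -> N (y v) <= M * dl.
  move=> /cubeE vd; apply: le_trans (N_le _) _; rewrite ler_wpM2l ?(ltW M0)//.
  apply/(cube_norm _ (ltW dl0))/cubeE => j.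
  by case: (unliftP i j) => [j' ->|->]; [rewrite yj|rewrite yi normr0 ltW].
have zy0 v : z + y v != 0.
  apply/eqP => /rowP /(_ i); rewrite mxE yi addr0 mxE => h.
  by rewrite h eqxx in zi0.
have Nzy v : 0 < N (z + y v) by exact: norm_like_gt0P.
have Nzy1 v : `|1 - N (z + y v)| <= N (y v).
  by rewrite -Nz; apply: le_trans (norm_like_dist _ _) _; rewrite opprD addrA subrr sub0r N_N.
have qS x : S x -> N x = 1 /\ `|x - z| <= r.
  move=> [v vd <-]; split; first exact: normalize.
  have -> : q v - z = y v + ((N (z + y v))^-1 - 1) *: (z + y v).
    by rewrite /q; apply/rowP => j; rewrite !mxE; ring.
  have h : N (y v + ((N (z + y v))^-1 - 1) *: (z + y v)) <= 2 * (M * dl).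
    have e2 : N (((N (z + y v))^-1 - 1) *: (z + y v)) <= M * dl.
      have -> : N (((N (z + y v))^-1 - 1) *: (z + y v)) = `|1 - N (z + y v)|.
        have NZ' t u : N (t *: u) = `|t| * N u.
          case: (lerP 0 t) => t0; first by rewrite N_Z// ger0_norm.
          by rewrite ltr0_norm// -N_Z ?oppr_ge0 ?ltW// scaleNr N_N.
        rewrite NZ' -{2}(gtr0_norm (Nzy v)) -normrM mulrBl mul1r mulVf//.
        by rewrite gt_eqF.
      exact: le_trans (Nzy1 v) (Ny v vd).
    by apply: le_trans (N_D _ _) _; have := Ny v vd; lra.
  rewrite -(ler_pM2l m0); apply: le_trans (N_ge _) (le_trans h _).
  by rewrite /dl /C le_eqVlt; apply/orP; left; apply/eqP; field; rewrite !gt_eqF.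
have pq v : p (q v) = p z + (z ord0 i)^-1 *: v.
  apply/rowP => j; have := Nzy v; rewrite /q; move: (N _) => w w0.
  rewrite !mxE unlift_none addr0 liftK; field; by rewrite zi0 gt_eqF.
have qi x : S x -> (2 * M)^-1 <= `|x ord0 i| /\ forall j, `|x ord0 j| <= m^-1.
  move=> Sx; have [Nx _] := qS _ Sx; split; last first.
    move=> j; apply: le_trans (coord_le_norm _ _) _.
    by rewrite -div1r ler_pdivlMr// mulrC -Nx.
  case: Sx => v vd <-; rewrite /q.
  have -> : ((N (z + y v))^-1 *: (z + y v)) ord0 i = (N (z + y v))^-1 * z ord0 i.
    by rewrite mxE [X in _ * X]mxE yi addr0.
  rewrite normrM zi normfV (gtr0_norm (Nzy v)).
  have N2 : N (z + y v) <= 2.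
    apply: le_trans (N_D _ _) _; rewrite Nz; have := Ny v vd; lra.
  by rewrite invfM; apply: ler_pM; rewrite ?invr_ge0 ?(ltW M0)// lef_pV2 ?posrE.
have pL x x' b : S x -> S x' -> `|x - x'| <= b -> forall j, `|p x ord0 j - p x' ord0 j| <= Lp * b.
  move=> Sx Sx' xb j; have [xi xj] := qi _ Sx; have [xi' xj'] := qi _ Sx'.
  have M2 : 0 < (2 * M)^-1 by rewrite invr_gt0 mulr_gt0.
  have x0 : x ord0 i != 0 by rewrite -normr_gt0; apply: lt_le_trans xi.
  have x0' : x' ord0 i != 0 by rewrite -normr_gt0; apply: lt_le_trans xi'.
  rewrite !mxE (_ : _ - _ = (x ord0 (lift i j) - x' ord0 (lift i j)) / x ord0 i +
     x' ord0 (lift i j) * (x' ord0 i - x ord0 i) / (x ord0 i * x' ord0 i)); last first.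
    by field; rewrite x0 x0'.
  have cd l : `|x ord0 l - x' ord0 l| <= b.
    by have := coord_le_norm (x - x') l; rewrite !mxE => /le_trans; apply.
  have b0 : 0 <= b by apply: le_trans (normr_ge0 _) xb.
  have iM : `|x ord0 i|^-1 <= 2 * M by rewrite -[leRHS]invrK lef_pV2 ?posrE// normr_gt0.
  have iM' : `|x' ord0 i|^-1 <= 2 * M by rewrite -[leRHS]invrK lef_pV2 ?posrE// normr_gt0.
  apply: le_trans (ler_normD _ _) _; rewrite /Lp [leRHS]mulrDl; apply: lerD.
    by rewrite normrM normfV mulrC ler_pM.
  rewrite !normrM normfV normrM invfM.
  apply: (@le_trans _ _ ((m^-1 * b) * ((2 * M) * (2 * M)))).
    apply: ler_pM; rewrite ?mulr_ge0 ?invr_ge0//.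
      by apply: ler_pM => //; rewrite distrC.
    by apply: ler_pM; rewrite ?invr_ge0.
  by rewrite le_eqVlt; apply/orP; left; apply/eqP; field; rewrite gt_eqF.
apply: le_trans (cover_outer_le_hausdorff _ _ (@ltr01 R)).
apply: le_ereal_inf_tmp => _ [F AF <-].
have SF : S `<=` \bigcup_l F l by move=> x Sx; apply: AF; exact: qS.
pose B : set 'rV[R]_k := [set u | cube (dl * m) (u - p z)].
have BF : B `<=` \bigcup_l (p @` (F l `&` S)).
  move=> u /cubeE Bu; pose v := z ord0 i *: (u - p z).
  have vd : cube dl v.
    apply/cubeE => j; rewrite mxE normrM zi; apply: (@le_trans _ _ (m^-1 * (dl * m))).
      by apply: ler_pM.
    by rewrite mulrC mulfK// gt_eqF.
  have Sq : S (q v) by exists v.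
  have [l _ Fl] := SF _ Sq; exists l => //; exists (q v) => //.
  by rewrite pq /v scalerA mulVf// scale1r addrC subrK.
have lB : lebesgue_rV R k B = ((dl * m *+ 2) ^+ k)%:E.
  have <- : lebesgue_rV R k (cube (dl * m)) = ((dl * m *+ 2) ^+ k)%:E.
    by rewrite lebesgue_rV_cube// mulr_ge0// ltW.
  exact: lebesgue_rV_translate.
(* The measure is the infimum over all countable covers of the sums of [box_volume], so the images
   of the covering sets can serve as a cover as they are. *)
have step : (lebesgue_rV R k B <= \sum_(l <oo) box_volume (p @` (F l `&` S)))%E.
  by apply: ereal_inf_lbound; exists (fun l => p @` (F l `&` S)).
have Lk0 : 0 < (2 * Lp) ^+ k by rewrite exprn_gt0// mulr_gt0.
have each l : (box_volume (p @` (F l `&` S)) <= ((2 * Lp) ^+ k)%:E * diam_gauge k%:R 1 (F l))%E.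
  have [F0|F0] := pselect (F l = set0).
    by rewrite F0 set0I image_set0 box_volume0 diam_gauge0 mule0.
  rewrite /diam_gauge asboolF//; case: ifPn => [F1|_]; last first.
    by rewrite mulry gtr0_sg// mul1e leey.
  have [x Fx] : F l !=set0 by apply/set0P/eqP.
  have ge0 : (0 <= ediam (F l))%E by apply: le_trans (le_ediam Fx Fx); rewrite lee_fin.
  have fin : ediam (F l) \is a fin_num by rewrite ge0_fin_numE// (le_lt_trans F1)// ltry.
  rewrite -(fineK fin) poweR_EFin powR_mulrn ?fine_ge0// -EFinM -exprMn -mulrA.
  apply: box_volume_le_diam; first by rewrite mulr_ge0 ?fine_ge0// ltW.
  move=> _ _ [x1 [F1x S1] <-] [x2 [F2x S2] <-] j; apply: pL => //.
  by rewrite -lee_fin fineK// le_ediam.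
have : (((dl * m *+ 2) ^+ k)%:E <= ((2 * Lp) ^+ k)%:E * \sum_(l <oo) diam_gauge k%:R 1 (F l))%E.
  rewrite -lB; apply: (le_trans step); rewrite -nneseriesZl; last by move=> l _; exact: diam_gauge_ge0.
  by apply: lee_nneseries => [l *|l *]; [exact: box_volume_ge0|exact: each].
rewrite -(@lee_pmul2l _ ((2 * Lp) ^+ k)^-1%:E)//; last by rewrite lte_fin invr_gt0.
rewrite muleA -!EFinM mulVf ?gt_eqF// mul1e; apply: le_trans.
rewrite lee_fin -exprVn /c -!exprMn le_eqVlt; apply/orP; left; apply/eqP; congr (_ ^+ k).
by rewrite /dl; rewrite -mulr_natr; field; rewrite !gt_eqF.
Qed.

End norm_spheres.

Lemma nbhs_rV (R : realType) (n : nat) (x : 'rV[R]_n) (A : set 'rV[R]_n) e : 0 < e ->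
  (forall y, `|x - y| < e -> A y) -> nbhs x A.
Proof. by move=> e0 h; apply/nbhs_ballP; exists e => // y; rewrite -ball_normE; exact: h. Qed.

Section surface.
Context {R : realType}.

Lemma ball_volume_gt0 k : 0 < @ball_volume R k.
Proof.
pose B : set 'rV[R]_k := [set x | enorm x <= 1].
have k0 : 0 < k%:R + 1 :> R by rewrite ltr_wpDl.
have k0' : 0 <= (k%:R + 1)^-1 :> R by rewrite invr_ge0 ltW.
have lo : ((((k%:R + 1)^-1 *+ 2) ^+ k)%:E <= lebesgue_rV R k B)%E.
  rewrite -lebesgue_rV_cube//; apply: le_cover_outer => x /(cube_norm _ k0') h.
  apply: le_trans (enorm_le_norm x) _.
  apply: le_trans (ler_wpM2l (ler0n _ _) h) _.
  by rewrite ler_pdivrMr// mul1r lerDl.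
have hi : (lebesgue_rV R k B < +oo)%E.
  apply: (@le_lt_trans _ _ (lebesgue_rV R k (cube 1))); last first.
    by rewrite lebesgue_rV_cube// ltry.
  apply: le_cover_outer => x h; apply/(cube_norm _ ler01).
  exact: le_trans (norm_le_enorm x) h.
rewrite /ball_volume fine_gt0// hi andbT; apply: lt_le_trans lo.
by rewrite lte_fin exprn_gt0// mulrn_wgt0// invr_gt0.
Qed.

Lemma surface_measureE k (A : set (borel 'rV[R]_k.+1)) :
  surface_measure R k.+1 A =
    ((ball_volume k / 2 ^+ k)%:E * hausdorff_outer k%:R A)%E.
Proof. by []. Qed.

Variables (k : nat) (N : 'rV[R]_k.+1 -> R) (m M : R).
Hypothesis NN : norm_like N m M.

Lemma surface_norm_sphere_lty :
  (surface_measure R k.+1 [set x | N x = 1%R] < +oo)%E.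
Proof.
rewrite surface_measureE lte_mul_pinfty ?lee_fin//; first exact: surface_const_ge0.
exact: hausdorff_norm_sphere_lty NN.
Qed.

Lemma surface_norm_sphere_ge : exists c : R, 0 < c /\ exists r0 : R, 0 < r0 /\
  forall z r, N z = 1 -> 0 < r <= r0 ->
  ((c * r ^+ k)%:E <=
    surface_measure R k.+1 [set x : 'rV[R]_k.+1 | N x = 1%R /\ (`|x - z| <= r)%R])%E.
Proof.
have [c [c0 [r0 [r00 h]]]] := hausdorff_norm_sphere_ge NN.
have b0 : 0 < @ball_volume R k / 2 ^+ k by rewrite divr_gt0// ?ball_volume_gt0// exprn_gt0.
exists (ball_volume k / 2 ^+ k * c); split; first by rewrite mulr_gt0.
exists r0; split=> // z r Nz rr; rewrite surface_measureE -mulrA EFinM.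
by apply: lee_wpmul2l; [rewrite lee_fin ltW|exact: h].
Qed.

Lemma norm_like_continuous : continuous N.
Proof.
have M0 := norm_like_gt0' NN.
move=> x; apply: (cvgrPdist_lt (FF := nbhs_filter x) N (N x)).2 => e e0.
apply: (@nbhs_rV _ _ x _ (e / M)); first by rewrite divr_gt0.
move=> y; rewrite ltr_pdivlMr// mulrC => xy.
by apply: le_lt_trans (norm_like_dist NN x y) _; apply: le_lt_trans (norm_like_le NN _) _.
Qed.

Lemma measurable_norm_like : measurable_fun setT (N : borel 'rV[R]_k.+1 -> R).
Proof. exact: (continuous_borel norm_like_continuous). Qed.

End surface.

(** * The gauge of a symmetric convex body and its boundary *)

Section gauge.
Context {R : realType} {k : nat}.
Variable K : set 'rV[R]_k.+1.
Hypothesis bK : bounded_set K.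
Hypothesis cK : convex_set (K : set (convex_lmodType 'rV[R]_k.+1)).
Hypothesis sK : forall x, K x -> K (- x).
Hypothesis iK : K° !=set0.
Implicit Types x y : 'rV[R]_k.+1.

Let convK x y t : 0 <= t <= 1 -> K x -> K y -> K (t *: x + (1 - t) *: y).
Proof.
move=> t01 Kx Ky.
have := @cK x y (Itv01 (andP t01).1 (andP t01).2).
by rewrite !inE => /(_ Kx Ky).
Qed.

(** Symmetry and convexity carry an interior ball around [a] to the origin: [x] is the midpoint of
    [a + x] and [- (a - x)]. *)
Let ballK : exists2 e, 0 < e & forall x, `|x| < e -> K x.
Proof.
have [a] := iK => /nbhs_normP[e /= e0 h]; exists e => // x xe.
have -> : x = 2^-1 *: (a + x) + (1 - 2^-1) *: - (a - x).
  by apply/rowP => j; rewrite !mxE; lra.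
apply: convK; first by lra.
  by apply: h; rewrite /ball_/= opprD addrA subrr sub0r normrN.
by apply/sK/h; rewrite /ball_/= opprB addrC subrK.
Qed.

Let K0 : K 0.
Proof. by have [e e0 h] := ballK; apply: h; rewrite normr0. Qed.

Let starK x t : 0 <= t <= 1 -> K x -> K (t *: x).
Proof. by move=> t01 Kx; have := convK t01 Kx K0; rewrite scaler0 addr0. Qed.

Let S x := [set t : R | 0 < t /\ K (t^-1 *: x)].

Let S_up x t t' : S x t -> t <= t' -> S x t'.
Proof.
move=> [t0 Kt] tt'; have t'0 : 0 < t' by apply: lt_le_trans tt'.
split => //; have -> : t'^-1 *: x = (t / t') *: (t^-1 *: x).
  by rewrite scalerA mulrAC divff ?mul1r// gt_eqF.
by apply: starK => //; rewrite divr_ge0 ?(ltW t0) ?(ltW t'0)//= ler_pdivrMr// mul1r.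
Qed.

Let S_has_inf x : has_inf (S x).
Proof.
have [e e0 h] := ballK; split; last by exists 0 => t [/ltW].
pose t := (`|x| + 1) / e.
have t0 : 0 < t by rewrite divr_gt0// ltr_wpDl.
exists t; split => //; apply: h; rewrite normrZ gtr0_norm ?invr_gt0// mulrC.
by rewrite ltr_pdivrMr// /t mulrC divfK ?gt_eqF// ltrDl.
Qed.

Lemma gauge_norm_le x t : 0 < t -> K (t^-1 *: x) -> gauge_norm K x <= t.
Proof. by move=> t0 Kt; apply: ge_inf => //; exact: (S_has_inf x).2. Qed.

Lemma gauge_norm_lt x t : gauge_norm K x < t -> 0 < t /\ K (t^-1 *: x).
Proof.
move=> /(inf_lt (S_has_inf x).1)[s Ss st]; exact: S_up Ss (ltW st).
Qed.

Lemma gauge_norm_norm_like : exists m M, norm_like (gauge_norm K) m M.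
Proof.
have [B B0 hB] : exists2 B, 0 < B & forall x, K x -> `|x| <= B.
  have [B [_ h]] := bK; exists (Num.max B 0 + 1); first by rewrite ltr_wpDl// le_max lexx orbT.
  by move=> x Kx; apply: (h (Num.max B 0 + 1)) => //; rewrite ltr_pwDr// le_max lexx.
have [e e0 he] := ballK.
have lo x : B^-1 * `|x| <= gauge_norm K x.
  apply: lb_le_inf; first exact: (S_has_inf x).1.
  move=> t [t0 /hB]; rewrite normrZ gtr0_norm ?invr_gt0// ler_pdivrMl// => h.
  by rewrite ler_pdivrMl// mulrC.
have hi x : gauge_norm K x <= e^-1 * `|x|.
  apply/ler_addgt0Pr => d d0; have t0 : 0 < e^-1 * `|x| + d.
    by rewrite ltr_wpDl// mulr_ge0// invr_ge0 ltW.
  apply: gauge_norm_le => //; apply: he; rewrite normrZ gtr0_norm ?invr_gt0//.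
  by rewrite ltr_pdivrMl// mulrC mulrDr mulrA divff ?gt_eqF// mul1r ltrDl mulr_gt0.
exists B^-1, e^-1; split => //; rewrite ?invr_gt0//.
- move=> x y; apply/ler_addgt0Pr => d d0.
  have d2 : 0 < d / 2 by rewrite divr_gt0.
  have tri t s : 0 < t -> K (t^-1 *: x) -> 0 < s -> K (s^-1 *: y) -> gauge_norm K (x + y) <= t + s.
    move=> t0 Kt s0 Ks; have ts0 : 0 < t + s by rewrite addr_gt0.
    apply: gauge_norm_le => //.
    have -> : (t + s)^-1 *: (x + y) = (t / (t + s)) *: (t^-1 *: x) + (1 - t / (t + s)) *: (s^-1 *: y).
      by apply/rowP => j; rewrite !mxE; field; rewrite !gt_eqF.
    by apply: convK => //; rewrite divr_ge0 ?(ltW t0) ?(ltW ts0)//= ler_pdivrMr// mul1r lerDl ltW.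
  have [|t0 Kt] := @gauge_norm_lt x (gauge_norm K x + d / 2); first by rewrite ltrDl.
  have [|s0 Ks] := @gauge_norm_lt y (gauge_norm K y + d / 2); first by rewrite ltrDl.
  by have := tri _ _ t0 Kt s0 Ks; lra.
- have le t x : 0 < t -> gauge_norm K (t *: x) <= t * gauge_norm K x.
    move=> t0; rewrite -ler_pdivrMl//; apply/ler_addgt0Pr => d d0.
    rewrite ler_pdivrMl//.
    have [|s0 Ks] := @gauge_norm_lt x (gauge_norm K x + d); first by rewrite ltrDl.
    apply: gauge_norm_le; first by rewrite mulr_gt0.
    by rewrite scalerA invfM mulrAC mulVf ?gt_eqF// mul1r.
  move=> t x; rewrite le_eqVlt => /orP[/eqP <-|t0].
    rewrite mul0r; apply/eqP; rewrite eq_le scale0r.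
    by have := lo 0; have := hi 0; rewrite normr0 !mulr0 => -> ->.
  apply/eqP; rewrite eq_le le//= -ler_pdivlMl//.
  have ti0 : 0 < t^-1 by rewrite invr_gt0.
  by have := le _ (t *: x) ti0; rewrite scalerA mulVf ?gt_eqF// scale1r.
- move=> x; congr inf; apply/seteqP; split => t [t0 h]; split => //.
    by have := sK h; rewrite scalerN opprK.
  by rewrite scalerN; exact: sK.
Qed.

(** The interior is the set of gauge less than 1 and the closure that of gauge at most 1, whichever
    boundary points [K] contains; both follow by scaling slightly along rays. *)
Lemma boundary_gauge : boundary K = [set x | gauge_norm K x = 1].
Proof.
have [m [M NN]] := gauge_norm_norm_like.
have M0 := norm_like_gt0' NN.
have lt1K x : gauge_norm K x < 1 -> K x.
  by move=> /gauge_norm_lt[_]; rewrite invr1 scale1r.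
have Kle1 x : K x -> gauge_norm K x <= 1.
  by move=> Kx; apply: gauge_norm_le => //; rewrite invr1 scale1r.
have intP x : K° x <-> gauge_norm K x < 1.
  split=> [/nbhs_normP[e /= e0 h]|x1].
    pose d := e / (2 * (`|x| + 1)).
    have x0 : 0 < 2 * (`|x| + 1) by rewrite mulr_gt0// ltr_wpDl.
    have d0 : 0 < d by rewrite divr_gt0.
    apply: (@le_lt_trans _ _ (1 + d)^-1); last first.
      by rewrite invf_lt1 ?ltrDl// addr_gt0.
    apply: gauge_norm_le; first by rewrite invr_gt0 addr_gt0.
    apply: h; rewrite /ball_/= invrK scalerDl scale1r opprD addrA subrr sub0r normrN.
    rewrite normrZ gtr0_norm// /d mulrAC ltr_pdivrMr// ltr_pM2l//.
    by have := normr_ge0 x; lra.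
  apply: (@nbhs_rV _ _ x _ ((1 - gauge_norm K x) / M)); first by rewrite divr_gt0// subr_gt0.
  move=> y; rewrite ltr_pdivlMr// => h; apply: lt1K.
  have := norm_like_D NN (y - x) x; rewrite subrK => /le_lt_trans; apply.
  by have := norm_like_le NN (y - x); rewrite distrC mulrC; lra.
have clP x : closure K x <-> gauge_norm K x <= 1.
  split=> [h|x1].
    apply/ler_addgt0Pr => e e0.
    have /h[y [Ky /= xy]] : nbhs x [set y | `|x - y| < e / M].
      by apply: (@nbhs_rV _ _ x _ (e / M)) => //; rewrite divr_gt0.
    have := norm_like_D NN (x - y) y; rewrite subrK => /le_trans; apply.
    have := norm_like_le NN (x - y); have := Kle1 _ Ky.
    by move: xy; rewrite ltr_pdivlMr// mulrC; lra.
  move=> B /nbhs_normP[e /= e0 h].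
  pose d := e / (2 * (`|x| + 1)).
  have x0 : 0 < 2 * (`|x| + 1) by rewrite mulr_gt0// ltr_wpDl.
  have d0 : 0 < d by rewrite divr_gt0.
  have d1 : 0 < 1 + d by rewrite addr_gt0.
  exists ((1 + d)^-1 *: x); split.
    apply: lt1K; rewrite (norm_like_Z NN) ?invr_ge0 ?ltW//.
    by rewrite ltr_pdivrMl// mulr1; apply: le_lt_trans x1 _; rewrite ltrDl.
  apply: h; rewrite /ball_/= -{1}(scale1r x) -scalerBl normrZ.
  have -> : 1 - (1 + d)^-1 = d / (1 + d) by field; rewrite gt_eqF.
  rewrite ger0_norm; last by rewrite divr_ge0// ltW.
  apply: (@le_lt_trans _ _ (d * `|x|)).
    by rewrite ler_wpM2r// ler_pdivrMr// mulrDr mulr1 lerDl mulr_ge0// ltW.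
  rewrite /d mulrAC ltr_pdivrMr// ltr_pM2l//.
  by have := normr_ge0 x; lra.
apply/seteqP; split => x /=.
  move=> [/clP h1 h2]; apply/eqP; rewrite eq_le h1 leNgt; apply/negP => h3.
  by apply: h2; apply/intP.
move=> x1; split; first by apply/clP; rewrite x1.
by move=> /intP; rewrite x1 ltxx.
Qed.

Lemma boundary_measure_lty : (boundary_measure K setT < +oo)%E.
Proof.
have [m [M NN]] := gauge_norm_norm_like.
have -> : boundary_measure K setT = surface_measure R k.+1 (boundary K).
  by rewrite /boundary_measure /= /mrestr setTI.
by rewrite boundary_gauge; exact: surface_norm_sphere_lty NN.
Qed.

Lemma boundary_measure_ge : exists c : R, 0 < c /\ exists r0 : R, 0 < r0 /\
  forall z r, gauge_norm K z = 1 -> 0 < r <= r0 ->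
  ((c * r ^+ k)%:E <= boundary_measure K [set x : 'rV[R]_k.+1 | (`|x - z| <= r)%R])%E.
Proof.
have [m [M NN]] := gauge_norm_norm_like.
have [c [c0 [r0 [r00 h]]]] := surface_norm_sphere_ge NN.
exists c; split=> //; exists r0; split=> // z r Nz rr.
apply: le_trans (h z r Nz rr) _.
rewrite le_eqVlt; apply/orP; left; apply/eqP.
transitivity (surface_measure R k.+1 ([set x : 'rV[R]_k.+1 | `|x - z| <= r] `&` boundary K)); last by [].
by rewrite boundary_gauge; congr (surface_measure _ _ _); apply/seteqP; split => x [].
Qed.

End gauge.

(** * Measures dominated by an integrable density *)

Lemma integral_indicT d (T : measurableType d) (R : realType) (m : {measure set T -> \bar R}) A :
  measurable A -> (\int[m]_x (\1_A x)%:E = m A)%E.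
Proof. by move=> mA; rewrite integral_indic// setIT. Qed.

Section density.
Local Open Scope ereal_scope.
Context {R : realType}.
Local Notation Rm := (measurableTypeR R).
Local Notation leb := (@lebesgue_measure R).
Variables (nu : {finite_measure set Rm -> \bar R}) (A : Rm -> \bar R) (a b C d0 : R).
Hypotheses (mA : measurable_fun setT A) (A0 : forall t, 0 <= A t).
Hypotheses (C0 : (0 <= C)%R) (d00 : (0 < d0)%R).
Hypothesis nuA : forall t d, (a <= t <= b)%R -> (0 < d <= d0)%R ->
  nu [set x : R | (`|x - t| <= d)%R] <= (C * d)%:E * A t.
Hypothesis Afin : \int[leb]_(t in `[a, b]) A t < +oo.

(* Integrate [nuA] over [t] in [U]: every point of [F] is within [d] of a set of
   [t] of length [2 d]. *)
Lemma small_integral_le (U : set Rm) d (F : set Rm) : open (U : set R) -> measurable F ->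
  U `<=` `]a, b[%classic -> (0 < d <= d0)%R ->
  (forall x t : R, F x -> (`|x - t| < d)%R -> U t) ->
  (d *+ 2)%:E * nu F <= (C * d)%:E * \int[leb]_(t in U) A t.
Proof.
move=> oU mF Uab d0d FU; have dp : (0 < d)%R by case/andP : d0d.
have mU : measurable U by exact: open_measurable.
pose G : set (Rm * Rm) := [set z | F z.1 /\ (`|z.1 - z.2| < d)%R].
have mG : measurable G.
  apply: measurableI; first by rewrite -[X in measurable X]setTI; exact: measurable_fst.
  have mn : measurable_fun setT (fun z : Rm * Rm => `|z.1 - z.2|%R : R).
    apply: measurableT_comp => //; apply: measurable_funB; [exact: measurable_fst|exact: measurable_snd].
  have := mn measurableT _ (measurable_itv `]-oo, d[); rewrite setTI.
  by congr (measurable _); apply/seteqP; split => z; rewrite /= in_itv.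
pose g (z : Rm * Rm) : \bar R := (\1_G z)%:E.
have mg : measurable_fun setT g by apply/measurable_EFinP.
have g0 z : 0 <= g z by rewrite lee_fin.
have := @fubini_tonelli _ _ Rm Rm R nu leb g mg g0.
have -> : \int[nu]_x \int[leb]_t g (x, t) = (d *+ 2)%:E * nu F.
  transitivity (\int[nu]_x ((d *+ 2)%:E * (\1_F x)%:E)); last first.
    by rewrite ge0_integralZl_EFin ?mulrn_wge0 ?(ltW dp)//; [rewrite integral_indicT|exact/measurable_EFinP].
  apply: eq_integral => x _.
  have [xF|xF] := boolP (x \in F).
    rewrite [in RHS]indicE xF mule1 -(lebesgue_measure_ball x (ltW dp)).
    rewrite -integral_indicT//; last exact: measurable_ball.
    apply: eq_integral => t _; rewrite /g !indicE; congr ((nat_of_bool _)%:R%:E); apply/idP/idP.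
      by rewrite !inE => -[_].
    by rewrite !inE => h; split => //; rewrite -in_setE.
  rewrite [in RHS]indicE (negbTE xF) mule0; apply: integral0_eq => t _.
  rewrite /g indicE; case: (boolP (_ \in G)) => //; rewrite inE => -[/= Fx _].
  by move/negP : xF; rewrite inE.
move=> ->.
have mI : measurable_fun setT (fun t => \int[nu]_x g (x, t)).
  exact: (@measurable_fun_fubini_tonelli_G _ _ Rm Rm R nu g mg g0).
rewrite -ge0_integralZl_EFin//; last 2 first.
- exact: measurable_funTS.
- by rewrite mulr_ge0// ltW.
rewrite [leRHS]integral_mkcond; apply: ge0_le_integral => //.
- by move=> t _; apply: integral_ge0.
- apply/(measurable_restrictT _ _).1 => //; apply: measurable_funTS.
  by apply: measurable_funeM.
move=> t _; rewrite patchE; case: ifPn => tU; last first.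
  rewrite integral0_eq// => x _; rewrite /g indicE; case: (boolP (_ \in G)) => //.
  by rewrite inE => -[/= Fx xt]; move/negP: tU; rewrite inE => -[]; exact: FU xt.
have tab : (a <= t <= b)%R.
  by have := Uab t; move: tU; rewrite inE => h /(_ h); rewrite /= in_itv/= => /andP[/ltW -> /ltW ->].
apply: le_trans (nuA tab d0d).
rewrite -integral_indicT//; last first.
  rewrite (_ : mkset _ = closed_ball t d); last first.
    by rewrite closed_ballE//; apply/seteqP; split => x /=; rewrite /closed_ball_/= distrC.
  by apply: closed_measurable; exact: closed_ball_closed.
apply: ge0_le_integral => //.
- apply: measurableT_comp mg _; exact: pair2_measurable.
- apply/measurable_EFinP; apply: measurable_indic.
  rewrite (_ : mkset _ = closed_ball t d); last first.
    by rewrite closed_ballE//; apply/seteqP; split => x /=; rewrite /closed_ball_/= distrC.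
  by apply: closed_measurable; exact: closed_ball_closed.
move=> x _; rewrite /g !indicE lee_fin ler_nat; case: (boolP (_ \in G)) => //.
by rewrite inE => -[/= _ xt]; rewrite mem_set//= ltW.
Qed.

(** [S] lies in an open [U'] so short that the integral of [A] over it is small. The points of [U']
    whose ball of radius [dl j] stays in [U'] have small [nu]-mass by [small_integral_le], and these
    sets increase to [U']. *)
Lemma density_null (S : set Rm) : measurable S -> S `<=` `]a, b[%classic ->
  leb S = 0 -> nu S = 0.
Proof.
move=> mS Sab S0.
(* Absolute continuity of the integral is applied to a real-valued function; [A] is finite almost
   everywhere on [[a, b]] because it is integrable there. *)
pose f := fine \o (A \_ `[a, b]).
have iA : leb.-integrable `[a, b] A.
  apply/integrableP; split; first exact: measurable_funTS.
  by under eq_integral do rewrite gee0_abs//.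
have iA' : leb.-integrable setT (A \_ `[a, b]).
  by apply/integrable_restrict => //; rewrite setTI.
have mA' : measurable_fun setT (A \_ `[a, b]) by exact: measurable_int iA'.
have A'0 x : 0 <= (A \_ `[a, b]) x by rewrite patchE; case: ifP.
have f0 x : (0 <= f x)%R by exact: fine_ge0.
have mf : measurable_fun setT f by apply: measurableT_comp => //; exact: fine_measurable.
have aef D : ae_eq leb D (A \_ `[a, b]) (EFin \o f).
  by apply: filterS (integrable_ae measurableT iA') => x h _; rewrite /f/= fineK// h.
have if_ : leb.-integrable setT (EFin \o f).
  apply/integrableP; split; first exact/measurable_EFinP.
  under eq_integral do rewrite gee0_abs ?lee_fin//.
  rewrite -(@ge0_ae_eq_integral _ Rm R leb setT _ _ measurableT mA' _ _ _ (aef _))//; last first.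
    - by move=> x _; rewrite lee_fin.
    - exact/measurable_EFinP.
  exact: integrable_lty iA'.
apply/eqP; rewrite eq_le measure_ge0 andbT; apply/lee_addgt0Pr => e e0; rewrite add0e.
have C1 : (0 < C + 1)%R by rewrite ltr_wpDl.
have e0' : (0 < e / (C + 1))%R by rewrite divr_gt0.
have [eta [eta0 heta]] := integral_normr_continuous if_ e0'.
have [|U [oU SU USeta]] := lebesgue_regularity_outer mS _ eta0; first by rewrite [X in X < _]S0.
pose U' : set R := U `&` `]a, b[%classic.
have oU' : open U' by apply: openI => //; exact: itv_open.
have mU' : measurable (U' : set Rm) by exact: open_measurable.
have mU : measurable (U : set Rm) by exact: open_measurable.
have U'eta : leb U' < eta%:E.
  apply: le_lt_trans USeta; apply: le_trans (_ : leb U <= _).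
    by apply: le_measure; rewrite ?inE//; exact: subIsetl.
  rewrite -{1}(setDUK SU); apply: le_trans (measureU2 _ _ _) _ => //.
    exact: measurableD.
  by rewrite [X in X + _]S0 add0e.
have IU : \int[leb]_(t in U') A t <= (e / (C + 1))%:E.
  have -> : \int[leb]_(t in U') A t = \int[leb]_(t in U') (A \_ `[a, b]) t.
    apply: eq_integral => t; rewrite inE => -[_ /=]; rewrite in_itv/= => /andP[at_ tb].
    by rewrite patchE mem_set//= in_itv/= !ltW.
  rewrite (@ge0_ae_eq_integral _ Rm R leb U' _ _ mU' _ _ _ _ (aef _))//; last first.
  - by move=> x _; rewrite lee_fin.
  - by apply: measurable_funTS; apply/measurable_EFinP.
  - exact: measurable_funTS.
  have := heta _ mU' U'eta; rewrite -lte_fin => /ltW; apply: le_trans.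
  rewrite /Rintegral fineK; last first.
    apply: integrable_fin_num => //; apply: (integrableS measurableT) => //.
    exact: integrable_abse if_.
  by rewrite le_eqVlt; apply/orP; left; apply/eqP; apply: eq_integral => x _; rewrite ger0_norm.
pose dl (j : nat) : R := (d0 / j.+1%:R)%R.
have dl0 j : (0 < dl j)%R by rewrite divr_gt0.
have dld0 j : (dl j <= d0)%R by rewrite ler_pdivrMr// ler_peMr ?(ltW d00)// ler1n.
pose F j : set Rm := [set x : R | ball x (dl j) `<=` U'].
have mF j : measurable (F j).
  rewrite -[F j]setCK; apply: measurableC; apply: open_measurable.
  rewrite openE => x /existsNP[y /not_implyP[xy Uy]]; move: xy; rewrite /ball/= => xy.
  apply/nbhs_ballP; exists (dl j - `|x - y|)%R => /=; first by rewrite subr_gt0.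
  move=> z; rewrite /ball/= => xz zF; apply: Uy; apply: zF.
  rewrite /ball/= -(subrK x z) -addrA; apply: le_lt_trans (ler_normD _ _) _.
  by rewrite (distrC z) -ltrBrDr.
have Fe j : nu (F j) <= e%:E.
  have F1 : nu (F j) \is a fin_num by rewrite fin_num_measure.
  have := small_integral_le oU' (mF j) (@subIsetr _ _ _) _ _ => /(_ (dl j)).
  rewrite dl0 dld0 => /(_ isT) h.
  have {}h := le_trans (h (fun x t Fx xt => Fx t xt)) (lee_wpmul2l _ IU).
  have : (dl j *+ 2)%:E * nu (F j) <= (C * dl j)%:E * (e / (C + 1))%:E.
    by apply: h; rewrite lee_fin mulr_ge0// ltW.
  rewrite -(fineK F1) -!EFinM !lee_fin => {}h.
  have nn : (0 <= fine (nu (F j)))%R by rewrite fine_ge0.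
  have e1 : (C * (e / (C + 1)) <= e)%R.
    by rewrite mulrCA ler_piMr ?(ltW e0)// ler_pdivrMr// mul1r lerDl.
  have := dl0 j; move: h; move: (dl j) (fine _) nn e1 => D v v0 e1 h D0.
  have : (D * (v *+ 2) <= D * e)%R.
    rewrite (_ : D * (v *+ 2) = D *+ 2 * v)%R; last by ring.
    by apply: le_trans h _; rewrite (mulrC C) -mulrA ler_pM2l.
  rewrite ler_pM2l//. lra.
have U'F : U' = \bigcup_j F j.
  apply/seteqP; split => [x Ux|x [j _ Fx]]; last by apply: Fx; exact: ballxx.
  have /nbhs_ballP[r /= r0 rU] := open_nbhs_nbhs (conj oU' Ux).
  exists (Num.truncn (d0 / r)) => // y xy; apply: rU; apply: le_ball xy.
  by rewrite ler_pdivrMr// mulrC -ler_pdivrMr// ltW// truncnS_gt.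
have cv : nu \o F @ \oo --> nu U'.
  rewrite U'F; apply: nondecreasing_cvg_mu => //; first by rewrite -U'F.
  move=> i j ij; rewrite subsetEset => x Fx y xy; apply: Fx; apply: le_ball xy.
  by rewrite ler_pM2l// lef_pV2 ?posrE// ler_nat.
apply: (@le_trans _ _ (nu U')).
  by apply: le_measure; rewrite ?inE// => x Sx; split; [exact: SU|exact: Sab].
rewrite -(cvg_lim _ cv)//; apply: lime_le; first by apply/cvg_ex; exists (nu U').
by apply: nearW => j; exact: Fe.
Qed.

End density.

(** * The energy of a pair of measures and distance sets *)

Lemma dotv_mulmx (R : realType) n (x y : 'rV[R]_n) (M : 'M[R]_n) :
  dotv (x *m M) y = dotv x (y *m M^T).
Proof.
have dE (u v : 'rV[R]_n) : dotv u v = (u *m v^T) ord0 ord0.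
  by rewrite mxE; apply: eq_bigr => i _; rewrite mxE.
by rewrite !dE trmx_mul trmxK mulmxA.
Qed.

Lemma enorm_mulmx (R : realType) n (x : 'rV[R]_n) (M : 'M[R]_n) :
  M *m M^T = 1%:M -> enorm (x *m M) = enorm x.
Proof. by move=> MM; rewrite /enorm dotv_mulmx -mulmxA MM mulmx1. Qed.

Section energy.
Context {R : realType} {n : nat}.
Local Notation V := (borel 'rV[R]_n).
Variables (mu sigma : {finite_measure set V -> \bar R}) (rho : 'M[R]_n).

(** The function A(t) of the overview, for the rotation [rho]. *)
Definition energy (t : R) : \bar R :=
  (\int[lebesgue_rV R n]_xi (Normc.normc (fourier mu xi) ^+ 2 *
     Normc.normc (fourier sigma (t *: ((xi : 'rV[R]_n) *m rho^T))))%:E)%E.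

Let measurable_energy_fun : measurable_fun setT (fun z : measurableTypeR R * V =>
  (Normc.normc (fourier mu z.2) ^+ 2 *
     Normc.normc (fourier sigma ((z.1 : R) *: ((z.2 : 'rV[R]_n) *m rho^T))))%:E).
Proof.
apply/measurable_EFinP; apply: measurable_funM.
  by apply: measurable_funX; apply: (measurableT_comp (measurable_normc_fourier mu)) measurable_snd.
apply: (measurableT_comp (measurable_normc_fourier sigma)).
apply: measurable_scalemx; first exact: measurable_fst.
by apply: measurable_mulmx; [exact: measurable_snd|exact: measurable_cst].
Qed.

Lemma energy_ge0 t : (0 <= energy t)%E.
Proof. by apply: integral_ge0 => x _; rewrite lee_fin mulr_ge0 ?sqr_ge0// normc_fourier_ge0. Qed.

Lemma measurable_energy : measurable_fun setT (energy : measurableTypeR R -> \bar R).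
Proof.
apply: (@measurable_fun_fubini_tonelli_F _ _ (measurableTypeR R) V R (lebesgue_rV R n) _ measurable_energy_fun).
by move=> z; rewrite lee_fin mulr_ge0 ?sqr_ge0// normc_fourier_ge0.
Qed.

Section shifted.
Variables (t : R) (b : 'rV[R]_n).

(** The dilated and rotated surface, moved by [- b]. The shift only changes the phase of the
    transform, so the bounds by the energy are uniform in [b]. *)
Let g (z : V) : V := t *: ((z : 'rV[R]_n) *m rho) - b.

Let mg : measurable_fun setT g.
Proof.
apply: measurable_submx; last exact: measurable_cst.
apply: measurable_scalemx; first exact: measurable_cst.
apply: measurable_mulmx; last exact: measurable_cst.
exact: measurable_id.
Qed.

Let sigma_g : {finite_measure set V -> \bar R} := law sigma mg.

Let dotv_g z xi : dotv (g z : 'rV[R]_n) xi = dotv (z : 'rV[R]_n) (t *: (xi *m rho^T)) - dotv b xi.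
Proof. by rewrite /g dotvBl dotvZl dotv_mulmx [in RHS]dotvC dotvZl [in RHS](dotvC (_ *m _)). Qed.

Let cosft_g_le xi : `|cosft sigma_g xi| <= Normc.normc (fourier sigma (t *: (xi *m rho^T))).
Proof.
set eta := t *: _; pose be := 2 * pi * dotv b xi.
have -> : cosft sigma_g xi = cosft sigma eta * cos be + sinft sigma eta * sin be.
  rewrite /cosft /sigma_g (@Rintegral_law _ _ _ _ _ _ _ _ (fun p : V => cos (2 * pi * dotv (p : 'rV[R]_n) xi)) 1); last 2 first.
    by apply: measurable_cos_phase => //; exact: measurable_cst.
    by move=> x; exact: cos_max.
  under eq_Rintegral do rewrite dotv_g mulrBr cosB.
  have ic := integrable_cos sigma eta; have is' := integrable_sin sigma eta.
  rewrite RintegralD//; [|exact: integrableMc|exact: integrableMc].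
  by rewrite !RintegralZr.
rewrite normc_fourier -sqrtr_sqr ler_wsqrtr//.
have := sin2cos2 be.
move: (cosft _ _) (sinft _ _) (cos be) (sin be) => x y u v e.
(* Cauchy-Schwarz by Lagrange's identity, with the squares of cosine and sine adding up to 1. *)
have : 0 <= (x * v - y * u) ^+ 2 by rewrite sqr_ge0.
have -> : x ^+ 2 + y ^+ 2 = (x ^+ 2 + y ^+ 2) * (v ^+ 2 + u ^+ 2) by rewrite e subrK mulr1.
by move=> h; rewrite -subr_ge0; apply: le_trans h _; rewrite le_eqVlt; apply/orP; left; apply/eqP; ring.
Qed.

(** [tau] is the law of [p + b - t *: (z *m rho)] for [p] distributed by [diff_law mu mu] and [z] by
    [sigma]. Its transform is at most the integrand of the energy, while by Fubini its mass near the
    origin is at least [v] times the mass of [P]. The test radius [c / e] makes the cube of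
    [cube_concentration] equal to [cube e]. *)
Lemma energy_concentration_cube (c : R) : 0 < c ->
  (forall r (tau : {finite_measure set V -> \bar R}), 0 < r ->
    (((r *+ 2) ^+ n)%:E * tau (cube (c / r)) <=
      4%:E * \int[lebesgue_rV R n]_xi `|cosft tau xi|%:E)%E) ->
  forall (P : set V) (v e : R),
  measurable P -> 0 < e -> 0 <= v ->
  (forall p, P p -> (v%:E <= sigma [set z : V | cube e ((p : 'rV[R]_n) + b - t *: ((z : 'rV[R]_n) *m rho))%R])%E) ->
  (((c *+ 2 / e) ^+ n * v)%:E * diff_law mu mu P <= 4%:E * energy t)%E.
Proof.
move=> c0 hc.
move=> P v e mP e0 v0 hP.
pose tau := diff_law (diff_law mu mu) sigma_g.
have r0 : 0 < c / e by rewrite divr_gt0.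
have := hc _ tau r0; rewrite invf_div mulrCA divff ?gt_eqF// mulr1 => h.
have : (v%:E * diff_law mu mu P <= tau (cube e))%E.
  apply: (@le_trans _ _ (\int[diff_law mu mu]_p (v * \1_P p)%:E)%E).
    under eq_integral do rewrite EFinM.
    rewrite ge0_integralZl_EFin//; last exact/measurable_EFinP.
    by rewrite integral_indicT.
  pose W : set (V * V) := (fun z : V * V => ((z.1 : 'rV[R]_n) - (z.2 : 'rV[R]_n))%R : V) @^-1` (cube e).
  have mW : measurable W.
    by rewrite -[W]setTI; apply: measurable_subV => //; exact: measurable_cube.
  have -> : tau (cube e) = (\int[diff_law mu mu]_p (sigma_g \o xsection W) p)%E by [].
  have sW p : (sigma_g \o xsection W) p =
      sigma [set z : V | cube e ((p : 'rV[R]_n) + b - t *: ((z : 'rV[R]_n) *m rho))%R].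
    rewrite /= /sigma_g /law /pushforward; congr (sigma _).
    by apply/seteqP; split => z /=; rewrite /xsection /= inE /W /= /g opprB addrA.
  apply: ge0_le_integral => //.
  - by move=> p _; rewrite lee_fin mulr_ge0.
  - by apply/measurable_EFinP; apply: measurable_funM => //; exact: measurable_cst.
  - exact: measurable_fun_xsection.
  - move=> p _; rewrite indicE; have [|_] := boolP (p \in P); last by rewrite mulr0.
    by rewrite inE mulr1 sW => /hP.
move=> h2; have cn : (0 <= (c *+ 2 / e) ^+ n) by rewrite exprn_ge0// divr_ge0 ?mulrn_wge0// ltW.
apply: (@le_trans _ _ (((c *+ 2 / e) ^+ n)%:E * tau (cube e))%E).
  by rewrite EFinM -muleA lee_wpmul2l// lee_fin.
rewrite -mulrnAl in h; apply: le_trans h _; rewrite lee_pmul2l//.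
apply: ge0_le_integral => //.
- apply/measurable_EFinP; apply: measurableT_comp => //; exact: measurable_cosft.
- apply/measurable_EFinP; apply: measurable_funM.
    by apply: measurable_funX; exact: measurable_normc_fourier.
  apply: (measurableT_comp (measurable_normc_fourier sigma)).
  apply: measurable_scalemx; first exact: measurable_cst.
  by apply: measurable_mulmx; [exact: measurable_id|exact: measurable_cst].
move=> xi _; rewrite lee_fin cosft_diff_law cosft_diff_law_self sinft_diff_law_self mul0r addr0.
rewrite normrM -normc_fourier2 ger0_norm ?sqr_ge0// ler_wpM2l ?sqr_ge0//.
Qed.

End shifted.

Lemma energy_concentration : exists2 c : R, 0 < c & forall t (b : 'rV[R]_n), forall (P : set V) (v e : R),
  measurable P -> 0 < e -> 0 <= v ->
  (forall p, P p -> (v%:E <= sigma [set z : V | cube e ((p : 'rV[R]_n) + b - t *: ((z : 'rV[R]_n) *m rho))%R])%E) ->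
  (((c / e) ^+ n * v)%:E * diff_law mu mu P <= 4%:E * energy t)%E.
Proof.
have [c c0 hc] := @cube_concentration R n.
exists (c *+ 2) => [|t b]; first by rewrite mulrn_wgt0.
exact: energy_concentration_cube.
Qed.

End energy.

(** Rotating the norm instead of the set keeps [E] and [mu] fixed while [rho] varies. *)
Lemma norm_like_mulmx (R : realType) k (N : 'rV[R]_k.+1 -> R) m M (rho : 'M[R]_k.+1) :
  norm_like N m M -> rho *m rho^T = 1%:M ->
  norm_like (fun x => N (x *m rho^T)) (m / k.+1%:R) (M * k.+1%:R).
Proof.
move=> NN rr; have rr' : rho^T *m rho = 1%:M by exact: mulmx1C.
have [m0 M0 Nge Nle ND NZ NN'] := NN.
have k0 : 0 < k.+1%:R :> R by rewrite ltr0n.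
have le1 (x : 'rV[R]_k.+1) : `|x *m rho^T| <= k.+1%:R * `|x|.
  apply: le_trans (norm_le_enorm _) _; rewrite enorm_mulmx; first exact: enorm_le_norm.
  by rewrite trmxK.
have le2 (x : 'rV[R]_k.+1) : `|x| <= k.+1%:R * `|x *m rho^T|.
  apply: le_trans (norm_le_enorm _) _; rewrite -[X in enorm X](mulmx1 x) -rr' mulmxA enorm_mulmx//.
  exact: enorm_le_norm.
split.
- by rewrite divr_gt0.
- by rewrite mulr_gt0.
- move=> x; apply: le_trans (Nge _); rewrite -mulrA ler_wpM2l ?(ltW m0)//.
  by rewrite mulrC ler_pdivrMr// mulrC.
- by move=> x; apply: le_trans (Nle _) _; rewrite -mulrA ler_wpM2l ?(ltW M0).
- by move=> x y; rewrite mulmxDl.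
- by move=> t x t0; rewrite -scalemxAl NZ.
- by move=> x; rewrite mulNmx NN'.
Qed.

Section distance_sets.
Context {R : realType} {k : nat}.
Local Notation V := (borel 'rV[R]_k.+1).
Local Notation leb := (@lebesgue_measure R).
Variables (N : 'rV[R]_k.+1 -> R) (m M : R).
Hypothesis NN : norm_like N m M.
Variables (mu sigma : {finite_measure set V -> \bar R}) (rho : 'M[R]_k.+1) (c r0 : R).
Hypothesis rhoT : rho *m rho^T = 1%:M.
Hypotheses (c0 : 0 < c) (r00 : 0 < r0).
Hypothesis sigma_ge : forall w r, N w = 1 -> 0 < r <= r0 ->
  ((c * r ^+ k)%:E <= sigma [set x : 'rV[R]_k.+1 | (`|x - w *m rho^T| <= r)%R])%E.

Let m_gt0 : 0 < m := norm_like_gt0 NN.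
Let D : {finite_measure set V -> \bar R} := diff_law mu mu.
Let K1 : 0 < k.+1%:R :> R. Proof. by rewrite ltr0n. Qed.

(** One half of [e] absorbs the distance from [p + b] to the dilated sphere, the other half the
    image of a ball of radius [r], since dilation and rotation enlarge the sup norm by at most
    [t * k.+1%:R]. *)
Let sigma_near t (p b w : 'rV[R]_k.+1) e r : 0 < t -> 0 < e -> N w = 1 -> 0 < r <= r0 ->
  `|p + b - t *: w| <= e / 2 -> t * k.+1%:R * r <= e / 2 ->
  ((c * r ^+ k)%:E <= sigma [set z : V | cube e (p + b - t *: ((z : 'rV[R]_k.+1) *m rho))%R])%E.
Proof.
move=> t0 e0 Nw rr pw tr; apply: le_trans (sigma_ge Nw rr) _.
have mW : measurable [set z : V | cube e (p + b - t *: ((z : 'rV[R]_k.+1) *m rho))%R].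
  have mf : measurable_fun setT (fun z : V => p + b - t *: ((z : 'rV[R]_k.+1) *m rho) : V).
    apply: measurable_submx; first exact: measurable_cst.
    apply: measurable_scalemx; first exact: measurable_cst.
    by apply: measurable_mulmx; [exact: measurable_id|exact: measurable_cst].
  by have := mf measurableT _ (measurable_cube e); rewrite setTI.
apply: le_measure; rewrite ?inE//.
  have := measurable_translated_cube (w *m rho^T) r; congr (measurable _).
  have r1 : 0 <= r by case/andP: rr => /ltW.
  by apply/seteqP; split => z /=; [move=> /(cube_norm _ r1)|move=> ?; apply/(cube_norm _ r1)].
move=> z /= zw; apply/(cube_norm _ (ltW e0)).
have -> : p + b - t *: (z *m rho) = (p + b - t *: w) + t *: ((w *m rho^T - z) *m rho).
  by rewrite mulmxBl -mulmxA (mulmx1C rhoT) mulmx1 scalerBr addrA subrK.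
apply: le_trans (ler_normD _ _) _.
rewrite [leRHS](_ : e = e / 2 + e / 2); last by lra.
apply: lerD => //; apply: le_trans tr; rewrite normrZ (gtr0_norm t0) -mulrA ler_wpM2l ?(ltW t0)//.
apply: le_trans (norm_le_enorm _) _; rewrite enorm_mulmx//.
by apply: le_trans (enorm_le_norm _) _; rewrite ler_wpM2l// distrC.
Qed.

Lemma diff_law_near : exists2 G : R, 0 < G & forall t (b : 'rV[R]_k.+1) (P : set V) e r,
  measurable P -> 0 < t -> 0 < e -> 0 < r <= r0 -> t * k.+1%:R * r <= e / 2 ->
  (forall p, P p -> exists2 w, N w = 1 & `|(p : 'rV[R]_k.+1) + b - t *: w| <= e / 2) ->
  ((G * (r ^+ k / e ^+ k.+1))%:E * D P <= 4%:E * energy mu sigma rho t)%E.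
Proof.
have [g g0 hg] := energy_concentration mu sigma rho.
exists (g ^+ k.+1 * c); first by rewrite mulr_gt0// exprn_gt0.
move=> t b P e r mP t0 e0 rr tr hP; have r1 : 0 < r by case/andP: rr.
have v0 : 0 <= c * r ^+ k by rewrite mulr_ge0 ?exprn_ge0// ltW.
have := hg t b P _ e mP e0 v0; rewrite exprMn exprVn => hg'.
rewrite (_ : _ * _ * _ = g ^+ k.+1 / e ^+ k.+1 * (c * r ^+ k)); last by ring.
apply: hg' => p /hP[w Nw pw]; exact: (sigma_near t0 e0 Nw rr pw tr).
Qed.

(** A point [p] of the shell is within [d / m] of [t] times its normalisation. As [e] and [r] are
    both multiples of [d], the quotient of [r ^+ k] by [e ^+ k.+1] is a multiple of [d^-1], which
    becomes the factor [d] on the right. *)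
Lemma diff_law_shell (a b : R) : 0 < a -> a <= b -> exists C : R, 0 <= C /\ exists d0 : R, 0 < d0 /\
  forall t d : R, a <= t <= b -> 0 < d <= d0 ->
  (D [set p : V | (`|N (p : 'rV[R]_k.+1) - t| <= d)%R] <= (C * d)%:E * energy mu sigma rho t)%E.
Proof.
move=> a0 ab; have b0 : 0 < b by exact: lt_le_trans ab.
have [G G0 hG] := diff_law_near.
pose q := m * k.+1%:R * b.
have q0 : 0 < q by apply: mulr_gt0 => //; exact: mulr_gt0.
exists (4 * (2 / m) ^+ k.+1 * q ^+ k / G); split.
  by rewrite divr_ge0 ?(ltW G0)// !mulr_ge0 ?exprn_ge0 ?divr_ge0// ltW.
(* The bound [a / 2] keeps [N p] positive on the shell; [q * r0] keeps [r] in the range of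
   [sigma_ge]. *)
exists (Num.min (a / 2) (q * r0)); split; first by rewrite lt_min divr_gt0//= mulr_gt0.
move=> t d /andP[ta tb] /andP[d0]; rewrite le_min => /andP[da dr].
have t0 : 0 < t by exact: lt_le_trans ta.
pose e := 2 * d / m; pose r := d / q.
have e0 : 0 < e by rewrite divr_gt0// mulr_gt0.
have rr : 0 < r <= r0 by rewrite divr_gt0//= ler_pdivrMr// mulrC.
have mP : measurable [set p : V | (`|N (p : 'rV[R]_k.+1) - t| <= d)%R].
  have mf : measurable_fun setT (fun p : V => `|N (p : 'rV[R]_k.+1) - t|%R : R).
    apply: measurableT_comp => //; apply: measurable_funB => //.
    exact: measurable_norm_like NN.
  have := mf measurableT _ (measurable_itv `]-oo, d]); rewrite setTI.
  by congr (measurable _); apply/seteqP; split => z; rewrite /= in_itv.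
have tr : t * k.+1%:R * r <= e / 2.
  rewrite /r /q /e (_ : 2 * d / m / 2 = d / m); last by field; rewrite gt_eqF.
  rewrite (_ : _ * _ * (d / _) = t / b * (d / m)); last by field; rewrite !gt_eqF.
  by rewrite ler_piMl ?divr_ge0 ?(ltW d0) ?(ltW m_gt0)// ler_pdivrMr// mul1r.
have hp (p : V) : [set p : V | (`|N (p : 'rV[R]_k.+1) - t| <= d)%R] p ->
   exists2 w, N w = 1 & `|(p : 'rV[R]_k.+1) + 0 - t *: w| <= e / 2.
  move=> /= pd.
  have s0 : 0 < N p by have := da; move: pd; rewrite ler_distl; lra.
  exists ((N p)^-1 *: (p : 'rV[R]_k.+1)); first by rewrite (norm_like_Z NN) ?invr_ge0 ?ltW// mulVf// gt_eqF.
  have -> : (p : 'rV[R]_k.+1) + 0 - t *: ((N p)^-1 *: (p : 'rV[R]_k.+1)) = ((N p - t) / N p) *: (p : 'rV[R]_k.+1).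
    by rewrite addr0 mulrBl divff ?gt_eqF// scalerBl scale1r scalerA.
  rewrite normrZ normrM normfV (gtr0_norm s0) -mulrA.
  rewrite (_ : e / 2 = d * m^-1); last by rewrite /e; field; rewrite gt_eqF.
  apply: ler_pM => //; first by rewrite mulr_ge0// invr_ge0 ltW.
  by rewrite mulrC ler_pdivrMr// ler_pdivlMl// (norm_like_ge NN).
have := hG t 0 _ e r mP t0 e0 rr tr hp; rewrite (_ : r ^+ k / e ^+ k.+1 = (m / 2) ^+ k.+1 / q ^+ k / d); last first.
  have aux (x y z : R) : 0 < x -> 0 < y -> 0 < z ->
      (x / y) ^+ k / (2 * x / z) ^+ k.+1 = (z / 2) ^+ k.+1 / y ^+ k / x.
    by move=> x0 y0 z0; rewrite !exprMn !exprVn !exprS; field; rewrite !gt_eqF ?exprn_gt0.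
  exact: aux.
move: (D _) (energy_ge0 mu sigma rho t) => X; move: (energy _ _ _ _) => Y Y0 h.
have H0 : 0 < G * ((m / 2) ^+ k.+1 / q ^+ k / d) by rewrite !mulr_gt0 ?invr_gt0 ?exprn_gt0 ?divr_gt0.
rewrite -(@lee_pmul2l _ (G * ((m / 2) ^+ k.+1 / q ^+ k / d))%:E)//.
apply: (le_trans h); rewrite muleA -EFinM le_eqVlt; apply/orP; left; apply/eqP; congr (_%:E * _)%E.
have aux (x y z w : R) : 0 < x -> 0 < y -> 0 < z -> 0 < w ->
    4 = w * ((z / 2) ^+ k.+1 / y ^+ k / x) * (4 * (2 / z) ^+ k.+1 * y ^+ k / w * x).
  by move=> x0 y0 z0 w0; rewrite !exprMn !exprVn; field; rewrite !gt_eqF ?exprn_gt0.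
exact: aux.
Qed.

(* Shifting the sphere of radius [t] so that it passes through the origin makes
   [P = {0}] a case of [diff_law_near]. *)
Lemma diff_law_diagonal t : 0 < t -> (energy mu sigma rho t < +oo)%E -> D [set 0 : 'rV[R]_k.+1] = 0%E.
Proof.
move=> t0 tfin; have [G G0 hG] := diff_law_near.
have m0' : measurable ([set 0 : 'rV[R]_k.+1] : set V).
  rewrite (_ : [set 0] = cube 0); first exact: measurable_cube.
  apply/seteqP; split => [_ ->|x /(cube_norm _ (lexx 0))]; first by apply/cube_norm; rewrite ?normr0.
  by rewrite normr_le0 => /eqP.
have D1 : D [set 0 : 'rV[R]_k.+1] \is a fin_num by rewrite fin_num_measure.
have E1 : energy mu sigma rho t \is a fin_num by rewrite ge0_fin_numE ?energy_ge0.
have z1 : (const_mx 1 : 'rV[R]_k.+1) != 0.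
  by apply/eqP => /rowP /(_ ord0); rewrite !mxE => /eqP; rewrite oner_eq0.
pose z0 : 'rV[R]_k.+1 := (N (const_mx 1))^-1 *: const_mx 1.
have Nz0 : N z0 = 1 by exact: normalize NN _ z1.
apply/eqP; rewrite eq_le measure_ge0 andbT -(fineK D1) lee_fin.
pose q := 2 * t * k.+1%:R; have q0 : 0 < q by rewrite !mulr_gt0.
pose B := 4 * fine (energy mu sigma rho t) * q ^+ k / G.
have B0 : 0 <= B.
  by rewrite /B divr_ge0 ?(ltW G0)// !mulr_ge0 ?exprn_ge0 ?fine_ge0 ?energy_ge0// ltW.
(* At scale [e] the factor in [diff_law_near] is a multiple of [e^-1], so the mass of the origin is
   at most a multiple of [e], which is arbitrarily small. *)
suff h e : 0 < e <= q * r0 -> fine (D [set 0 : 'rV[R]_k.+1]) <= B * e.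
  apply/ler_addgt0Pr => d d0; rewrite add0r.
  have B1 : 0 < B + 1 by rewrite ltr_wpDl.
  pose e := Num.min (q * r0) (d / (B + 1)).
  have e0 : 0 < e by rewrite lt_min mulr_gt0//= divr_gt0.
  apply: le_trans (h e _) _; first by rewrite e0 /e ge_min lexx.
  apply: (@le_trans _ _ (B * (d / (B + 1)))).
    by rewrite ler_wpM2l// /e ge_min lexx orbT.
  by rewrite mulrCA ler_piMr ?(ltW d0)// ler_pdivrMr// mul1r lerDl.
move=> /andP[e0 eq]; pose r := e / q.
have rr : 0 < r <= r0 by rewrite divr_gt0//= ler_pdivrMr// mulrC.
have tr : t * k.+1%:R * r <= e / 2.
  by rewrite /r /q le_eqVlt; apply/orP; left; apply/eqP; field; rewrite !gt_eqF.
have hp (p : V) : [set 0 : 'rV[R]_k.+1] p -> exists2 w, N w = 1 & `|p + t *: z0 - t *: w| <= e / 2.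
  by move=> /= ->; exists z0 => //; rewrite add0r subrr normr0 divr_ge0// ltW.
have := hG t (t *: z0) _ e r m0' t0 e0 rr tr hp.
rewrite -(fineK D1) -(fineK E1) -!EFinM lee_fin fineK//.
rewrite (_ : r ^+ k / e ^+ k.+1 = (q ^+ k * e)^-1); last first.
  have aux (x y : R) : 0 < x -> 0 < y -> (x / y) ^+ k / x ^+ k.+1 = (y ^+ k * x)^-1.
    by move=> x0 y0; rewrite exprMn exprVn exprS; field; rewrite !gt_eqF ?exprn_gt0.
  exact: aux.
move=> h; rewrite /B.
have Qe0 : 0 < q ^+ k * e by rewrite mulr_gt0// exprn_gt0.
rewrite (_ : _ * e = 4 * fine (energy mu sigma rho t) * (q ^+ k * e / G)); last by ring.
rewrite -ler_pdivrMr ?divr_gt0//; apply: le_trans h.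
by rewrite invf_div mulrC.
Qed.

Lemma distance_set_measure_gt0 (E : set 'rV[R]_k.+1) : compact E ->
  mu setT != 0%E -> mu (~` E) = 0%E ->
  (forall j : nat, (\int[leb]_(t in `[(j.+2%:R^-1)%R, j.+2%:R%R]) energy mu sigma rho t < +oo)%E) ->
  (0 < leb [set N (p.1 - p.2) | p in E `*` E])%E.
Proof.
move=> cE mu0 muE Afin; set S := [set _ | _ in _].
have cS : compact S.
  apply: continuous_compact; last exact: compact_setX.
  apply: continuous_subspaceT => z; apply: (@continuous_comp _ _ _ (fun z : 'rV[R]_k.+1 * 'rV[R]_k.+1 => z.1 - z.2) N).
    by apply: (@cvgB _ _ _ (nbhs z) _ fst snd); [exact: cvg_fst|exact: cvg_snd].
  exact: norm_like_continuous NN _.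
have mS : measurable (S : set (measurableTypeR R)) by exact: compact_measurable.
have mE : measurable (E : set V).
  by apply: closed_borel; apply: compact_closed => //; exact: norm_hausdorff.
rewrite lt_neqAle measure_ge0 andbT; apply/eqP => /esym S0.
have mN : measurable_fun setT (N : V -> measurableTypeR R) by exact: measurable_norm_like NN.
pose nu : {finite_measure set (measurableTypeR R) -> \bar R} := law D mN.
have nuS : nu (~` S) = 0%E.
  apply/eqP; rewrite eq_le measure_ge0 andbT.
  have -> : nu (~` S) = fin_product mu mu [set z : V * V | ~ S (N ((z.1 : 'rV[R]_k.+1) - (z.2 : 'rV[R]_k.+1)))] by [].
  apply: (@le_trans _ _ (fin_product mu mu ((~` E) `*` setT `|` setT `*` (~` E)))).
    apply: le_measure; rewrite ?inE.
    - have mf : measurable_fun setT (fun z : V * V => N ((z.1 : 'rV[R]_k.+1) - (z.2 : 'rV[R]_k.+1)) : measurableTypeR R).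
        exact: (measurableT_comp mN (@measurable_subV R k.+1)).
      have := mf measurableT _ (measurableC mS); rewrite setTI; congr (measurable _).
    - by apply: measurableU; apply: measurableX => //; exact: measurableC.
    - move=> z /= nS; have [Ez1|] := pselect (E z.1); last by left.
      by right; split => // Ez2; apply: nS; exists (z.1, z.2).
  apply: (le_trans (measureU2 _ _ _)); do ?[by apply: measurableX => //; exact: measurableC].
  have mCE : measurable (~` E : set V) by exact: measurableC.
  have e1 : (mu \x mu)%E ((~` E : set V) `*` (setT : set V)) = 0%E by rewrite product_measure1E// [X in (X * _)%E]muE mul0e.
  have e2 : (mu \x mu)%E ((setT : set V) `*` (~` E : set V)) = 0%E by rewrite product_measure1E// [X in (_ * X)%E]muE mule0.
  by rewrite [X in (X + _)%E]e1 [X in (_ + X)%E]e2 adde0.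
have nuSj (j : nat) : nu (S `&` `]j.+2%:R^-1, j.+2%:R[%classic) = 0%E.
  have j0 : 0 < j.+2%:R^-1 :> R by rewrite invr_gt0.
  have jj : j.+2%:R^-1 <= j.+2%:R :> R.
    by apply: (@le_trans _ _ 1); rewrite ?ler1n// invf_le1// ler1n.
  have [C [C0 [d0 [d00 h]]]] := diff_law_shell j0 jj.
  apply: (@density_null _ nu (energy mu sigma rho) j.+2%:R^-1 j.+2%:R C d0) => //.
  - exact: measurable_energy.
  - by move=> t; exact: energy_ge0.
  - by apply: measurableI => //; exact: measurable_itv.
  - apply/eqP; rewrite eq_le measure_ge0 andbT -[leRHS]S0; apply: le_measure; rewrite ?inE//.
    by apply: measurableI => //; exact: measurable_itv.
(* An energy infinite at every positive [t] would have infinite integral over [[1/2, 2]]. *)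
have [t t0 tfin] : exists2 t, 0 < t & (energy mu sigma rho t < +oo)%E.
  apply: contrapT => no; have := Afin 0%N; rewrite ltNge => /negP; apply.
  rewrite (eq_integral (fun=> +oo%E)); last first.
    move=> t; rewrite inE/= in_itv/= => /andP[t0 _]; apply/eqP; rewrite -leye_eq leNgt.
    by apply/negP => tfin; apply: no; exists t => //; apply: lt_le_trans t0; rewrite invr_gt0.
  rewrite integral_cst//= lebesgue_measure_itv/= lte_fin.
  have -> : 2^-1 < 2 :> R by lra.
  by rewrite -EFinB gt0_mulye// lte_fin; lra.
have nu0 : nu [set x | x <= 0] = 0%E.
  rewrite -[RHS](diff_law_diagonal t0 tfin); rewrite /nu /law /pushforward; congr (D _).
  apply/seteqP; split => x /=; last by move=> ->; have := norm_like_le NN 0; rewrite normr0 mulr0.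
  by move=> h; apply/eqP; apply: contraT => /(norm_like_gt0P NN); rewrite ltNge h.
have m0' : measurable [set x : measurableTypeR R | x <= 0].
  rewrite (_ : mkset _ = [set` `]-oo, (0 : R)]]); first exact: measurable_itv.
  by apply/seteqP; split => x; rewrite /= in_itv.
have nuT : nu setT = 0%E.
  apply/negligibleP => //.
  (* The line is covered by the complement of [S], the nonpositive numbers and the parts of [S] in
     the intervals, each of which is null for [nu]. *)
  apply: (@negligibleS _ _ _ nu ((~` S `|` [set x | x <= 0]) `|` \bigcup_j (S `&` `]j.+2%:R^-1, j.+2%:R[%classic))).
    move=> x _; have [Sx|] := pselect (S x); last by left; left.
    have [x0|x0] := lerP x 0; first by left; right.
    right; exists (Num.truncn (Num.max x x^-1)) => //; split => //=; rewrite in_itv/=.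
    have h : Num.max x x^-1 < (Num.truncn (Num.max x x^-1)).+2%:R.
      by apply: lt_trans (truncnS_gt _) _; rewrite ltr_nat.
    rewrite invf_plt ?posrE//; apply/andP; split; apply: le_lt_trans h; by rewrite le_max lexx ?orbT.
  apply: negligibleU; first apply: negligibleU.
  - by apply/negligibleP => //; exact: measurableC.
  - by apply/negligibleP.
  - apply: negligible_bigcup => j; apply/negligibleP; last exact: nuSj.
    by apply: measurableI => //; exact: measurable_itv.
have : nu setT = (mu setT * mu setT)%E.
  transitivity ((mu \x mu)%E (setT `*` setT)); first by rewrite setXTT.
  by rewrite product_measure1E.
rewrite nuT => /esym/eqP; rewrite mule_eq0 orbb => /eqP h.
by rewrite h eqxx in mu0.
Qed.

End distance_sets.

(** * Frostman's lemma *)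

Lemma measure_fin_cover d (T : measurableType d) (R : realType) (m : {measure set T -> \bar R})
    (I : finType) (B : I -> set T) X :
  measurable X -> (forall i, measurable (B i)) -> X `<=` \bigcup_(i in [set: I]) B i ->
  (m X <= \sum_i m (B i))%E.
Proof.
move=> mX mB XB; pose F j := nth set0 [seq B i | i <- enum I] j.
have FE : (\sum_(j < #|I|) m (F j) = \sum_i m (B i))%E.
  rewrite -[RHS](big_enum) /= -(big_map B xpredT m) (big_nth set0) size_map -cardE big_mkord.
  by [].
rewrite -FE; apply: content_subadditive => //.
  move=> j jI; rewrite /F (nth_map (enum_val (Ordinal jI))) -?cardE//.
move=> x /XB[i _ Bx]; rewrite -bigcup_mkord; exists (index i (enum I)) => /=.
  by rewrite cardE index_mem mem_enum.
by rewrite /F (nth_map i) ?index_mem ?mem_enum// nth_index ?mem_enum.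
Qed.

(** * Dyadic boxes by successive halving and their coding by an interval *)

Section dyadic_boxes.
Context {R : realType} {k : nat}.
Variables (a : 'rV[R]_k.+1) (S : R).
Hypothesis S0 : 0 < S.

(** Coordinates are halved one at a time in cyclic order, so that every split is binary, like a cut
    of an interval; after [k.+1 * l] steps the box is a cube again. *)
Definition halvings j (i : 'I_k.+1) : nat := \sum_(l < j) (l %% k.+1 == i).

Lemma halvingsS j i : halvings j.+1 i = (halvings j i + (j %% k.+1 == i))%N.
Proof. by rewrite /halvings big_ord_recr. Qed.

Lemma halvingsM l i : halvings (k.+1 * l)%N i = l.
Proof.
have h j t : (t <= k.+1)%N -> halvings (k.+1 * j + t) i = (halvings (k.+1 * j) i + (i < t))%N.
  elim: t => [|t ih] tk; first by rewrite addn0 ltn0 addn0.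
  rewrite addnS halvingsS ih ?(ltnW tk)// mulnC modnMDl modn_small// -addnA; congr addn.
  by rewrite ltnS [in RHS]leq_eqVlt eq_sym; case: ltngtP.
elim: l => [|l ih]; first by rewrite muln0 /halvings big_ord0.
by rewrite mulnS addnC h// ih ltn_ord addn1.
Qed.

Definition dyadic_side j i : R := S / 2 ^+ halvings j i.

Lemma dyadic_side_gt0 j i : 0 < dyadic_side j i.
Proof. by rewrite divr_gt0// exprn_gt0. Qed.

Lemma dyadic_sideS j i :
  dyadic_side j.+1 i = (if (j %% k.+1 == i)%N then dyadic_side j i / 2 else dyadic_side j i).
Proof.
rewrite /dyadic_side halvingsS; case: ifP => _; last by rewrite addn0.
by rewrite addn1 exprS invfM mulrA mulrAC.
Qed.

(* Bit lists are read from the right: the head is the most recent choice. *)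
Fixpoint dyadic_corner (b : seq bool) : 'rV[R]_k.+1 :=
  if b is c :: b' then \row_i (dyadic_corner b' ord0 i +
    (if c && (size b' %% k.+1 == i)%N then dyadic_side (size b).-1 i / 2 else 0))
  else a.

Definition dyadic_box b : set 'rV[R]_k.+1 := [set x | forall i,
  dyadic_corner b ord0 i <= x ord0 i < dyadic_corner b ord0 i + dyadic_side (size b) i].

Lemma dyadic_corner_box b : dyadic_box b (dyadic_corner b).
Proof. by move=> i; rewrite lexx ltrDl dyadic_side_gt0. Qed.

Lemma dyadic_box_cons c b x : dyadic_box (c :: b) x -> dyadic_box b x.
Proof.
move=> h i; have := h i; rewrite /= !mxE dyadic_sideS; have := dyadic_side_gt0 (size b) i.
by case: c h => h /=; case: ifP => _ ? /andP[? ?]; apply/andP; split; lra.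
Qed.

Lemma dyadic_box_split b x : dyadic_box b x -> exists c, dyadic_box (c :: b) x.
Proof.
move=> h; pose i0 : 'I_k.+1 := Ordinal (ltn_pmod (size b) (ltn0Sn k)).
have i0P (i : 'I_k.+1) : (size b %% k.+1 == i)%N = (i == i0 :> 'I_k.+1) by rewrite eq_sym.
exists (dyadic_corner b ord0 i0 + dyadic_side (size b) i0 / 2 <= x ord0 i0) => i.
have := h i; rewrite /= !mxE dyadic_sideS i0P; have := dyadic_side_gt0 (size b) i.
case: (eqVneq i i0) => [->|ii0]; last by rewrite andbF => ? /andP[? ?]; apply/andP; split; lra.
rewrite andbT; case: (lerP (dyadic_corner b ord0 i0 + dyadic_side (size b) i0 / 2) (x ord0 i0)).
  by move=> /= ? ? /andP[? ?]; apply/andP; split; lra.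
by move=> /= ? ? /andP[? ?]; apply/andP; split; lra.
Qed.

Lemma dyadic_box_inj b b' x : size b = size b' -> dyadic_box b x -> dyadic_box b' x -> b = b'.
Proof.
elim: b b' => [|c b ih] [|c' b'] //= [sb] h h'.
have bb' := ih _ sb (dyadic_box_cons h) (dyadic_box_cons h'); subst b'; congr (_ :: _).
pose i0 : 'I_k.+1 := Ordinal (ltn_pmod (size b) (ltn0Sn k)).
have := h i0; have := h' i0; rewrite /= !mxE dyadic_sideS eqxx.
have := dyadic_side_gt0 (size b) i0.
by clear; case: c; case: c' => //= ? /andP[? ?] /andP[? ?]; exfalso; lra.
Qed.

Variable w : seq bool -> R.
Hypothesis w_ge0 : forall b, 0 <= w b.
Hypothesis w_le : forall b, w b <= w (false :: b) + w (true :: b).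

(* Left end point and length of the subinterval of [0, w [::][ assigned to a
   box; each interval is cut in proportion to the weights of the two halves. *)
Fixpoint cell (b : seq bool) : R * R :=
  if b is c :: b' then
    let d := (cell b').2 * (w (false :: b') / (w (false :: b') + w (true :: b'))) in
    if c then ((cell b').1 + d, (cell b').2 - d) else ((cell b').1, d)
  else (0, w [::]).

(** The length of a cell is at most the weight of its box, hence at most the sum of the two
    half-weights; a proportional cut then leaves each part below its own weight. *)
Lemma cell_len b : 0 <= (cell b).2 <= w b.
Proof.
elim: b => [|c b /andP[l0 lw]] /=; first by rewrite w_ge0 lexx.
have := w_le b; have := w_ge0 (false :: b); have := w_ge0 (true :: b).
have -> : w (c :: b) = if c then w (true :: b) else w (false :: b) by case: c.
move: (w (true :: b)) (w (false :: b)) => x y x0 y0 wxy.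
(* If both halves have weight zero the parent cell is empty, so the division by zero in [cell] is
   harmless. *)
have [xy0|xy0] := eqVneq (y + x) 0.
  have -> : (cell b).2 = 0 by apply/eqP; rewrite eq_le l0 andbT (le_trans lw)// (le_trans wxy)// xy0.
  by rewrite mul0r subrr; case: c; rewrite /= lexx.
have xyp : 0 < y + x by rewrite lt_neqAle eq_sym xy0 addr_ge0.
have lxy : (cell b).2 / (y + x) <= 1.
  by rewrite ler_pdivrMr// mul1r (le_trans lw).
have lxy0 : 0 <= (cell b).2 / (y + x) by rewrite divr_ge0// ltW.
have -> : (cell b).2 * (y / (y + x)) = (cell b).2 / (y + x) * y by rewrite mulrCA mulrC.
case: c => /=; last by rewrite mulr_ge0//= ler_piMl.
have -> : (cell b).2 - (cell b).2 / (y + x) * y = (cell b).2 / (y + x) * x.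
  by field.
by rewrite mulr_ge0//= ler_piMl.
Qed.

(** Follows the cells that contain [u]: the new bit tells whether [u] lies beyond the left part of
    the current cell. *)
Fixpoint address j (u : R) : seq bool :=
  if j is j'.+1 then
    ((cell (false :: address j' u)).1 + (cell (false :: address j' u)).2 <= u) :: address j' u
  else [::].

Lemma size_address j u : size (address j u) = j.
Proof. by elim: j => //= j ->. Qed.

Lemma address_cell j u : 0 <= u < w [::] ->
  (cell (address j u)).1 <= u < (cell (address j u)).1 + (cell (address j u)).2.
Proof.
move=> u0; elim: j => [|j]; first by rewrite /= add0r.
rewrite [address j.+1 u]/=; set b := address j u => /andP[h1 h2].
case: (lerP ((cell (false :: b)).1 + (cell (false :: b)).2) u) => /= h3; last by rewrite h1 h3.
by move: h2 h3; move: (_ * _) => y h2 h3; apply/andP; split => //; lra.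
Qed.

(** General in [F] because the point with which [u] is compared depends on the address: in the
    induction step it is itself such an [F]. *)
Lemma measurable_address j (F : seq bool -> R) :
  measurable_fun setT (fun u : measurableTypeR R => F (address j u)).
Proof.
elim: j F => [|j ih] F /=; first exact: measurable_cst.
pose mid b := (cell (false :: b)).1 + (cell (false :: b)).2.
have -> : (fun u : measurableTypeR R => F ((mid (address j u) <= u) :: address j u)) =
    (fun u => if mid (address j u) <= u then F (true :: address j u) else F (false :: address j u)).
  by apply/funext => u; case: ifP.
apply: measurable_fun_ifT.
- apply: (measurable_fun_ler (f := fun u => mid (address j u)) (g := id)); last exact: measurable_id.
  exact: (ih mid).
- exact: (ih (fun b => F (true :: b))).
- exact: (ih (fun b => F (false :: b))).
Qed.

Lemma address_box j m u : dyadic_box (address j u) (dyadic_corner (address (m + j) u)).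
Proof.
suff : dyadic_box (address (m + j) u) `<=` dyadic_box (address j u).
  by apply; exact: dyadic_corner_box.
elim: m => [|m ih] // x; rewrite addSn => /dyadic_box_cons; exact: ih.
Qed.

Lemma corner_nd u i : nondecreasing_seq (fun j => dyadic_corner (address j u) ord0 i).
Proof.
apply/nondecreasing_seqP => j.
by have /andP[] := @address_box j 1 u i.
Qed.

Definition limit_point u : 'rV[R]_k.+1 :=
  \row_i limn (fun j => dyadic_corner (address j u) ord0 i).

Lemma corner_cvg u i :
  (fun j => dyadic_corner (address j u) ord0 i) @ \oo --> limit_point u ord0 i.
Proof.
rewrite mxE; apply: nondecreasing_is_cvgn; first exact: corner_nd.
exists (a ord0 i + S) => _ [j _ <-].
have /andP[_ /ltW] := @address_box 0 j u i.
by rewrite addn0 /dyadic_side /halvings big_ord0 divr1.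
Qed.

(** Closed on the right: the limit of the corners may lie on an upper face, outside the half-open
    boxes. *)
Lemma limit_point_itv j u i :
  dyadic_corner (address j u) ord0 i <= limit_point u ord0 i <=
  dyadic_corner (address j u) ord0 i + dyadic_side j i.
Proof.
have c := @corner_cvg u i; apply/andP; split.
  rewrite -(cvg_lim _ c)//; apply: (nondecreasing_cvgn_le (corner_nd u i)).
  by apply/cvg_ex; eexists; exact: c.
rewrite -(cvg_lim _ c)//; apply: limr_le; first by apply/cvg_ex; eexists; exact: c.
near=> m; have jm : (j <= m)%N by near: m; exists j.
by have /andP[_ /ltW] := @address_box j (m - j) u i; rewrite subnK// size_address.
Unshelve. all: by end_near. Qed.

Lemma measurable_limit_point :
  measurable_fun setT (limit_point : measurableTypeR R -> borel 'rV[R]_k.+1).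
Proof.
apply: measurable_fun_matrix => i j; rewrite (ord1 i).
apply: (@measurable_fun_cvg _ _ _ setT (fun l u => dyadic_corner (address l u) ord0 j)).
  by move=> l; exact: (measurable_address l (fun b => dyadic_corner b ord0 j)).
by move=> u _; exact: corner_cvg.
Qed.

End dyadic_boxes.

Section frostman_measure.
Context {R : realType} {k : nat}.
Local Notation V := (borel 'rV[R]_k.+1).
Local Notation leb := (@lebesgue_measure R).
Variables (E : set 'rV[R]_k.+1) (cap : set 'rV[R]_k.+1 -> \bar R) (a : 'rV[R]_k.+1) (S G s : R).
Hypothesis cE : closed E.
Hypothesis cap0 : cap set0 = 0%E.
Hypothesis cap_ge0 : forall A, (0 <= cap A)%E.
Hypothesis cap_le : forall A B, A `<=` B -> (cap A <= cap B)%E.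
Hypothesis capU : forall A B, (cap (A `|` B) <= cap A + cap B)%E.
Hypotheses (S0 : 0 < S) (G0 : 0 <= G) (s0 : 0 <= s).
Hypothesis cap_cube : forall x h, 0 < h <= S ->
  (cap (E `&` [set y : 'rV[R]_k.+1 | forall i, ((x : 'rV[R]_k.+1) ord0 i <= y ord0 i < x ord0 i + h)%R])
    <= (G * h `^ s)%:E)%E.

Local Notation box := (dyadic_box a S).
Let w (b : seq bool) : R := fine (cap (E `&` box b)).
Let phi := limit_point a S w.

Let cap_fin b : cap (E `&` box b) \is a fin_num.
Proof.
rewrite ge0_fin_numE//; apply: le_lt_trans (ltry (G * S `^ s)).
apply: le_trans (cap_cube a (h := S) _); last by rewrite S0 lexx.
apply: cap_le => x [Ex bx]; split => //.
elim: b bx => [|c b ih]; last by move/(dyadic_box_cons S0).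
by move=> h i; have := h i; rewrite /dyadic_side /halvings big_ord0 divr1.
Qed.

Let w_ge0 b : 0 <= w b. Proof. by rewrite fine_ge0. Qed.

Let w_le b : w b <= w (false :: b) + w (true :: b).
Proof.
rewrite -lee_fin EFinD /w !fineK//; apply: le_trans (capU _ _).
apply: cap_le => x [Ex /(dyadic_box_split S0)[c xc]].
by case: c xc => xc; [right|left].
Qed.

Let w_gt0 b : 0 < w b -> exists2 x, E x & box b x.
Proof.
move=> wb; apply: contrapT => no; move: wb; rewrite /w.
rewrite (_ : _ `&` _ = set0) ?cap0 ?ltxx//.
by apply/seteqP; split => x // [Ex bx]; apply: no; exists x.
Qed.

(** Each box on the branch of [u] has a cell of positive length, hence positive weight, hence meets
    [E]; the boxes shrink to [phi u] and [E] is closed. *)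
Let phiE u : 0 <= u < w [::] -> E (phi u).
Proof.
move=> u0; apply: cE => B /nbhs_ballP[e /= e0 eB].
have [l le] : exists l : nat, S / 2 ^+ l < e.
  exists (Num.truncn (S / e)).+1; rewrite ltr_pdivrMr ?exprn_gt0// mulrC -ltr_pdivrMr//.
  by apply: lt_le_trans (truncnS_gt _) _; rewrite -natrX ler_nat ltnW// ltn_expl.
have := address_cell (w := w) (k.+1 * l) u0; set b := address _ _ _ => /andP[u1 u2].
have : 0 < w b by have /andP[_] := cell_len w_ge0 w_le b; apply: lt_le_trans; lra.
move=> /w_gt0[x Ex bx]; exists x; split => //; apply: eB.
rewrite -ball_normE /=; apply: le_lt_trans le.
have Sl : 0 <= S / 2 ^+ l by rewrite divr_ge0 ?exprn_ge0// ltW.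
apply/(cube_norm _ Sl)/cubeE => i; rewrite !mxE.
have := bx i; have := limit_point_itv a S0 w (k.+1 * l) u i.
rewrite -/phi -/b size_address /dyadic_side halvingsM !mxE => /andP[? ?] /andP[? ?].
by rewrite ler_norml; apply/andP; split; lra.
Qed.

(** Boxes of one level are disjoint, so all such [u] have the same address and lie in a single cell,
    whose length is at most the weight of a cube of side S / 2^j. *)
Let cell_measure_le j p : exists2 B : set (measurableTypeR R), measurable B &
  [/\ (leb B <= (G * (S / 2 ^+ j) `^ s)%:E)%E &
  forall u, 0 <= u < w [::] -> box (address w (k.+1 * j) u) p -> B u].
Proof.
have [[b [sb bp]]|no] := pselect (exists b, size b = (k.+1 * j)%N /\ box b p); last first.
  exists set0 => //; split; first by rewrite measure0 lee_fin mulr_ge0// powR_ge0.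
  by move=> u _ up; apply: no; exists (address w (k.+1 * j) u); rewrite size_address.
exists `[(cell w b).1, (cell w b).1 + (cell w b).2[%classic; first exact: measurable_itv.
have Sj : 0 < S / 2 ^+ j <= S.
  by rewrite divr_gt0 ?exprn_gt0//= ler_pdivrMr ?exprn_gt0// ler_peMr ?(ltW S0)// exprn_ege1// ler1n.
have /andP[l0 lw] := cell_len w_ge0 w_le b.
split.
  rewrite lebesgue_measure_itv/= lte_fin ltrDl.
  case: ifP => _; last by rewrite lee_fin mulr_ge0// powR_ge0.
  rewrite -EFinB addrAC subrr add0r; apply: (@le_trans _ _ (w b)%:E); first by rewrite lee_fin.
  rewrite /w fineK//; apply: le_trans (cap_cube (dyadic_corner a S b) Sj).
  apply: cap_le => x [Ex bx]; split => // i.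
  by have := bx i; rewrite /dyadic_side sb halvingsM.
move=> u u0 up; have := address_cell (w := w) (k.+1 * j) u0.
by rewrite (dyadic_box_inj S0 _ up bp) ?size_address ?sb// /= in_itv.
Qed.

Let mphi : measurable_fun setT (phi : measurableTypeR R -> V).
Proof. exact: measurable_limit_point S0 w. Qed.

Let mass : {measure set (measurableTypeR R) -> \bar R} :=
  mrestr leb (measurable_itv `[0, w [::][).

Let mass_lty : (mass setT < +oo)%E.
Proof.
rewrite /mass /= /mrestr setTI lebesgue_measure_itv/= lte_fin; case: ifP => _ //.
by rewrite -EFinB ltry.
Qed.

(** [mu] is the image of Lebesgue measure on [[0, w [::][] under [phi]: an explicit measure, where
    the usual proof takes a weak limit. *)
Lemma frostman_measure : 0 < w [::] -> exists mu : {finite_measure set V -> \bar R},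
  [/\ mu setT != 0%E, mu (~` E) = 0%E & exists C, frostman mu C s].
Proof.
move=> w0; pose mu : {finite_measure set V -> \bar R} := law (fin_measure mass_lty) mphi.
have muE A : mu A = leb (phi @^-1` A `&` `[0, w [::][) by [].
have muT : mu setT = (w [::])%:E.
  by rewrite muE preimage_setT setTI lebesgue_measure_itv/= lte_fin w0 -EFinB subr0.
exists mu; split; first by rewrite muT eqe gt_eqF.
  rewrite muE (_ : _ `&` _ = set0) ?measure0//; apply/seteqP; split => u //= [nE].
  by rewrite in_itv/= => /phiE.
(* The first term serves radii below [S], the second, total mass over S^s, the larger ones. *)
pose H := G * 2 `^ s * 3 ^+ k.+1 + w [::] / S `^ s.
have Ss : 0 < S `^ s by rewrite powR_gt0.
have wS : 0 <= w [::] / S `^ s by rewrite divr_ge0// ltW.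
have G3 : 0 <= G * 2 `^ s * 3 ^+ k.+1 by rewrite !mulr_ge0// powR_ge0.
exists H => x r /andP[r0 r1]; set A := [set y | _].
have mA : measurable (A : set V) by exact: measurable_translated_cube.
have [Sr|rS] := lerP S r.
  apply: (@le_trans _ _ (mu setT)); first by apply: le_measure; rewrite ?inE.
  rewrite muT lee_fin /H mulrDl -[leLHS]add0r lerD ?mulr_ge0 ?powR_ge0//.
  rewrite mulrAC ler_pdivlMr// ler_wpM2l// ge0_ler_powR// nnegrE ltW//.
have [l lr lr'] : exists2 l : nat, S / 2 ^+ l.+1 <= r & r < S / 2 ^+ l.
  have ex : exists l : nat, S / 2 ^+ l.+1 <= r.
    exists (Num.truncn (S / r)); rewrite ler_pdivrMr ?exprn_gt0// mulrC -ler_pdivrMr//.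
    apply: ltW; apply: lt_le_trans (truncnS_gt _) _; rewrite -natrX ler_nat ltnW// ltn_expl//.
  case: (ex_minnP ex) => l lr lmin; exists l => //.
  case: l lr lmin => [|l] lr lmin; first by rewrite divr1.
  by rewrite ltNge; apply/negP => /lmin; rewrite ltnn.
pose h := S / 2 ^+ l.
have hr : h <= 2 * r by move: lr; rewrite exprS invfM mulrCA ler_pdivrMl.
have h0 : 0 < h by rewrite divr_gt0// exprn_gt0.
have rh : r < h by [].
(* A half-open box of side [h > r] whose closure meets the cube of radius [r] about [x] contains one
   of the points obtained by moving each coordinate of [x] by -h, 0 or h. *)
pose p (f : {ffun 'I_k.+1 -> 'I_3}) : 'rV[R]_k.+1 := \row_i (x ord0 i + ((f i)%:R - 1) * h).
have /choice[B hB] : forall f, exists B : set (measurableTypeR R), measurable B /\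
  ((leb B <= (G * h `^ s)%:E)%E /\
  forall u, 0 <= u < w [::] -> box (address w (k.+1 * l) u) (p f) -> B u).
  by move=> f; have [B mB [B1 B2]] := cell_measure_le l (p f); exists B.
apply: (@le_trans _ _ (\sum_f leb (B f))%E).
  rewrite [X in (X <= _)%E]muE; apply: measure_fin_cover => [| |u [/= /cubeE Au]].
  - apply: measurableI; last exact: measurable_itv.
    by have := mphi measurableT mA; rewrite setTI.
  - by move=> f; have [] := hB f.
  rewrite in_itv/= => u0; pose b := address w (k.+1 * l) u.
  have bu i : dyadic_corner a S b ord0 i <= phi u ord0 i <= dyadic_corner a S b ord0 i + h.
    by have := limit_point_itv a S0 w (k.+1 * l) u i; rewrite /dyadic_side halvingsM.
  pose c i := dyadic_corner a S b ord0 i.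
  pose f : {ffun 'I_k.+1 -> 'I_3} := [ffun i =>
    if x ord0 i < c i then inord 2 else if x ord0 i < c i + h then inord 1 else inord 0].
  exists f => //; have [_ [_ Bf]] := hB f; apply: Bf => // i.
  rewrite !mxE ffunE size_address /dyadic_side halvingsM -/b -/(c i) -/h.
  have := Au i; have := bu i; rewrite -/(c i) !mxE ler_distl => /andP[? ?] /andP[? ?].
  case: (ltrP (x ord0 i) (c i)) => ?; first by rewrite inordK//; apply/andP; split; lra.
  by case: (ltrP (x ord0 i) (c i + h)) => ?; rewrite inordK//; apply/andP; split; lra.
apply: (@le_trans _ _ (\sum_(f : {ffun 'I_k.+1 -> 'I_3}) (G * h `^ s)%:E)%E).
  by apply: lee_sum => f _; have [_ []] := hB f.
rewrite sumEFin lee_fin sumr_const card_ffun !card_ord /H mulrDl.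
apply: (@le_trans _ _ (G * 2 `^ s * 3 ^+ k.+1 * r `^ s)); last by rewrite lerDl mulr_ge0// powR_ge0.
have hs : h `^ s <= 2 `^ s * r `^ s.
  by rewrite -powRM// ?(ltW r0)// ge0_ler_powR// nnegrE ltW// mulr_gt0.
rewrite -[leLHS]mulr_natr natrX [leRHS](_ : _ = G * (2 `^ s * r `^ s) * 3 ^+ k.+1); last by ring.
by rewrite ler_wpM2r// ler_wpM2l.
Qed.

End frostman_measure.

Section frostman_exists.
Context {R : realType} {k : nat}.
Local Notation V := (borel 'rV[R]_k.+1).
Implicit Types (A B E : set 'rV[R]_k.+1) (s e : R).

Lemma cover_outerU s e A B : (cover_outer (diam_gauge s e) (A `|` B) <=
  cover_outer (diam_gauge s e) A + cover_outer (diam_gauge s e) B)%E.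
Proof.
pose m : {outer_measure set 'rV[R]_k.+1 -> \bar R} := HB.pack (cover_outer (diam_gauge s e))
  (isOuterMeasure.Build R 'rV[R]_k.+1 (cover_outer (diam_gauge s e))
  (cover_outer0 (diam_gauge0 s e) (diam_gauge_ge0 s e)) (cover_outer_ge0 (diam_gauge_ge0 s e))
  (@le_cover_outer _ _ (diam_gauge s e)) (cover_outer_sigma_subadditive (diam_gauge_ge0 s e))).
exact: (outer_measureU2 m).
Qed.

(** The content at scale [e] is bounded by covering a cube with itself, which has finite gauge when
    its diameter is at most [e]. So the construction starts from a dyadic box that is small enough
    for this and in which [E] still has positive content. *)
Lemma frostman_exists E s : closed E -> (forall x, E x -> forall i, 0 <= x ord0 i <= 1) ->
  0 <= s -> hausdorff_measure k.+1 s E != 0%E ->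
  exists mu : {finite_measure set V -> \bar R},
    [/\ mu setT != 0%E, mu (~` E) = 0%E & exists C, frostman mu C s].
Proof.
move=> cE E01 s0 HE.
have [e e0 capE] : exists2 e : R, 0 < e & (0 < cover_outer (diam_gauge s e) E)%E.
  apply: contrapT => no; move/eqP : HE; apply; apply/eqP; rewrite eq_le measure_ge0 andbT.
  apply: ge_ereal_sup => _ [e /= e0 <-]; rewrite leNgt; apply/negP => h.
  by apply: no; exists e.
pose cap := cover_outer (@diam_gauge R k.+1 s e).
have cap0 : cap set0 = 0%E by exact: cover_outer0 (diam_gauge0 s e) (diam_gauge_ge0 s e).
have cap_ge0 A : (0 <= cap A)%E by exact: cover_outer_ge0 (diam_gauge_ge0 s e) A.
have cap_le A B : A `<=` B -> (cap A <= cap B)%E by exact: le_cover_outer.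
have capU A B : (cap (A `|` B) <= cap A + cap B)%E by exact: cover_outerU.
(* Side 2, because a half-open box of side 1 at the origin would miss the points with a coordinate
   equal to 1. By subadditivity one of the two halves always keeps positive content. *)
have deep j : exists b, size b = j /\ (0 < cap (E `&` dyadic_box 0 2 b))%E.
  elim: j => [|j [b [bj cb]]].
    exists [::]; split => //; apply: lt_le_trans capE _; apply: cap_le => x Ex; split => // i.
    rewrite /= mxE /dyadic_side /halvings big_ord0 divr1.
    by have := E01 x Ex i => /andP[? ?]; apply/andP; split; lra.
  have : (0 < cap (E `&` dyadic_box 0 2 (false :: b)) + cap (E `&` dyadic_box 0 2 (true :: b)))%E.
    apply: lt_le_trans cb _; apply: le_trans (capU _ _); apply: cap_le => x [Ex].
    have S0 : 0 < 2 :> R by [].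
    by move=> /(dyadic_box_split S0)[[] xc]; [right|left].
  have [cf _|cf] := ltP 0%E (cap (E `&` dyadic_box 0 2 (false :: b))).
    by exists (false :: b); rewrite /= bj.
  have [ct _|ct] := ltP 0%E (cap (E `&` dyadic_box 0 2 (true :: b))).
    by exists (true :: b); rewrite /= bj.
  by rewrite ltNge (le_trans (leeD cf ct))// adde0.
have k0 : 0 < k.+1%:R :> R by rewrite ltr0n.
have [l le] : exists l : nat, k.+1%:R * (2 / 2 ^+ l) <= e.
  exists (Num.truncn (k.+1%:R * 2 / e)); rewrite mulrA ler_pdivrMr ?exprn_gt0// (mulrC e) -ler_pdivrMr//.
  apply: ltW; apply: lt_le_trans (truncnS_gt _) _; rewrite -natrX ler_nat ltn_expl//.
have [b [bl cb]] := deep (k.+1 * l)%N.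
pose S : R := 2 / 2 ^+ l; have S0 : 0 < S by rewrite divr_gt0// exprn_gt0.
have cap_cube (x : 'rV[R]_k.+1) h : 0 < h <= S ->
    (cap (E `&` [set y : 'rV[R]_k.+1 | forall i, (x ord0 i <= y ord0 i < x ord0 i + h)%R])
      <= (k.+1%:R `^ s * h `^ s)%:E)%E.
  move=> /andP[h0 hS]; apply: (@le_trans _ _ (diam_gauge s e (E `&`
      [set y : 'rV[R]_k.+1 | forall i, (x ord0 i <= y ord0 i < x ord0 i + h)%R]))).
    exact: cover_outer_le (diam_gauge0 s e) (diam_gauge_ge0 s e) _.
  rewrite -powRM ?(ltW h0)//; apply: diam_gauge_le => //.
  + by apply: le_trans le; rewrite ler_wpM2l.
  + by rewrite mulr_ge0// ltW.
  apply: ediam_le => y z [_ hy] [_ hz]; apply/(cube_norm _ (ltW h0))/cubeE => i.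
  have /andP[? ?] := hy i; have /andP[? ?] := hz i.
  by rewrite !mxE ler_norml; apply/andP; split; lra.
apply: (@frostman_measure R k E cap (dyadic_corner 0 2 b) S (k.+1%:R `^ s) s) => //.
have -> : dyadic_box (dyadic_corner (0 : 'rV[R]_k.+1) 2 b) S [::] = dyadic_box 0 2 b.
  by apply/seteqP; split => x h i; have := h i;
    rewrite /dyadic_side bl halvingsM /halvings big_ord0 divr1.
rewrite fine_gt0// cb/=; apply: le_lt_trans (ltry (k.+1%:R `^ s * S `^ s)).
apply: le_trans (cap_cube (dyadic_corner 0 2 b) S _); last by rewrite S0 lexx.
apply: cap_le => x [Ex bx]; split => // i.
by have := bx i; rewrite /dyadic_side bl halvingsM.
Qed.

Lemma hausdorff_dim_gt E s : 0 <= s -> (s%:E < hausdorff_dim E)%E -> hausdorff_measure k.+1 s E != 0%E.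
Proof.
move=> s0 sE; apply/eqP => HE; move: sE; rewrite ltNge => /negP; apply.
by apply: ereal_inf_lbound; exists s.
Qed.

End frostman_exists.

(** * Summation over dyadic shells *)

Lemma nneseries_le_bound (R : realType) (u : nat -> \bar R) B : (forall j, 0 <= u j)%E ->
  (forall N, \sum_(0 <= j < N) u j <= B)%E -> (\sum_(j <oo) u j <= B)%E.
Proof.
move=> u0 uB; apply: lime_le; last by apply: nearW => N; exact: uB.
by apply: is_cvg_nneseries => *; exact: u0.
Qed.

Lemma geometric_sum_le (R : realType) (q : R) N : 0 <= q < 1 ->
  \sum_(0 <= j < N) q ^+ j <= (1 - q)^-1.
Proof.
move=> /andP[q0 q1]; have p0 : 0 < 1 - q by rewrite subr_gt0.
suff -> : \sum_(0 <= j < N) q ^+ j = (1 - q)^-1 - q ^+ N / (1 - q).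
  by rewrite gerBl divr_ge0 ?exprn_ge0// ltW.
elim: N => [|N ih]; first by rewrite big_nil expr0 mul1r subrr.
by rewrite big_nat_recr//= ih exprS; field; rewrite gt_eqF.
Qed.

Section dyadic_energy.
Context {R : realType} {n : nat}.
Local Notation V := (borel 'rV[R]_n).
Local Notation lambda := (lebesgue_rV R n).
Variable mu : {finite_measure set V -> \bar R}.

Let phi (xi : 'rV[R]_n) := Normc.normc (fourier mu xi) ^+ 2.
Local Notation F := (ball_energy (diff_law mu mu)).

Let phi0 xi : 0 <= phi xi. Proof. exact: sqr_ge0. Qed.

Let mphi : measurable_fun setT (phi : V -> R).
Proof. by apply: measurable_funX; exact: measurable_normc_fourier. Qed.

Let FE r : F r = (\int[lambda]_(xi in cube r) (phi xi)%:E)%E.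
Proof. by apply: eq_integral => xi _; rewrite cosft_diff_law_self /phi normc_fourier2. Qed.

Lemma ball_energy_ge0 r : (0 <= F r)%E.
Proof. by rewrite FE; apply: integral_ge0 => xi _; rewrite lee_fin. Qed.

Lemma ball_energy_lty r : 0 <= r -> (F r < +oo)%E.
Proof.
move=> r0; have mc : measurable (cube r : set V) by exact: measurable_cube.
apply: (@le_lt_trans _ _ (\int[lambda]_(xi in cube r) (fine (diff_law mu mu setT))%:E)%E).
  apply: ge0_le_integral => //.
  - by move=> xi _; rewrite lee_fin cosft_diff_law_self -normc_fourier2 sqr_ge0.
  - by apply: measurable_funTS; apply/measurable_EFinP; exact: measurable_cosft.
  - by move=> xi _; rewrite lee_fin; apply: le_trans (ler_norm _) (cosft_le _ _).
rewrite integral_cst// [X in (_ * X)%E]lebesgue_rV_cube// -EFinM; exact: ltry.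
Qed.

Lemma ball_energy_scale j r : 0 < r -> (F (2 ^+ j * r) <= ((34 ^+ n) ^+ j)%:E * F r)%E.
Proof.
move=> r0; elim: j => [|j ih]; first by rewrite !expr0 mul1r mul1e.
have j0 : 0 < 2 ^+ j * r by rewrite mulr_gt0// exprn_gt0.
have h xi : 0 <= cosft (diff_law mu mu) xi by rewrite cosft_diff_law_self -normc_fourier2 sqr_ge0.
rewrite exprS -mulrA mulr_natl; apply: le_trans (ball_energy_doubling h j0) _.
by rewrite exprS EFinM -muleA lee_wpmul2l// lee_fin exprn_ge0.
Qed.

(** A point outside [cube (2 ^+ p)] lies between two successive dyadic cubes, where [g j] bounds
    [W]; each shell is then enlarged to its outer cube. The offset [p] leaves room for comparing
    dilations in the convex case. *)
Lemma dyadic_energy_le p S (g : nat -> R) (W : V -> \bar R) :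
  measurable_fun setT W -> (forall xi, 0 <= W xi)%E -> 0 <= S -> (forall j, 0 <= g j) ->
  (forall xi, W xi <= S%:E)%E ->
  (forall j xi, ~ cube (2 ^+ (p + j)) xi -> W xi <= (g j)%:E)%E ->
  (\int[lambda]_xi ((phi xi)%:E * W xi) <=
    S%:E * F (2 ^+ p) + \sum_(j <oo) (g j)%:E * F (2 ^+ (p + j.+1)))%E.
Proof.
move=> mW W0 S0 g0 WS Wg.
pose pr r : V -> \bar R := (fun xi : V => (phi xi)%:E) \_ (cube r).
pose h j (xi : V) : \bar R := ((g j)%:E * (pr (2 ^+ (p + j.+1))%R) xi)%E.
pose h0 (xi : V) : \bar R := (S%:E * (pr (2 ^+ p)%R) xi)%E.
have mr r : measurable_fun setT (pr r).
  apply/(measurable_restrictT _ _).1; first exact: measurable_cube.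
  by apply: measurable_funTS; exact/measurable_EFinP.
have r0 r xi : (0 <= (pr r) xi)%E.
  by rewrite /pr patchE; case: ifP => // _; rewrite lee_fin.
have mh j : measurable_fun setT (h j) by exact: measurable_funeM.
have mh0 : measurable_fun setT h0 by exact: measurable_funeM.
have hj0 j xi : (0 <= h j xi)%E by rewrite mule_ge0// lee_fin.
have h00 xi : (0 <= h0 xi)%E by rewrite mule_ge0// lee_fin.
have Fr c r : 0 <= c -> (\int[lambda]_xi (c%:E * (pr r) xi) = c%:E * F r)%E.
  by move=> c0; rewrite ge0_integralZl_EFin// FE [in RHS]integral_mkcond.
rewrite -Fr// (eq_eseriesr (g := fun j => \int[lambda]_xi h j xi)%E); last by move=> j _; rewrite -Fr.
rewrite -integral_nneseries// -ge0_integralD//; last 3 first.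
- by move=> xi _; exact: h00.
- by move=> xi _; apply: nneseries_ge0.
- exact: ge0_emeasurable_sum.
apply: ge0_le_integral => //.
- by move=> xi _; rewrite mule_ge0// lee_fin.
- by apply: emeasurable_funM => //; exact/measurable_EFinP.
- apply: emeasurable_funD => //; exact: ge0_emeasurable_sum.
move=> xi _; have [xp|xp] := pselect (cube (2 ^+ p) xi).
  apply: (@le_trans _ _ (h0 xi)); last by rewrite leeDl// nneseries_ge0.
  by rewrite /h0 /pr patchE mem_set// muleC lee_wpmul2r// lee_fin.
have ex : exists j, `[< cube (2 ^+ (p + j) : R) xi >].
  have [r hr] : exists r : R, cube r xi by exists `|xi|; apply/cube_norm.
  exists (Num.truncn `|r|).+1; apply/asboolP; apply/cubeE => i; have /cubeE/(_ i) := hr.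
  move/le_trans; apply; apply: le_trans (ler_norm r) _; apply: ltW.
  apply: lt_le_trans (truncnS_gt _) _; rewrite -natrX ler_nat.
  by apply: (@leq_trans (2 ^ (Num.truncn `|r|).+1)); [exact/ltnW/ltn_expl|rewrite leq_exp2l// leq_addl].
case: (ex_minnP ex) => -[|j] /asboolP xj jmin; first by rewrite addn0 in xj.
have xj' : ~ cube (2 ^+ (p + j)) xi by move=> /asboolP /jmin; rewrite ltnn.
apply: (@le_trans _ _ (h j xi)).
  by rewrite /h /pr patchE mem_set// muleC lee_wpmul2r ?lee_fin// Wg.
apply: (@le_trans _ _ (\sum_(i <oo) h i xi)%E); last exact: (leeDr _ (h00 xi)).
apply: le_trans (nneseries_lim_ge j.+1 _) => //.
by rewrite big_nat_recr//= leeDr// sume_ge0.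
Qed.

End dyadic_energy.

Section averaged_energy.
Context {R : realType} {n : nat} {d : measure_display} {Omega : measurableType d}.
Local Notation V := (borel 'rV[R]_n).
Local Notation lambda := (lebesgue_rV R n).
Variables (mu sigma : {finite_measure set V -> \bar R}).
Variables (P : {finite_measure set Omega -> \bar R}) (f : Omega * V -> V).
Hypothesis mf : measurable_fun setT f.

Let phi (xi : 'rV[R]_n) := Normc.normc (fourier mu xi) ^+ 2.

(** The parameter [w] stands for a dilation, or for a dilation and a rotation. By Tonelli,
    integrating this average against the squared transform of [mu] integrates the energy over the
    parameters. *)
Definition averaged_fourier (xi : V) : \bar R := (\int[P]_w (Normc.normc (fourier sigma (f (w, xi))))%:E)%E.

Lemma averaged_fourier_ge0 xi : (0 <= averaged_fourier xi)%E.
Proof. by apply: integral_ge0 => w _; rewrite lee_fin normc_fourier_ge0. Qed.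

Let mF : measurable_fun setT (fun z => (Normc.normc (fourier sigma (f z)))%:E).
Proof. by apply/measurable_EFinP; apply: (measurableT_comp (measurable_normc_fourier sigma)). Qed.

Let F0 z : (0 <= (Normc.normc (fourier sigma (f z)))%:E)%E.
Proof. by rewrite lee_fin normc_fourier_ge0. Qed.

Lemma measurable_averaged_fourier : measurable_fun setT averaged_fourier.
Proof. exact: (@measurable_fun_fubini_tonelli_G _ _ Omega V R P _ mF F0). Qed.

Lemma averaged_fourier_le xi :
  (averaged_fourier xi <= (2 * fine (sigma setT))%:E * P setT)%E.
Proof.
rewrite -integral_cst//; apply: ge0_le_integral => //.
- by apply: measurableT_comp mF _; exact: pair2_measurable.
- by move=> w _; rewrite lee_fin normc_fourier_le.
Qed.

Lemma integral_averaged_fourier :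
  (\int[P]_w \int[lambda]_xi (phi xi * Normc.normc (fourier sigma (f (w, xi))))%:E =
   \int[lambda]_xi ((phi xi)%:E * averaged_fourier xi))%E.
Proof.
have mphi : measurable_fun setT (fun z : Omega * V => (phi z.2)%:E).
  apply/measurable_EFinP; apply: measurable_funX.
  exact: (measurableT_comp (measurable_normc_fourier mu)) measurable_snd.
have mG : measurable_fun setT (fun z : Omega * V => (phi z.2 * Normc.normc (fourier sigma (f z)))%:E).
  by under eq_fun do rewrite EFinM; exact: emeasurable_funM.
have G0 z : (0 <= (phi z.2 * Normc.normc (fourier sigma (f z)))%:E)%E.
  by rewrite lee_fin mulr_ge0 ?sqr_ge0// normc_fourier_ge0.
rewrite [LHS](@fubini_tonelli _ _ Omega V R P lambda _ mG G0).
apply: eq_integral => xi _ /=; under eq_integral do rewrite EFinM.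
rewrite ge0_integralZl_EFin ?sqr_ge0//.
by apply: measurableT_comp mF _; exact: pair2_measurable.
Qed.

End averaged_energy.

Lemma powR_exp2 (R : realType) j (x : R) : (2 ^+ j : R) `^ x = (2 `^ x) ^+ j.
Proof.
elim: j => [|j ih]; first by rewrite !expr0 powR1.
by rewrite !exprS powRM ?exprn_ge0// ih.
Qed.

(** The j-th shell contributes at most a constant times 2^((n - s - gamma) j), a geometric series of
    ratio [q < 1]; near the origin, where the power blows up, the bound [S] is used. *)
Lemma frostman_decay_lty (R : realType) n (mu : {finite_measure set (borel 'rV[R]_n) -> \bar R})
    (C s gamma B S : R) (W : borel 'rV[R]_n -> \bar R) :
  0 <= s -> frostman mu C s -> mu (~` [set x : 'rV[R]_n | forall i, 0 <= x ord0 i <= 1]) = 0%E ->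
  0 <= gamma -> n%:R - s < gamma -> 0 <= B -> 0 <= S ->
  measurable_fun setT W -> (forall xi, 0 <= W xi)%E -> (forall xi, W xi <= S%:E)%E ->
  (forall xi : 'rV[R]_n, xi != 0%R -> (W xi <= (B * `|xi| `^ (- gamma))%:E)%E) ->
  (\int[lebesgue_rV R n]_xi ((Normc.normc (fourier mu xi) ^+ 2)%:E * W xi) < +oo)%E.
Proof.
move=> s0 muC mu01 g0 ng B0 S0 mW W0 WS WB.
have [K K0 hK] := frostman_fourier s0 muC mu01.
pose g j : R := B * (2 ^+ j) `^ (- gamma).
have gj0 j : 0 <= g j by rewrite mulr_ge0 ?powR_ge0.
have Wg j (xi : 'rV[R]_n) : ~ cube (2 ^+ (0 + j)) xi -> (W xi <= (g j)%:E)%E.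
  rewrite add0n => h; have j0 : 0 < 2 ^+ j :> R by rewrite exprn_gt0.
  have xj : 2 ^+ j < `|xi|.
    by rewrite ltNge; apply/negP => /(cube_norm _ (ltW j0)).
  have xi0 : xi != 0 by rewrite -normr_gt0; exact: lt_trans xj.
  apply: (le_trans (WB _ xi0)); rewrite lee_fin /g ler_wpM2l// !powRN.
  by rewrite lef_pV2 ?posrE ?powR_gt0 ?normr_gt0// ge0_ler_powR ?nnegrE ?(ltW xj)// ltW.
have h := dyadic_energy_le mu (p := 0%N) mW W0 S0 gj0 WS Wg.
apply: (le_lt_trans h).
rewrite lte_add_pinfty//.
  by rewrite lte_mul_pinfty ?lee_fin// ball_energy_lty.
pose q : R := 2 `^ (n%:R - s - gamma).
have q01 : 0 <= q < 1.
  have e0 : n%:R - s - gamma < 0 by rewrite subr_lt0.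
  rewrite powR_ge0 lt_neqAle /q powR_eq1 -[leRHS](powRr0 2) ler_powR ?ler1n ?(ltW e0)//.
  by rewrite (lt_eqF e0) (_ : (2 == 1 :> R) = false) 1?(_ : (2 < 0 :> R) = false)//; lra.
pose D : R := B * K * 2 `^ (n%:R - s).
have D0 : 0 <= D by rewrite !mulr_ge0// powR_ge0.
apply: (@le_lt_trans _ _ (D * (1 - q)^-1)%:E); last exact: ltry.
apply: nneseries_le_bound => [j|N]; first by rewrite mule_ge0 ?lee_fin// ball_energy_ge0.
apply: (@le_trans _ _ (\sum_(0 <= j < N) (D * q ^+ j)%:E)%E).
  apply: lee_sum => j _; apply: (@le_trans _ _ ((g j)%:E * (K * (2 ^+ j.+1) `^ (n%:R - s))%:E)%E).
    rewrite lee_wpmul2l ?lee_fin// add0n; apply: hK.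
    by apply: exprn_ege1; rewrite ler1n.
  rewrite -EFinM lee_fin /g !powR_exp2 le_eqVlt; apply/orP; left; apply/eqP.
  have -> : q = 2 `^ (n%:R - s) * 2 `^ (- gamma) by rewrite -powRD ?pnatr_eq0 ?implybT.
  by rewrite /D exprMn exprS; ring.
rewrite sumEFin lee_fin -mulr_sumr ler_wpM2l//; exact: geometric_sum_le.
Qed.

(** * Pointwise decay of the Fourier transform *)

Section scales.
Context {R : realType}.
Local Notation leb := (@lebesgue_measure R).
Variable j : nat.

Let scales_lty : (mrestr leb (measurable_itv `[(j.+2%:R^-1 : R)%R, j.+2%:R%R]) setT < +oo)%E.
Proof. by rewrite /mrestr setTI lebesgue_measure_itv/=; case: ifP => // _; rewrite -EFinB ltry. Qed.

(** With [j.+2] even the first interval, [[1/2, 2]], is nondegenerate; together they exhaust the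
    positive half-line. *)
Definition scales : {finite_measure set (measurableTypeR R) -> \bar R} := fin_measure scales_lty.

Lemma ge0_integral_scales (f : measurableTypeR R -> \bar R) :
  measurable_fun setT f -> (forall x, 0 <= f x)%E ->
  (\int[scales]_t f t = \int[leb]_(t in `[(j.+2%:R^-1)%R, j.+2%:R%R]) f t)%E.
Proof. exact: ge0_integral_mrestr. Qed.

Lemma le_integral_scales (f : measurableTypeR R -> \bar R) (c : R) :
  measurable_fun setT f -> (forall t, 0 <= f t)%E -> 0 <= c ->
  (forall t : R, j.+2%:R^-1 <= t -> (f t <= c%:E)%E) ->
  (\int[scales]_t f t <= c%:E * scales setT)%E.
Proof.
move=> mf f0 c0 fc; rewrite ge0_integral_scales//.
have -> : scales setT = leb `[(j.+2%:R^-1)%R, j.+2%:R%R]%classic.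
  by rewrite /scales /fin_measure/= /mrestr setTI.
rewrite -integral_cst//; apply: ge0_le_integral => //.
- exact: measurable_funTS.
- by move=> t /=; rewrite in_itv/= => /andP[jt _]; exact: fc.
Qed.

End scales.

Lemma unit_cube0 (R : realType) n (x : 'rV[R]_n) : [set 0] x -> forall i, 0 <= x ord0 i <= 1.
Proof. by move=> -> i; rewrite mxE lexx ler01. Qed.

Lemma frostman_point (R : realType) k : exists mu : {finite_measure set (borel 'rV[R]_k.+1) -> \bar R},
  [/\ mu setT != 0%E, mu (~` [set 0]) = 0%E & frostman mu 1 0].
Proof.
have mu_lty : (@dirac _ (borel 'rV[R]_k.+1) (0 : 'rV[R]_k.+1)%R R setT < +oo)%E by rewrite diracT ltry.
pose mu : {finite_measure set (borel 'rV[R]_k.+1) -> \bar R} := fin_measure mu_lty.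
have mE (A : set (borel 'rV[R]_k.+1)) : mu A = (((0 : 'rV[R]_k.+1)%R \in A)%:R : R)%:E by exact: diracE.
exists mu; split.
- by rewrite mE mem_setT eqe oner_eq0.
- by rewrite mE memNset//= => h; exact: h.
- move=> x r _; rewrite powRr0 mulr1 [X in (X <= _)%E]mE lee_fin.
  by case: (_ \in _).
Qed.

Lemma null_unit_cubeC (R : realType) k (E : set 'rV[R]_k.+1)
    (mu : {finite_measure set (borel 'rV[R]_k.+1) -> \bar R}) :
  compact E -> (forall x, E x -> forall i, 0 <= x ord0 i <= 1) -> mu (~` E) = 0%E ->
  mu (~` [set x : 'rV[R]_k.+1 | forall i, 0 <= x ord0 i <= 1]) = 0%E.
Proof.
move=> cE E01 muE; apply/eqP; rewrite eq_le measure_ge0 andbT -[leRHS]muE.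
apply: le_measure; rewrite ?inE.
- apply: measurableC; rewrite (_ : mkset _ = cbox 0 (const_mx 1)); first exact: measurable_cbox.
  by apply/seteqP; split => x h i; have := h i; rewrite !mxE.
- by apply: measurableC; apply: closed_borel; apply: compact_closed => //; exact: norm_hausdorff.
- by move=> x h Ex; apply: h => i; exact: E01.
Qed.

Lemma frostman_above (R : realType) k (E : set 'rV[R]_k.+1) c :
  compact E -> (forall x, E x -> forall i, 0 <= x ord0 i <= 1) ->
  0 <= c -> (c%:E < hausdorff_dim E)%E ->
  exists s (mu : {finite_measure set (borel 'rV[R]_k.+1) -> \bar R}) C,
    [/\ 0 <= s, c < s, mu setT != 0%E, mu (~` E) = 0%E & frostman mu C s].
Proof.
move=> cE E01 c0 dE.
have [s [s0 cs sE]] : exists s : R, [/\ 0 <= s, c < s & (s%:E < hausdorff_dim E)%E].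
  case: (hausdorff_dim E) dE => [r| |] //.
    by rewrite lte_fin => h; exists ((c + r) / 2); rewrite lte_fin; split; lra.
  by move=> _; exists (c + 1); rewrite ltry; split => //; lra.
have [|mu [mu0 muE [C muC]]] := frostman_exists _ E01 s0 (hausdorff_dim_gt s0 sE).
  by apply: compact_closed => //; exact: norm_hausdorff.
by exists s, mu, C.
Qed.

Section gauge_distance_sets.
Context {R : realType} {k : nat}.
Local Notation V := (borel 'rV[R]_k.+1).
Local Notation leb := (@lebesgue_measure R).
Local Notation lambda := (lebesgue_rV R k.+1).
Variable K : set 'rV[R]_k.+1.
Hypothesis bK : bounded_set K.
Hypothesis cK : convex_set (K : set (convex_lmodType 'rV[R]_k.+1)).
Hypothesis sK : forall x, K x -> K (- x).
Hypothesis iK : K° !=set0.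

Let sigma : {finite_measure set V -> \bar R} := fin_measure (boundary_measure_lty bK cK sK iK).

Definition dilate_rotate (rho : 'M[R]_k.+1) (z : measurableTypeR R * V) : V :=
  (z.1 : R) *: ((z.2 : 'rV[R]_k.+1) *m rho^T).

Lemma measurable_dilate_rotate rho : measurable_fun setT (dilate_rotate rho).
Proof.
apply: measurable_scalemx; first exact: measurable_fst.
by apply: measurable_mulmx; [exact: measurable_snd|exact: measurable_cst].
Qed.

Lemma gauge_distance_set_gt0 (rho : 'M[R]_k.+1) (E : set 'rV[R]_k.+1)
    (mu : {finite_measure set V -> \bar R}) :
  rho *m rho^T = 1%:M -> compact E -> mu setT != 0%E -> mu (~` E) = 0%E ->
  (forall j, (\int[scales j]_t energy mu sigma rho t < +oo)%E) ->
  (0 < leb (distance_set K (rotate rho E)))%E.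
Proof.
move=> rr cE mu0 muE fin.
have [m [M NN]] := gauge_norm_norm_like bK cK sK iK.
have [c [c0 [r0 [r00 hc]]]] := boundary_measure_ge bK cK sK iK.
have := @distance_set_measure_gt0 R k _ _ _ (norm_like_mulmx NN rr) mu sigma rho c r0 rr c0 r00
  (fun w r Nw rr0 => hc _ r Nw rr0) E cE mu0 muE.
rewrite (_ : distance_set K _ = [set gauge_norm K ((p.1 - p.2) *m rho^T) | p in E `*` E]); last first.
  apply/seteqP; split => [_ [[_ _] [/= [x Ex <-] [y Ey <-]] <-]|_ [[x y] [/= Ex Ey] <-]].
    by exists (x, y) => //=; rewrite mulmxBl.
  by exists (x *m rho^T, y *m rho^T) => /=; [split; [exists x|exists y]|rewrite mulmxBl].
apply => j; rewrite -ge0_integral_scales; first exact: fin.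
  exact: measurable_energy.
by move=> t; exact: energy_ge0.
Qed.

Lemma gauge_distance_set_averaged_gt0 (E : set 'rV[R]_k.+1)
    (mu : {finite_measure set V -> \bar R}) :
  compact E -> mu setT != 0%E -> mu (~` E) = 0%E ->
  (forall j, (\int[lambda]_xi ((Normc.normc (fourier mu xi) ^+ 2)%:E *
     averaged_fourier sigma (scales j) (dilate_rotate 1%:M) xi) < +oo)%E) ->
  (0 < leb (distance_set K E))%E.
Proof.
move=> cE mu0 muE fin.
have <- : rotate 1%:M E = E.
  apply/seteqP; split => [_ [x Ex <-]|x Ex]; first by rewrite trmx1 mulmx1.
  by exists x => //; rewrite trmx1 mulmx1.
apply: (gauge_distance_set_gt0 _ cE mu0 muE) => [|j]; first by rewrite trmx1 mulmx1.
have := fin j; rewrite -integral_averaged_fourier//.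
exact: measurable_dilate_rotate.
Qed.

Lemma enorm_dilate_ge t (xi : 'rV[R]_k.+1) j : j.+2%:R^-1 <= t ->
  j.+2%:R^-1 * `|xi| <= enorm (dilate_rotate 1%:M (t, xi) : 'rV[R]_k.+1).
Proof.
move=> jt; have j0 : 0 < j.+2%:R^-1 :> R by rewrite invr_gt0.
rewrite /dilate_rotate/= trmx1 mulmx1 enormZ ger0_norm; last by apply: le_trans jt; exact: ltW.
by rewrite ler_pM ?(ltW j0)// norm_le_enorm.
Qed.

Lemma distance_set_point : leb (distance_set K [set 0]) = 0%E.
Proof.
rewrite (_ : distance_set K [set 0] = [set 0]) ?lebesgue_measure_set1//.
have [m [M NN]] := gauge_norm_norm_like bK cK sK iK.
have N0 : gauge_norm K 0 = 0.
  apply/eqP; rewrite eq_le (norm_like_ge0 NN) andbT.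
  by have := norm_like_le NN 0; rewrite normr0 mulr0.
apply/seteqP; split => [_ [[x y] [/= -> ->] <-]|_ ->]; first by rewrite subrr N0.
by exists (0, 0); rewrite //= subrr.
Qed.

Section decay.
Variables (gamma C : R).
Hypotheses (gamma0 : 0 < gamma) (C0 : 0 < C).
Hypothesis decay : forall xi, xi != 0 ->
  Normc.normc (fourier (boundary_measure K) xi) <= C * enorm xi `^ (- gamma).

(** Kept apart from the choice of [mu]: it is applied to a Frostman measure and to the point mass
    that excludes [gamma > d]. *)
Let frostman_distance_set_gt0 (E : set 'rV[R]_k.+1) (mu : {finite_measure set V -> \bar R}) C' s :
  compact E -> (forall x, E x -> forall i, 0 <= x ord0 i <= 1) ->
  mu setT != 0%E -> mu (~` E) = 0%E -> 0 <= s -> k.+1%:R - s < gamma -> frostman mu C' s ->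
  (0 < leb (distance_set K E))%E.
Proof.
move=> cE E01 mu0 muE s0 sg muC.
apply: (gauge_distance_set_averaged_gt0 cE mu0 muE) => j.
pose T := fine (@scales R j setT).
have T1 : scales j setT = T%:E by rewrite fineK// fin_num_measure.
have T0 : 0 <= T by rewrite fine_ge0.
have j0 : 0 < j.+2%:R^-1 :> R by rewrite invr_gt0.
apply: (@frostman_decay_lty R k.+1 mu C' s gamma (C * j.+2%:R^-1 `^ (- gamma) * T) (2 * fine (sigma setT) * T)) => //.
- exact: null_unit_cubeC cE E01 muE.
- exact: ltW.
- by rewrite !mulr_ge0 ?powR_ge0// ltW.
- by rewrite !mulr_ge0// fine_ge0.
- by apply: measurable_averaged_fourier; exact: measurable_dilate_rotate.
- by move=> xi; exact: averaged_fourier_ge0.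
- move=> xi; apply: le_trans (averaged_fourier_le _ _ (measurable_dilate_rotate _) _) _.
  by rewrite T1 -EFinM.
move=> xi xi0; have x0 : 0 < `|xi| by rewrite normr_gt0.
rewrite mulrAC EFinM -T1; apply: le_integral_scales.
- apply/measurable_EFinP; apply: (measurableT_comp (measurable_normc_fourier sigma)).
  by apply: measurableT_comp (measurable_dilate_rotate _) _; exact: pair2_measurable.
- by move=> t; rewrite lee_fin normc_fourier_ge0.
- by rewrite !mulr_ge0 ?powR_ge0// ltW.
move=> t jt; have e0 := enorm_dilate_ge xi jt.
have ep : 0 < enorm (dilate_rotate 1%:M (t, xi) : 'rV[R]_k.+1).
  by apply: lt_le_trans e0; rewrite mulr_gt0.
rewrite lee_fin; apply: le_trans (decay _) _.
  by apply/eqP => z; rewrite z enorm0 ltxx in ep.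
rewrite -mulrA -powRM ?(ltW j0)// ler_wpM2l ?(ltW C0)// !powRN.
rewrite lef_pV2 ?posrE ?powR_gt0 ?mulr_gt0// ge0_ler_powR ?nnegrE ?(ltW ep)//;
  do ?[exact: ltW|by rewrite mulr_ge0// ltW].
Qed.

Lemma distance_set_decay_gt0 (E : set 'rV[R]_k.+1) : compact E ->
  (forall x, E x -> forall i, 0 <= x ord0 i <= 1) ->
  ((k.+1%:R - gamma)%:E < hausdorff_dim E)%E -> (0 < leb (distance_set K E))%E.
Proof.
move=> cE E01 dE.
have gd : gamma <= k.+1%:R.
  rewrite leNgt; apply/negP => gd.
  have [mu [mu0 muE muC]] := @frostman_point R k.
  have := @frostman_distance_set_gt0 _ mu 1 0 (@compact_set1 _ (0 : 'rV[R]_k.+1)) (@unit_cube0 R k.+1) mu0 muE (lexx 0).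
  by rewrite subr0 => /(_ gd muC); rewrite [X in (_ < X)%E]distance_set_point ltxx.
have d0 : 0 <= k.+1%:R - gamma by rewrite subr_ge0.
have [s [mu [C' [s0 ds mu0 muE muC]]]] := frostman_above cE E01 d0 dE.
by apply: (frostman_distance_set_gt0 cE E01 mu0 muE s0 _ muC); lra.
Qed.

End decay.

(** * Decay controlled by a convex function *)

Section convex_decay.
Variables (C : R) (gamma : R -> R).
Hypothesis C0 : 0 < C.
Hypothesis gamma_convex : convex_function ([set t | 0 <= t] : set (convex_lmodType R^o)) gamma.
Hypothesis gamma0 : gamma 0 = 0.
Hypothesis decay : forall xi, xi != 0 ->
  Normc.normc (fourier (boundary_measure K) xi) <= C * gamma (enorm xi)^-1.

(** Forced by the decay bound, since some frequency has norm [u^-1] and the modulus there is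
    nonnegative. *)
Let gamma_ge0 u : 0 < u -> 0 <= gamma u.
Proof.
move=> u0; have e1 : (const_mx 1 : 'rV[R]_k.+1) != 0.
  by apply/eqP => /rowP /(_ ord0); rewrite !mxE => /eqP; rewrite oner_eq0.
have := normalize (enorm_norm_like R (ltn0Sn k)) e1; set e := _ *: _ => en.
have ue : enorm (u^-1 *: e) = u^-1 by rewrite enormZ en mulr1 ger0_norm// invr_ge0 ltW.
have ue0 : u^-1 *: e != 0.
  by apply/eqP => z; move: ue; rewrite z enorm0 => /esym/eqP; rewrite invr_eq0 gt_eqF.
have := decay ue0; rewrite ue invrK => /(le_trans (normc_fourier_ge0 _ _)).
by rewrite pmulr_rge0.
Qed.

Let gamma_scale t v : 0 <= t <= 1 -> 0 <= v -> gamma (t * v) <= t * gamma v.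
Proof.
move=> t01 v0; have := gamma_convex (Itv01 (andP t01).1 (andP t01).2) (x := v) (y := 0).
rewrite !inE => /(_ v0 (lexx 0)); rewrite convRE /= gamma0 mulr0 addr0.
congr (gamma _ <= _); change (t *: (v : R^o) + (1 - t) *: (0 : R^o) = t * v).
by rewrite scaler0 addr0.
Qed.

Let gamma_nd u v : 0 < u -> u <= v -> gamma u <= gamma v.
Proof.
move=> u0 uv; have v0 : 0 < v by exact: lt_le_trans uv.
have uv01 : 0 <= u / v <= 1 by rewrite divr_ge0 ?(ltW u0) ?(ltW v0)//= ler_pdivrMr// mul1r.
have := gamma_scale uv01 (ltW v0); rewrite divfK ?gt_eqF// => /le_trans; apply.
by rewrite ler_piMl ?gamma_ge0//; case/andP: uv01.
Qed.

(** The values of [gamma] at negative numbers are arbitrary; cutting them off leaves a monotone,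
    hence measurable, function on the line. *)
Let gammap (u : R) : R := if 0 < u then gamma u else 0.

Let measurable_gammap : measurable_fun setT gammap.
Proof.
apply: nondecreasing_measurable => // u v uv; rewrite /gammap.
case: (ltP 0 u) => u0; last by case: ltP => // /gamma_ge0.
by rewrite (lt_le_trans u0 uv) gamma_nd.
Qed.

Lemma distance_set_convex_decay_gt0 (E : set 'rV[R]_k.+1) (mu : {finite_measure set V -> \bar R}) :
  compact E -> mu setT != 0%E -> mu (~` E) = 0%E ->
  (\int[lambda]_xi (Normc.normc (fourier mu xi) ^+ 2 * gamma (enorm xi)^-1)%:E < +oo)%E ->
  (0 < leb (distance_set K E))%E.
Proof.
move=> cE mu0 muE fin.
pose phi (xi : 'rV[R]_k.+1) := Normc.normc (fourier mu xi) ^+ 2.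
have phi0 xi : 0 <= phi xi by exact: sqr_ge0.
have mphi : measurable_fun setT (phi : V -> R).
  by apply: measurable_funX; exact: measurable_normc_fourier.
(* The Euclidean norm is at most [k.+1%:R * 2 ^+ i] on [cube (2 ^+ i)], so there
   [gamma (enorm xi)^-1] is at least [Gam i] for nonzero [xi]. *)
pose Gam i := gamma (k.+1%:R^-1 * 2^-1 ^+ i).
have K1 : 0 < k.+1%:R^-1 :> R by rewrite invr_gt0.
have arg0 i : 0 < k.+1%:R^-1 * 2^-1 ^+ i :> R by rewrite mulr_gt0// exprn_gt0// invr_gt0.
have Gam0 i : 0 <= Gam i by exact: gamma_ge0.
have Gam_half i : 2 * Gam i.+1 <= Gam i.
  rewrite /Gam exprS mulrCA; have h01 : 0 <= (2^-1 : R) <= 1 by lra.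
  by have := gamma_scale h01 (ltW (arg0 i)); lra.
have Gam_sum i0 N : \sum_(0 <= i < N) (if (i0 <= i)%N then Gam i else 0) <= 2 * Gam i0.
  (* Since [Gam] at least halves at each step, twice its next value bounds the rest of the series;
     adding it to the partial sum gives an inductive invariant. *)
  suff : \sum_(0 <= i < N) (if (i0 <= i)%N then Gam i else 0) + 2 * Gam (maxn i0 N) <= 2 * Gam i0.
    by have := Gam0 (maxn i0 N); lra.
  elim: N => [|N ih]; first by rewrite big_geq// add0r maxn0.
  rewrite big_nat_recr//=; case: leqP => iN.
    rewrite (maxn_idPr (leqW iN)); move: ih; rewrite (maxn_idPr iN); have := Gam_half N; lra.
  by rewrite addr0 (maxn_idPl iN); move: ih; rewrite (maxn_idPl (ltnW iN)).
pose F := ball_energy (diff_law mu mu).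
have FE r : F r = (\int[lambda]_(xi in cube r) (phi xi)%:E)%E.
  by apply: eq_integral => xi _; rewrite cosft_diff_law_self /phi normc_fourier2.
(* Sum and integral are exchanged. If [i0] is the first index with [xi] in [cube (2 ^+ i0)], only
   the terms from [i0] on are present, and they add up to at most [2 * Gam i0]. *)
have sumF : (\sum_(i <oo) (Gam i)%:E * F (2 ^+ i)%R < +oo)%E.
  pose pr i : V -> \bar R := ((fun xi : V => (phi xi)%:E) \_ (cube (2 ^+ i)%R)).
  have mpr i : measurable_fun setT (pr i).
    apply/(measurable_restrictT _ _).1; first exact: measurable_cube.
    by apply: measurable_funTS; exact/measurable_EFinP.
  have pr0 i xi : (0 <= pr i xi)%E by rewrite /pr patchE; case: ifP => // _; rewrite lee_fin.
  have mH : measurable_fun setT (fun xi : V => (phi xi * gamma (enorm (xi : 'rV[R]_k.+1))^-1)%:E).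
    apply/measurable_EFinP; apply: measurable_funM => //.
    rewrite (_ : (fun xi : V => _) = (fun xi : V => gammap (enorm (xi : 'rV[R]_k.+1))^-1)); last first.
      apply/funext => xi; rewrite /gammap; case: ltP => //.
      by rewrite invr_le0 => e0; rewrite (_ : enorm _ = 0) ?invr0//; apply/eqP; rewrite eq_le e0 enorm_ge0.
    apply: (measurableT_comp measurable_gammap).
    rewrite (_ : (fun xi : V => _) = (fun xi : V => enorm (xi : 'rV[R]_k.+1) `^ (-1))); last first.
      by apply/funext => xi; rewrite powR_inv1// enorm_ge0.
    apply: (measurableT_comp (measurable_powR (-1))).
    exact: measurable_norm_like (enorm_norm_like R (ltn0Sn k)).
  have H0 (xi : V) : (0 <= (phi xi * gamma (enorm (xi : 'rV[R]_k.+1))^-1)%:E)%E.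
    rewrite lee_fin mulr_ge0//; have [->|e0] := eqVneq (enorm (xi : 'rV[R]_k.+1)) 0.
      by rewrite invr0 gamma0.
    by rewrite gamma_ge0// invr_gt0 lt_neqAle eq_sym e0 enorm_ge0.
  apply: (@le_lt_trans _ _ (2%:E * \int[lambda]_xi (phi xi * gamma (enorm xi)^-1)%:E)%E); last first.
    by rewrite lte_mul_pinfty.
  have -> : (\sum_(i <oo) (Gam i)%:E * F (2 ^+ i)%R = \sum_(i <oo) \int[lambda]_xi ((Gam i)%:E * pr i xi))%E.
    by apply: eq_eseriesr => i _; rewrite ge0_integralZl_EFin// FE [in LHS]integral_mkcond.
  rewrite -integral_nneseries//; last 2 first.
  - by move=> i; exact: measurable_funeM.
  - by move=> i xi _; rewrite mule_ge0// lee_fin.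
  rewrite -ge0_integralZl_EFin//.
  apply: ae_ge0_le_integral => //.
  - by move=> xi _; apply: nneseries_ge0 => i _ _; rewrite mule_ge0// lee_fin.
  - by apply: ge0_emeasurable_sum => [i xi _ _|i _]; [rewrite mule_ge0// lee_fin|exact: measurable_funeM].
  - by move=> xi _; rewrite mule_ge0.
  - exact: measurable_funeM.
  (* The origin is excepted: there the inverse norm is [0^-1 = 0], so the right-hand side
     vanishes. *)
  exists (cube 0); split; first exact: measurable_cube.
    by apply: etrans (lebesgue_rV_cube _ (lexx 0)) _; rewrite mul0rn expr0n.
  move=> xi /= /not_implyP[_ h]; apply/(cube_norm _ (lexx 0)); rewrite normr_le0.
  apply: contraPT h => xi0 []; have x0 : 0 < `|xi : 'rV[R]_k.+1| by rewrite normr_gt0.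
  have ex : exists i, `[< cube (2 ^+ i : R) xi >].
    exists (Num.truncn `|xi : 'rV[R]_k.+1|).+1; apply/asboolP/cube_norm; first exact: exprn_ge0.
    apply: ltW; apply: lt_le_trans (truncnS_gt _) _; rewrite -natrX ler_nat; exact/ltnW/ltn_expl.
  case: (ex_minnP ex) => i0 /asboolP xi_i0 i0min.
  have ep : 0 < enorm (xi : 'rV[R]_k.+1) by apply: lt_le_trans (norm_le_enorm _).
  have Gi0 : Gam i0 <= gamma (enorm (xi : 'rV[R]_k.+1))^-1.
    apply: gamma_nd => //; rewrite exprVn -invfM lef_pV2 ?posrE ?mulr_gt0 ?exprn_gt0//.
    apply: le_trans (enorm_le_norm _) _; rewrite ler_wpM2l//.
    by apply/(cube_norm _ _) => //; exact: exprn_ge0.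
  apply: nneseries_le_bound => [i|N]; first by rewrite mule_ge0// lee_fin.
  apply: (@le_trans _ _ (\sum_(0 <= i < N) (phi xi * (if (i0 <= i)%N then Gam i else 0))%:E)%E).
    apply: lee_sum => i _; rewrite /pr patchE; case: ifPn => xi_i; last first.
      by rewrite mule0 lee_fin mulr_ge0//; case: ifP.
    have -> : (i0 <= i)%N by apply: i0min; apply/asboolP; move: xi_i; rewrite inE.
    by rewrite -EFinM lee_fin mulrC.
  rewrite sumEFin -mulr_sumr -EFinM lee_fin mulrCA ler_wpM2l//.
  by apply: le_trans (Gam_sum _ _) _; rewrite ler_wpM2l.
apply: (gauge_distance_set_averaged_gt0 cE mu0 muE) => j.
pose T := fine (@scales R j setT).
have T1 : scales j setT = T%:E by rewrite fineK// fin_num_measure.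
have T0 : 0 <= T by rewrite fine_ge0.
(* For [t] at least [j.+2%:R^-1] and [xi] outside [cube (2 ^+ (p + i))] the dilated frequency then
   has norm at least [k.+1%:R * 2 ^+ i]. Doubling pays for the shift with the factor
   [(34 ^+ k.+1) ^+ p.+1]. *)
have [p hp] : exists p, k.+1%:R * j.+2%:R <= 2 ^+ p :> R.
  by exists (k.+1 * j.+2)%N; rewrite -natrM -natrX ler_nat; exact/ltnW/ltn_expl.
pose g i := C * Gam i * T.
have g0 i : 0 <= g i by rewrite !mulr_ge0// ltW.
have Wg i (xi : 'rV[R]_k.+1) : ~ cube (2 ^+ (p + i)) xi ->
    (averaged_fourier sigma (scales j) (dilate_rotate 1%:M) xi <= (g i)%:E)%E.
  move=> hxi; have pi0 : 0 < 2 ^+ (p + i) :> R by rewrite exprn_gt0.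
  have xj : 2 ^+ (p + i) < `|xi|.
    by rewrite ltNge; apply/negP => /(cube_norm _ (ltW pi0)).
  rewrite /g EFinM -T1; apply: le_integral_scales.
  - apply/measurable_EFinP; apply: (measurableT_comp (measurable_normc_fourier sigma)).
    by apply: measurableT_comp (measurable_dilate_rotate _) _; exact: pair2_measurable.
  - by move=> t; rewrite lee_fin normc_fourier_ge0.
  - by rewrite mulr_ge0// ltW.
  move=> t jt; have e0 := enorm_dilate_ge xi jt.
  have e1 : k.+1%:R * 2 ^+ i <= enorm (dilate_rotate 1%:M (t, xi) : 'rV[R]_k.+1).
    apply: le_trans e0; rewrite ler_pdivlMl//; apply: le_trans (ltW xj).
    by rewrite mulrA exprD ler_wpM2r ?exprn_ge0// mulrC.
  have ep : 0 < enorm (dilate_rotate 1%:M (t, xi) : 'rV[R]_k.+1).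
    by apply: lt_le_trans e1; rewrite mulr_gt0// exprn_gt0.
  rewrite lee_fin; apply: le_trans (decay _) _.
    by apply/eqP => z; rewrite z enorm0 ltxx in ep.
  rewrite ler_wpM2l ?(ltW C0)// gamma_nd ?invr_gt0// exprVn -invfM.
  by rewrite lef_pV2 ?posrE ?mulr_gt0 ?exprn_gt0.
have S0 : 0 <= 2 * fine (sigma setT) * T by rewrite !mulr_ge0// fine_ge0.
have WS xi : (averaged_fourier sigma (scales j) (dilate_rotate 1%:M) xi <= (2 * fine (sigma setT) * T)%:E)%E.
  apply: le_trans (averaged_fourier_le _ _ (measurable_dilate_rotate _) _) _.
  by rewrite T1 -EFinM.
have mW : measurable_fun setT (averaged_fourier sigma (scales j) (dilate_rotate 1%:M)).
  by apply: measurable_averaged_fourier; exact: measurable_dilate_rotate.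
have hd := dyadic_energy_le mu mW (averaged_fourier_ge0 _ _ _) S0 g0 WS Wg.
apply: (le_lt_trans hd); apply: lte_add_pinfty.
  by rewrite lte_mul_pinfty ?lee_fin// ball_energy_lty.
pose D : R := C * T * (34 ^+ k.+1) ^+ p.+1.
have D0 : 0 <= D by rewrite !mulr_ge0 ?exprn_ge0// ltW.
apply: (@le_lt_trans _ _ (D%:E * \sum_(i <oo) (Gam i)%:E * F (2 ^+ i)%R)%E); last first.
  by rewrite lte_mul_pinfty ?lee_fin.
rewrite -nneseriesZl//; last by move=> i _; rewrite mule_ge0 ?lee_fin// ball_energy_ge0.
apply: lee_nneseries => [i *|i *]; first by rewrite mule_ge0 ?lee_fin// ball_energy_ge0.
have -> : (2 ^+ (p + i.+1) : R) = 2 ^+ p.+1 * 2 ^+ i by rewrite -exprD addnS addSn.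
have i0 : 0 < 2 ^+ i :> R by rewrite exprn_gt0.
apply: le_trans (lee_wpmul2l _ (ball_energy_scale mu p.+1 i0)) _; first by rewrite lee_fin.
rewrite !muleA -!EFinM le_eqVlt; apply/orP; left; apply/eqP; congr (_%:E * _)%E.
by rewrite /g /D; ring.
Qed.

End convex_decay.
End gauge_distance_sets.

(** * Rotations and the surface measure of the sphere *)

Section householder.
Context {R : realType} {n : nat}.
Implicit Types (e u v w : 'rV[R]_n) (rho kappa : 'M[R]_n).

(** The reflection in the hyperplane orthogonal to [u], when [u] is a unit vector. *)
Definition householder u : 'M[R]_n := 1%:M - 2 *: (u^T *m u).

Lemma mulmx_householder e u : e *m householder u = e - (2 * dotv e u) *: u.
Proof.
rewrite /householder mulmxBr mulmx1 -scalemxAr mulmxA; congr (_ - _).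
rewrite -scalerA; congr (_ *: _).
have -> : e *m u^T = (dotv e u)%:M; last by rewrite mul_scalar_mx.
by apply/rowP => j; rewrite ord1 !mxE mulr1n; apply: eq_bigr => i _; rewrite mxE.
Qed.

Lemma trmx_householder u : (householder u)^T = householder u.
Proof. by rewrite /householder linearB/= linearZ/= trmx1 trmx_mul trmxK. Qed.

Lemma householder_sqr u : enorm u = 1 -> householder u *m householder u = 1%:M.
Proof.
move=> u1; have uu : u *m u^T = 1%:M.
  apply/rowP => j; rewrite ord1 !mxE mulr1n -[RHS](expr1n _ 2) -u1 enorm_sqr.
  by apply: eq_bigr => i _; rewrite mxE.
rewrite {2}/householder mulmxBr mulmx1 -scalemxAr {1 2}/householder mulmxBl mul1mx -scalemxAl.
rewrite -mulmxA (mulmxA u) uu mul1mx scalerBr scalerA.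
by apply/matrixP => i j; rewrite !mxE; ring.
Qed.

Lemma householder_swap e v : enorm e = 1 -> enorm v = 1 -> e != v ->
  let u := (enorm (e - v))^-1 *: (e - v) in enorm u = 1 /\ e *m householder u = v.
Proof.
move=> e1 v1 ev u; have ev0 : 0 < enorm (e - v).
  by apply: lt_le_trans (norm_le_enorm _); rewrite normr_gt0 subr_eq0.
split; first by rewrite enormZ ger0_norm ?invr_ge0 ?enorm_ge0// mulVf// gt_eqF.
rewrite mulmx_householder /u (dotvC e) dotvZl scalerA.
rewrite (_ : 2 * _ / _ = 1) ?scale1r ?subKr//.
have de : dotv (e - v) e = 1 - dotv e v by rewrite dotvBl -enorm_sqr e1 expr1n (dotvC v).
have dv : dotv (e - v) v = dotv e v - 1 by rewrite dotvBl -[dotv v v]enorm_sqr v1 expr1n.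
have := enorm_sqr (e - v); rewrite dotvBl (dotvC e (e - v)) (dotvC v (e - v)) de dv.
move: (enorm (e - v)) ev0 (dotv e v) => x x0 y h.
have -> : 1 - y = x ^+ 2 / 2 by lra.
by field; rewrite gt_eqF.
Qed.

(** A reflection exchanging [u] and [v] conjugates one of the two reflections into the other. *)
Lemma det_householder u v : enorm u = 1 -> enorm v = 1 -> \det (householder u) = \det (householder v).
Proof.
move=> u1 v1; have [->//|uv] := eqVneq u v.
have [] := householder_swap u1 v1 uv; move: ((enorm (u - v))^-1 *: (u - v)) => w w1 uw.
have -> : householder v = householder w *m householder u *m householder w.
  have := householder_sqr w1; have := trmx_householder w; rewrite -uw.
  move: (householder w) => H Ht HH.
  rewrite /householder trmx_mul Ht mulmxBr mulmxBl mulmx1 HH; congr (_ - _).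
  by rewrite -scalemxAr -scalemxAl !mulmxA.
have := congr1 determinant (householder_sqr w1); rewrite !det_mulmx det1 => ww.
by rewrite mulrAC ww mul1r.
Qed.

Lemma orthogonal_unit e : (2 <= n)%N -> exists v, enorm v = 1 /\ dotv e v = 0.
Proof.
move=> n2; suff [x [x0 ex]] : exists x, x != 0 /\ dotv e x = 0.
  have xp : 0 < enorm x by apply: lt_le_trans (norm_le_enorm _); rewrite normr_gt0.
  exists ((enorm x)^-1 *: x); split.
    by rewrite enormZ ger0_norm ?invr_ge0 ?enorm_ge0// mulVf// gt_eqF.
  by rewrite dotvC dotvZl dotvC ex mulr0.
pose i : 'I_n := Ordinal (ltnW n2); pose j : 'I_n := Ordinal n2.
have ij : i != j by [].
have [ei|ei] := eqVneq (e ord0 i) 0.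
  exists (delta_mx ord0 i); split.
    by apply/eqP => /rowP /(_ i); rewrite !mxE !eqxx => /eqP; rewrite oner_eq0.
  rewrite /dotv (bigD1 i)//= ei mul0r add0r big1// => l li.
  by rewrite mxE (negbTE li) andbF mulr0.
exists (e ord0 j *: delta_mx ord0 i - e ord0 i *: delta_mx ord0 j); split.
  apply/eqP => /rowP /(_ j); rewrite !mxE !eqxx eq_sym (negbTE ij) mulr0 sub0r mulr1.
  by move/eqP; rewrite oppr_eq0 (negbTE ei).
rewrite /dotv (bigD1 i)//= (bigD1 j)//=.
rewrite !mxE !eqxx (negbTE ij) eq_sym (negbTE ij) /= big1 => [|l /andP[li lj]].
  by rewrite addr0; ring.
by rewrite !mxE (negbTE li) (negbTE lj) !mulr0 subr0 mulr0.
Qed.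

(** One reflection takes [e] to [v]; a second one, in a direction orthogonal to [v], fixes [v] and
    restores determinant 1. Such a direction exists because [2 <= n]. *)
Lemma special_orthogonal_transitive e v : (2 <= n)%N -> enorm e = 1 -> enorm v = 1 ->
  exists2 rho, special_orthogonal R n rho & e *m rho = v.
Proof.
move=> n2 e1 v1; have [->|ev] := eqVneq e v.
  by exists 1%:M; [split; rewrite ?trmx1 ?mulmx1 ?det1|rewrite mulmx1].
have [u1 eu] := householder_swap e1 v1 ev; move: u1 eu; set u := _ *: _ => u1 eu.
have [w [w1 vw]] := orthogonal_unit v n2.
exists (householder u *m householder w).
  split; last first.
    rewrite det_mulmx (det_householder w1 u1) -det_mulmx.
    by rewrite householder_sqr// det1.
  by rewrite trmx_mul !trmx_householder mulmxA -(mulmxA _ _ (householder w)) householder_sqr// mulmx1 householder_sqr.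
by rewrite mulmxA eu mulmx_householder vw mulr0 scale0r subr0.
Qed.

Lemma special_orthogonal_trmx rho : special_orthogonal R n rho -> special_orthogonal R n rho^T.
Proof. by move=> [rr d1]; split; [rewrite trmxK; exact: mulmx1C|rewrite det_tr]. Qed.

Lemma measurable_special_orthogonal : measurable (special_orthogonal R n : set (borel 'M[R]_n)).
Proof.
apply: measurableI.
  have mf : measurable_fun setT (fun rho : borel 'M[R]_n => (rho : 'M[R]_n) *m (rho : 'M[R]_n)^T : borel 'M[R]_n).
    by apply: measurable_mulmx; [exact: measurable_id|apply: measurable_trmx; exact: measurable_id].
  have m1 : measurable ([set 1%:M] : set (borel 'M[R]_n)).
    apply: closed_borel; apply: compact_closed; [exact: norm_hausdorff|exact: compact_set1].
  by have := mf measurableT _ m1; rewrite setTI.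
have md : measurable_fun setT (fun rho : borel 'M[R]_n => \det (rho : 'M[R]_n)).
  apply: measurable_sum => s; apply: measurable_funM; first exact: measurable_cst.
  elim: (index_enum _) => [|i r ih]; first by under eq_fun do rewrite big_nil; exact: measurable_cst.
  under eq_fun do rewrite big_cons; apply: measurable_funM => //; exact: measurable_coord.
have := md measurableT _ (measurable_set1 1); rewrite setTI; congr (measurable _).
Qed.

End householder.

Section rotated_surface.
Context {R : realType} {k : nat}.
Local Notation V := (borel 'rV[R]_k.+1).
Variable rho : 'M[R]_k.+1.
Hypothesis rr : rho *m rho^T = 1%:M.

Lemma hausdorff_outer_mulmx_le s (A : set 'rV[R]_k.+1) :
  (hausdorff_outer s [set (x : 'rV[R]_k.+1) *m rho | x in A] <= hausdorff_outer s A)%E.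
Proof.
apply: ge_ereal_sup => _ [e /= e0 <-]; apply: le_trans (cover_outer_le_hausdorff _ _ e0).
apply: le_cover_outer_image; first exact: diam_gauge_ge0.
move=> U; have dU : (ediam [set (x : 'rV[R]_k.+1) *m rho | x in U] = ediam U)%E.
  congr ereal_sup; apply/seteqP; split => [_ [[_ _] [/= [x Ux <-] [y Uy <-]] <-]|_ [[x y] [/= Ux Uy] <-]].
    by exists (x, y) => //=; rewrite -mulmxBl enorm_mulmx.
  by exists (x *m rho, y *m rho) => /=; [split; [exists x|exists y]|rewrite -mulmxBl enorm_mulmx].
rewrite /diam_gauge dU; case: asboolP => U0; case: asboolP => U1 //.
- by case: ifP => // _; rewrite ?poweR_ge0 ?leey.
- by exfalso; apply: U0; rewrite U1 image_set0.
Qed.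

Lemma surface_measure_mulmx_le (A : set 'rV[R]_k.+1) :
  (surface_measure R k.+1 [set (x : 'rV[R]_k.+1) *m rho | x in A] <= surface_measure R k.+1 A)%E.
Proof.
rewrite !surface_measureE lee_wpmul2l ?lee_fin ?surface_const_ge0//.
exact: hausdorff_outer_mulmx_le.
Qed.

End rotated_surface.

Section sphere_measure.
Context {R : realType} {k : nat}.
Local Notation V := (borel 'rV[R]_k.+1).

Lemma measurable_sphere : measurable (sphere : set V).
Proof.
have mN := measurable_norm_like (enorm_norm_like R (ltn0Sn k)).
by have := mN measurableT _ (measurable_set1 1); rewrite setTI.
Qed.

Let sphere_measure_lty : (mrestr (surface_measure R k.+1) measurable_sphere setT < +oo)%E.
Proof.
by rewrite /mrestr setTI; exact: surface_norm_sphere_lty (enorm_norm_like R (ltn0Sn k)).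
Qed.

Definition sphere_measure : {finite_measure set V -> \bar R} := fin_measure sphere_measure_lty.

Lemma sphere_measureE A : sphere_measure A = surface_measure R k.+1 (A `&` sphere).
Proof. by []. Qed.

Lemma sphere_measure_gt0 : (0 < sphere_measure setT)%E.
Proof.
have EN := enorm_norm_like R (ltn0Sn k).
have e1 : (const_mx 1 : 'rV[R]_k.+1) != 0.
  by apply/eqP => /rowP /(_ ord0); rewrite !mxE => /eqP; rewrite oner_eq0.
have en := normalize EN e1.
have [c [c0 [r0 [r00 hc]]]] := surface_norm_sphere_ge EN.
have rr : 0 < r0 <= r0 by rewrite r00 lexx.
apply: (@lt_le_trans _ _ (c * r0 ^+ k)%:E); first by rewrite lte_fin mulr_gt0// exprn_gt0.
apply: le_trans (hc _ _ en rr) _; rewrite sphere_measureE setTI !surface_measureE.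
rewrite lee_wpmul2l ?lee_fin ?surface_const_ge0//.
by apply: le_hausdorff_outer => x [].
Qed.

Lemma sphere_measure_rotate (rho : 'M[R]_k.+1) A : rho *m rho^T = 1%:M ->
  sphere_measure [set x : V | A ((x : 'rV[R]_k.+1) *m rho)] = sphere_measure A.
Proof.
move=> rr; have rr' : rho^T *m rho^T^T = 1%:M by rewrite trmxK; exact: mulmx1C.
rewrite !sphere_measureE; apply/eqP; rewrite eq_le; apply/andP; split.
  apply: le_trans (surface_measure_mulmx_le rr' _).
  rewrite !surface_measureE lee_wpmul2l ?lee_fin ?surface_const_ge0//.
  apply: le_hausdorff_outer => x [/= Ax x1]; exists (x *m rho).
    by split => //; rewrite /sphere/= enorm_mulmx.
  by rewrite -mulmxA rr mulmx1.
apply: le_trans (surface_measure_mulmx_le rr _).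
rewrite !surface_measureE lee_wpmul2l ?lee_fin ?surface_const_ge0//.
apply: le_hausdorff_outer => x [/= Ax x1]; exists (x *m rho^T).
  split => /=; first by rewrite -mulmxA (mulmx1C rr) mulmx1.
  by rewrite /sphere/= enorm_mulmx.
by rewrite -mulmxA (mulmx1C rr) mulmx1.
Qed.

Lemma integral_sphere_measure_rotate (rho : 'M[R]_k.+1) (g : V -> \bar R) :
  rho *m rho^T = 1%:M -> measurable_fun setT g -> (forall x, 0 <= g x)%E ->
  (\int[sphere_measure]_x g ((x : 'rV[R]_k.+1) *m rho) = \int[sphere_measure]_x g x)%E.
Proof.
move=> rr mg g0.
have mr : measurable_fun setT (fun x : V => (x : 'rV[R]_k.+1) *m rho : V).
  by apply: measurable_mulmx; [exact: measurable_id|exact: measurable_cst].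
rewrite -(ge0_integral_law sphere_measure mr mg g0).
by apply: eq_measure_integral => A mA _; exact: (sphere_measure_rotate A rr).
Qed.

End sphere_measure.

(** * Averaging over rotations *)

Section haar_average.
Local Open Scope ereal_scope.
Context {R : realType} {k : nat}.
Local Notation V := (borel 'rV[R]_k.+1).
Local Notation G := (borel 'M[R]_k.+1).
Local Notation Sm := (@sphere_measure R k).
Variable h : {measure set G -> \bar R}.
Hypothesis haar : haar_SO h.

Lemma haar_SO_lty : h setT < +oo.
Proof.
have [h0 /andP[_ hf] _] := haar; have mSO := @measurable_special_orthogonal R k.+1.
rewrite -(setUv (special_orthogonal R k.+1)).
apply: le_lt_trans (measureU2 _ _ _) _ => //; first exact: measurableC.
by rewrite [X in _ + X]h0 adde0.
Qed.

Definition haar_measure : {finite_measure set G -> \bar R} := fin_measure haar_SO_lty.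

Lemma haar_measure_gt0 : 0 < haar_measure setT.
Proof.
have [_ /andP[hp _] _] := haar; apply: lt_le_trans hp _.
by apply: le_measure; rewrite ?inE//; exact: measurable_special_orthogonal.
Qed.

Lemma haar_integral_eq (f g : G -> \bar R) : measurable_fun setT f -> measurable_fun setT g ->
  (forall rho, 0 <= f rho) -> (forall rho, 0 <= g rho) ->
  (forall rho, special_orthogonal R k.+1 rho -> f rho = g rho) ->
  \int[haar_measure]_rho f rho = \int[haar_measure]_rho g rho.
Proof.
move=> mf mg f0 g0 fg; apply: (@ge0_ae_eq_integral _ G R haar_measure setT f g) => //.
have mC : measurable (~` special_orthogonal R k.+1 : set G).
  exact: measurableC (@measurable_special_orthogonal R k.+1).
have [h0 _ _] := haar.
exists (~` special_orthogonal R k.+1); split => //.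
by move=> rho /not_implyP[_ nfg] so; apply: nfg; exact: fg.
Qed.

Lemma haar_integral_left (kappa : 'M[R]_k.+1) (f : G -> \bar R) : special_orthogonal R k.+1 kappa ->
  measurable_fun setT f -> (forall rho, 0 <= f rho) ->
  \int[haar_measure]_rho f (kappa *m (rho : 'M[R]_k.+1)) = \int[haar_measure]_rho f rho.
Proof.
move=> so mf f0.
have mk : measurable_fun setT (fun rho : G => kappa *m (rho : 'M[R]_k.+1) : G).
  by apply: measurable_mulmx; [exact: measurable_cst|exact: measurable_id].
rewrite -(ge0_integral_law haar_measure mk mf f0).
apply: eq_measure_integral => A mA _; have [_ _ hinv] := haar.
transitivity (h [set kappa^T *m g | g in A]); last exact: (hinv _ _ (special_orthogonal_trmx so) mA).
rewrite /law /pushforward /=; congr (h _); have [kk _] := so.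
apply/seteqP; split => [rho /= Ar|_ [g Ag <-]] /=.
  by exists (kappa *m rho) => //; rewrite mulmxA (mulmx1C kk) mul1mx.
by rewrite mulmxA kk mul1mx.
Qed.

Variable g : V -> \bar R.
Hypotheses (mg : measurable_fun setT g) (g0 : forall x, 0 <= g x).

(** Left invariance of [h] acts on [Ar]; the energies lead to [Al], since a rotation acts on rows
    through its transpose. *)
Let Ar (eta : 'rV[R]_k.+1) : \bar R := \int[haar_measure]_rho g (eta *m (rho : 'M[R]_k.+1)).
Let Al (eta : 'rV[R]_k.+1) : \bar R := \int[haar_measure]_rho g (eta *m (rho : 'M[R]_k.+1)^T).

Let mgr (eta : 'rV[R]_k.+1) : measurable_fun setT (fun rho : G => g (eta *m (rho : 'M[R]_k.+1))).
Proof.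
apply: (measurableT_comp mg).
by apply: measurable_mulmx; [exact: measurable_cst|exact: measurable_id].
Qed.

Let mgl (eta : 'rV[R]_k.+1) : measurable_fun setT (fun rho : G => g (eta *m (rho : 'M[R]_k.+1)^T)).
Proof.
apply: (measurableT_comp mg).
by apply: measurable_mulmx; [exact: measurable_cst|apply: measurable_trmx; exact: measurable_id].
Qed.

Let Ar_ge0 eta : 0 <= Ar eta. Proof. exact: integral_ge0. Qed.
Let Al_ge0 eta : 0 <= Al eta. Proof. exact: integral_ge0. Qed.

Let Ar_rotate (eta : 'rV[R]_k.+1) kappa : special_orthogonal R k.+1 kappa -> Ar (eta *m kappa) = Ar eta.
Proof.
move=> so; rewrite -[RHS](haar_integral_left so (mgr eta) (fun=> g0 _)).
by apply: eq_integral => rho _; rewrite mulmxA.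
Qed.

(* Haar measure is only assumed left invariant; averaging over a second copy
   of the group shows that it is invariant under inversion. *)
Let Al_Ar eta : Al eta = Ar eta.
Proof.
pose H := haar_measure setT.
have Hfin : H \is a fin_num by rewrite fin_num_measure.
have H0 : (0 < fine H)%R by apply: fine_gt0; rewrite haar_measure_gt0 ltey_eq Hfin.
suff : Al eta * H = Ar eta * H.
    have H1 : 0 < H by exact: haar_measure_gt0.
  by move=> e; apply/eqP; rewrite eq_le; apply/andP; split; rewrite -(lee_pmul2r Hfin H1) e.
rewrite -!integral_cst//.
pose F (z : G * G) := g (eta *m (z.2 : 'M[R]_k.+1)^T *m (z.1 : 'M[R]_k.+1)).
have mF : measurable_fun setT F.
  apply: (measurableT_comp mg); apply: measurable_mulmx; last exact: measurable_fst.
  by apply: measurable_mulmx; [exact: measurable_cst|apply: measurable_trmx; exact: measurable_snd].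
have F0 z : 0 <= F z by exact: g0.
have F10 kappa : 0 <= \int[haar_measure]_rho F (kappa, rho) by exact: integral_ge0.
have F20 rho : 0 <= \int[haar_measure]_kappa F (kappa, rho) by exact: integral_ge0.
have mF1 : measurable_fun setT (fun kappa => \int[haar_measure]_rho F (kappa, rho)).
  exact: (@measurable_fun_fubini_tonelli_F _ _ G G R haar_measure F mF F0).
have mF2 : measurable_fun setT (fun rho => \int[haar_measure]_kappa F (kappa, rho)).
  exact: (@measurable_fun_fubini_tonelli_G _ _ G G R haar_measure F mF F0).
transitivity (\int[haar_measure]_kappa \int[haar_measure]_rho F (kappa, rho)).
  apply: haar_integral_eq; [exact: measurable_cst|exact: mF1|by move=> ?; exact: Al_ge0|exact: F10|].
  move=> kappa so; rewrite /cst/=.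
  rewrite -[LHS](haar_integral_left (special_orthogonal_trmx so) (mgl eta) (fun=> g0 _)).
  by apply: eq_integral => rho _; rewrite /F/= trmx_mul trmxK mulmxA.
rewrite (@fubini_tonelli _ _ G G R haar_measure haar_measure F mF F0).
apply: haar_integral_eq; [exact: mF2|exact: measurable_cst|exact: F20|by move=> ?; exact: Ar_ge0|].
by move=> rho so; rewrite /cst/= -(Ar_rotate eta (special_orthogonal_trmx so)).
Qed.

(** By transitivity of SO(d), [Ar] depends only on the length of [eta], so it may be averaged over
    directions; after exchanging the integrals, each rotation preserves the sphere measure. *)
Lemma haar_average (eta : 'rV[R]_k.+1) : (2 <= k.+1)%N -> eta != 0%R ->
  Al eta * Sm setT =
  haar_measure setT * \int[surface_measure R k.+1]_(w in sphere) g (enorm eta *: (w : 'rV[R]_k.+1))%R.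
Proof.
move=> k2 eta0; set r := enorm eta.
have r0 : (0 < r)%R by apply: lt_le_trans (norm_le_enorm _); rewrite normr_gt0.
rewrite Al_Ar.
pose F (z : V * G) := g (r *: ((z.1 : 'rV[R]_k.+1) *m (z.2 : 'M[R]_k.+1)))%R.
have mF : measurable_fun setT F.
  apply: (measurableT_comp mg); apply: measurable_scalemx; first exact: measurable_cst.
  by apply: measurable_mulmx; [exact: measurable_fst|exact: measurable_snd].
have F0 z : 0 <= F z by exact: g0.
have mgs : measurable_fun setT (fun w : V => g (r *: (w : 'rV[R]_k.+1))%R).
  apply: (measurableT_comp mg); apply: measurable_scalemx; first exact: measurable_cst.
  exact: measurable_id.
rewrite -integral_cst//.
have mFF : measurable_fun setT (fun w => \int[haar_measure]_rho F (w, rho)).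
  exact: (@measurable_fun_fubini_tonelli_F _ _ V G R haar_measure F mF F0).
transitivity (\int[Sm]_w \int[haar_measure]_rho F (w, rho)).
  rewrite !ge0_integral_mrestr//; last 2 first.
  - by move=> w; exact: integral_ge0.
  - by move=> w; exact: Ar_ge0.
  apply: eq_integral => w; rewrite inE => w1; rewrite /cst/=.
  have e1 : enorm (r^-1 *: eta)%R = 1%R by rewrite enormZ ger0_norm ?invr_ge0 ?(ltW r0)// mulVf// gt_eqF.
  have [kappa so ek] := special_orthogonal_transitive k2 e1 w1.
  rewrite -(Ar_rotate eta so); apply: eq_integral => rho _.
  by rewrite /F/= -ek -!scalemxAl scalerA divff ?scale1r// gt_eqF.
rewrite (@fubini_tonelli _ _ V G R Sm haar_measure F mF F0).
transitivity (\int[haar_measure]_rho (cst (\int[Sm]_w g (r *: (w : 'rV[R]_k.+1))%R)) rho).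
  apply: haar_integral_eq => //.
  - exact: (@measurable_fun_fubini_tonelli_G _ _ V G R Sm F mF F0).
  - by move=> rho; exact: integral_ge0.
  - by move=> rho; exact: integral_ge0.
  move=> rho [rr _]; rewrite /cst/= -(integral_sphere_measure_rotate rr mgs (fun=> g0 _)).
  by [].
by rewrite integral_cst// muleC ge0_integral_mrestr.
Qed.

Lemma haar_average_le gamma C : (2 <= k.+1)%N ->
  (forall r, (0 < r)%R -> \int[surface_measure R k.+1]_(w in sphere) g (r *: (w : 'rV[R]_k.+1))%R
    <= (C * r `^ (- gamma))%:E) ->
  forall eta : 'rV[R]_k.+1, eta != 0%R ->
  \int[haar_measure]_rho g (eta *m (rho : 'M[R]_k.+1)^T) <=
    (fine (haar_measure setT) / fine (Sm setT) * C * enorm eta `^ (- gamma))%:E.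
Proof.
move=> k2 hC eta eta0; have hA := haar_average k2 eta0.
have r0 : (0 < enorm eta)%R by apply: lt_le_trans (norm_le_enorm _); rewrite normr_gt0.
have Sfin : Sm setT \is a fin_num by rewrite fin_num_measure.
have Hfin : haar_measure setT \is a fin_num by rewrite fin_num_measure.
have S0 : (0 < fine (Sm setT))%R.
  by apply: fine_gt0; rewrite sphere_measure_gt0 ltey_eq Sfin.
rewrite -(@lee_pmul2r _ (Sm setT))//; last exact: sphere_measure_gt0.
rewrite [leLHS]hA; apply: le_trans (lee_wpmul2l _ (hC _ r0)) _ => //.
rewrite -(fineK Sfin) -(fineK Hfin) -!EFinM lee_fin fineK//.
by rewrite le_eqVlt; apply/orP; left; apply/eqP; field; rewrite gt_eqF.
Qed.

End haar_average.

Section averaged_decay.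
Context {R : realType} {k : nat}.
Local Notation V := (borel 'rV[R]_k.+1).
Local Notation G := (borel 'M[R]_k.+1).
Local Notation leb := (@lebesgue_measure R).
Local Notation lambda := (lebesgue_rV R k.+1).
Variable K : set 'rV[R]_k.+1.
Hypothesis bK : bounded_set K.
Hypothesis cK : convex_set (K : set (convex_lmodType 'rV[R]_k.+1)).
Hypothesis sK : forall x, K x -> K (- x).
Hypothesis iK : K° !=set0.
Variable h : {measure set G -> \bar R}.
Hypothesis haar : haar_SO h.
Hypothesis k2 : (2 <= k.+1)%N.
Variables (gamma C : R).
Hypotheses (gamma0 : 0 < gamma) (C0 : 0 < C).
Hypothesis decay : forall r : R, 0 < r ->
  (\int[surface_measure R k.+1]_(w in sphere)
     (Normc.normc (fourier (boundary_measure K) (r *: w)))%:E <= (C * r `^ (- gamma))%:E)%E.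

Let sigma : {finite_measure set V -> \bar R} := fin_measure (boundary_measure_lty bK cK sK iK).
Let hf : {finite_measure set G -> \bar R} := haar_measure haar.
Let P j : {finite_measure set (measurableTypeR R * G)%type -> \bar R} := fin_product (@scales R j) hf.

Let f (z : (measurableTypeR R * G) * V) : V :=
  (z.1.1 : R) *: ((z.2 : 'rV[R]_k.+1) *m (z.1.2 : 'M[R]_k.+1)^T).

Let mf : measurable_fun setT f.
Proof.
apply: measurable_scalemx; first exact: (measurableT_comp measurable_fst measurable_fst).
apply: measurable_mulmx; first exact: measurable_snd.
apply: measurable_trmx; exact: (measurableT_comp measurable_snd measurable_fst).
Qed.

Let g (x : V) : \bar R := (Normc.normc (fourier sigma x))%:E.

Let mg : measurable_fun setT g.
Proof. by apply/measurable_EFinP; exact: measurable_normc_fourier. Qed.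

Let g0 x : (0 <= g x)%E.
Proof. by rewrite lee_fin normc_fourier_ge0. Qed.

(** Rotations are integrated first, at a fixed dilation [t]: the spherical bound then applies at
    radius [enorm (t *: xi)], which is at least [j.+2%:R^-1] times the norm of [xi]. *)
Let average_le j : exists2 B : R, 0 <= B & forall xi : 'rV[R]_k.+1, xi != 0 ->
  (averaged_fourier sigma (P j) f xi <= (B * `|xi| `^ (- gamma))%:E)%E.
Proof.
pose T := fine (@scales R j setT).
have T1 : scales j setT = T%:E by rewrite fineK// fin_num_measure.
have T0 : 0 <= T by rewrite fine_ge0.
have j0 : 0 < j.+2%:R^-1 :> R by rewrite invr_gt0.
pose D := fine (hf setT) / fine (@sphere_measure R k setT) * C.
have D0 : 0 <= D by rewrite !mulr_ge0 ?invr_ge0 ?fine_ge0// ltW.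
exists (D * j.+2%:R^-1 `^ (- gamma) * T); first by apply: mulr_ge0 => //; apply: mulr_ge0 => //; exact: powR_ge0.
move=> xi xi0; have x0 : 0 < `|xi| by rewrite normr_gt0.
have mgf : measurable_fun setT (fun z : measurableTypeR R * G => g (f (z, xi))).
  by apply: (measurableT_comp mg); apply: measurableT_comp mf _; exact: pair2_measurable.
have gf0 z : (0 <= g (f (z, xi)))%E by exact: g0.
have -> : averaged_fourier sigma (P j) f xi = (\int[scales j]_t \int[hf]_rho g (f ((t, rho), xi)))%E.
  exact: (@fubini_tonelli1 _ _ (measurableTypeR R) G R (scales j) hf _ mgf gf0).
rewrite mulrAC EFinM -T1; apply: le_integral_scales.
- exact: (@measurable_fun_fubini_tonelli_F _ _ (measurableTypeR R) G R hf _ mgf gf0).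
- by move=> t; exact: integral_ge0.
- by apply: mulr_ge0; [apply: mulr_ge0 => //|]; exact: powR_ge0.
move=> t jt; have t0 : 0 < t by exact: lt_le_trans jt.
have tx0 : t *: xi != 0 by rewrite scaler_eq0 negb_or gt_eqF.
have := haar_average_le haar mg g0 k2 decay tx0.
rewrite (_ : (\int[_]_rho _)%E = (\int[hf]_rho g (f ((t, rho), xi)))%E); last first.
  by apply: eq_integral => rho _; rewrite /f/= scalemxAl.
move/le_trans; apply; rewrite lee_fin -/D -[leRHS]mulrA ler_wpM2l//.
have le0 : j.+2%:R^-1 * `|xi| <= enorm (t *: xi).
  by rewrite enormZ gtr0_norm// ler_pM ?(ltW j0)// norm_le_enorm.
have e0 : 0 < enorm (t *: xi) by apply: lt_le_trans le0; rewrite mulr_gt0.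
rewrite -powRM ?(ltW j0)// !powRN.
by rewrite lef_pV2 ?posrE ?powR_gt0 ?mulr_gt0// ge0_ler_powR ?nnegrE ?(ltW e0)//;
  do ?[exact: ltW|by rewrite mulr_ge0// ltW].
Qed.

Let frostman_distance_set_ae (E : set 'rV[R]_k.+1) (mu : {finite_measure set V -> \bar R}) C' s :
  compact E -> (forall x, E x -> forall i, 0 <= x ord0 i <= 1) ->
  mu setT != 0%E -> mu (~` E) = 0%E -> 0 <= s -> k.+1%:R - s < gamma -> frostman mu C' s ->
  {ae h, forall rho, special_orthogonal R k.+1 rho ->
    (0 < leb (distance_set K (rotate rho E)))%E}.
Proof.
move=> cE E01 mu0 muE s0 sg muC.
have fin j : (\int[P j]_w \int[lambda]_xi (Normc.normc (fourier mu xi) ^+ 2 *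
    Normc.normc (fourier sigma (f (w, xi))))%:E < +oo)%E.
  rewrite integral_averaged_fourier//.
  have [B B0 hB] := average_le j.
  have PT : P j setT = (fine (P j setT))%:E by rewrite fineK// fin_num_measure.
  apply: (@frostman_decay_lty R k.+1 mu C' s gamma B (2 * fine (sigma setT) * fine (P j setT))) => //.
  - exact: null_unit_cubeC cE E01 muE.
  - exact: ltW.
  - by rewrite !mulr_ge0// fine_ge0.
  - exact: measurable_averaged_fourier.
  - by move=> xi; exact: averaged_fourier_ge0.
  - by move=> xi; apply: le_trans (averaged_fourier_le _ _ mf _) _; rewrite [X in (_ * X)%E]PT -EFinM.
pose X (z : measurableTypeR R * G) := energy mu sigma (z.2 : 'M[R]_k.+1) (z.1 : R).
have X0 z : (0 <= X z)%E by exact: energy_ge0.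
have mX : measurable_fun setT X.
  pose F (y : (measurableTypeR R * G) * V) : \bar R :=
    (Normc.normc (fourier mu y.2) ^+ 2 * Normc.normc (fourier sigma (f y)))%:E.
  apply: (@measurable_fun_fubini_tonelli_F _ _ (measurableTypeR R * G)%type V R lambda F).
    apply/measurable_EFinP; apply: measurable_funM.
      apply: measurable_funX; exact: (measurableT_comp (measurable_normc_fourier mu)) measurable_snd.
    exact: (measurableT_comp (measurable_normc_fourier sigma)) mf.
  by move=> y; rewrite lee_fin mulr_ge0 ?sqr_ge0// normc_fourier_ge0.
have ae j : {ae hf, forall rho, (\int[scales j]_t X (t, rho) < +oo)%E}.
  have i0 rho : (0 <= \int[scales j]_t X (t, rho))%E by exact: integral_ge0.
  have ih : hf.-integrable setT (fun rho => \int[scales j]_t X (t, rho))%E.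
    apply/integrableP; split.
      exact: (@measurable_fun_fubini_tonelli_G _ _ (measurableTypeR R) G R (scales j) X mX X0).
    have -> : (\int[hf]_rho `|\int[scales j]_t X (t, rho)| = \int[hf]_rho \int[scales j]_t X (t, rho))%E.
      by apply: eq_integral => rho _; apply: gee0_abs; exact: i0.
    rewrite -[Y in (Y < _)%E](@fubini_tonelli2 _ _ (measurableTypeR R) G R (scales j) hf X mX X0).
    exact: fin.
  apply: filterS (integrable_ae measurableT ih) => rho /(_ I) h'.
  by rewrite ltey_eq h'.
(* Countably many null sets of rotations, one for each [j], are merged into one. *)
have := ae_foralln ae; apply: filterS => rho hrho so.
have := @gauge_distance_set_gt0 R k K bK cK sK iK rho E mu so.1 cE mu0 muE.
apply => j; exact: hrho.
Qed.

Lemma distance_set_averaged_decay_ae (E : set 'rV[R]_k.+1) : compact E ->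
  (forall x, E x -> forall i, 0 <= x ord0 i <= 1) ->
  ((k.+1%:R - gamma)%:E < hausdorff_dim E)%E ->
  {ae h, forall rho, special_orthogonal R k.+1 rho ->
    (0 < leb (distance_set K (rotate rho E)))%E}.
Proof.
move=> cE E01 dE.
have gd : gamma <= k.+1%:R.
  rewrite leNgt; apply/negP => gd.
  have [mu [mu0 muE muC]] := @frostman_point R k.
  have := @frostman_distance_set_ae _ mu 1 0 (@compact_set1 _ (0 : 'rV[R]_k.+1)) (@unit_cube0 R k.+1) mu0 muE (lexx 0).
  (* The distance set of a point is null for every rotation, so the exceptional null set would
     contain SO(d), whose Haar measure is positive. *)
  rewrite subr0 => /(_ gd muC) [A [mA A0 subA]]; have [_ /andP[hp _] _] := haar.
  move: hp; rewrite ltNge => /negP; apply; rewrite -[leRHS]A0; apply: le_measure.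
  - by rewrite inE; exact: measurable_special_orthogonal.
  - by rewrite inE.
  move=> rho so; apply: subA => /= /(_ so).
  have -> : rotate rho [set 0] = [set 0].
    apply/seteqP; split => [_ [_ -> <-]|_ ->]; first by rewrite mul0mx.
    by exists 0; rewrite ?mul0mx.
  by rewrite [X in (_ < X)%E](distance_set_point bK cK sK iK) ltxx.
have d0 : 0 <= k.+1%:R - gamma by rewrite subr_ge0.
have [s [mu [C' [s0 ds mu0 muE muC]]]] := frostman_above cE E01 d0 dE.
by apply: (frostman_distance_set_ae cE E01 mu0 muE s0 _ muC); lra.
Qed.

End averaged_decay.

Theorem theorem0p1 (R : realType) (d : nat) (E K : set 'rV[R]_d) :
  (2 <= d)%N ->
  compact E ->
  (forall x, E x -> forall i, 0 <= x ord0 i <= 1) ->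
  bounded_set K ->
  convex_set (K : set (convex_lmodType 'rV[R]_d)) ->
  (forall x, K x -> K (- x)) ->
  K° !=set0 ->
  [/\ forall gamma C : R, 0 < gamma -> 0 < C ->
        (forall xi, xi != 0 ->
           Normc.normc (fourier (boundary_measure K) xi)
             <= C * enorm xi `^ (- gamma)) ->
        ((d%:R - gamma)%:E < hausdorff_dim E)%E ->
        (0 < lebesgue_measure (distance_set K E))%E,
      forall gamma C : R, 0 < gamma -> 0 < C ->
        (forall r : R, 0 < r ->
           (\int[surface_measure R d]_(w in sphere)
              (Normc.normc (fourier (boundary_measure K) (r *: w)))%:E
             <= (C * r `^ (- gamma))%:E)%E) ->
        ((d%:R - gamma)%:E < hausdorff_dim E)%E ->
        forall h : {measure set (borel 'M[R]_d) -> \bar R}, haar_SO h ->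
        {ae h, forall rho, special_orthogonal R d rho ->
          (0 < lebesgue_measure (distance_set K (rotate rho E)))%E}
    & forall (C : R) (gamma : R -> R), 0 < C ->
        convex_function
          ([set t | 0 <= t] : set (convex_lmodType R^o)) gamma ->
        gamma 0 = 0 ->
        (forall xi, xi != 0 ->
           Normc.normc (fourier (boundary_measure K) xi)
             <= C * gamma (enorm xi)^-1) ->
        (exists mu : {finite_measure set (borel 'rV[R]_d) -> \bar R},
          [/\ mu setT != 0%E, mu (~` E) = 0%E &
           (\int[lebesgue_rV R d]_xi
              (Normc.normc (fourier mu xi) ^+ 2 * gamma (enorm xi)^-1)%:E
             < +oo)%E]) ->
        (0 < lebesgue_measure (distance_set K E))%E].
Proof.
case: d E K => // k E K k2 cE E01 bK cK sK iK; split.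
- move=> gamma C g0 C0 decay.
  exact: (distance_set_decay_gt0 bK cK sK iK g0 C0 decay cE E01).
- move=> gamma C g0 C0 decay dE h haar.
  exact: (distance_set_averaged_decay_ae bK cK sK iK haar k2 g0 C0 decay cE E01 dE).
- move=> C gamma C0 cg g0 decay [mu [mu0 muE fin]].
  exact: (distance_set_convex_decay_gt0 bK cK sK iK C0 cg g0 decay cE mu0 muE fin).
Qed.
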